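(* Let $\alpha > -1$. For every holomorphic $\phi : \mathbb{H} \to \mathbb{H}$ such that the composition operator $C_\phi$ is bounded on $\mathcal{A}^2_\alpha(\mathbb{H})$, the essential norm of $C_\phi$ on $\mathcal{A}^2_\alpha(\mathbb{H})$ is equal to its operator norm. In particular, for every $\alpha > -1$, there are no compact composition operators on $\mathcal{A}^2_\alpha(\mathbb{H})$.
   Context: $\mathbb{H} = \{z \in \mathbb{C} : \Re z > 0\}$ is the right half-plane. For $\alpha > -1$, the weighted Bergman space $\mathcal{A}^2_\alpha(\mathbb{H})$ is the Hilbert space of analytic functions $F : \mathbb{H} \to \mathbb{C}$ with $\|F\|^2_{\mathcal{A}^2_\alpha(\mathbb{H})} := \frac{1}{\pi}\int_{-\infty}^\infty \int_0^\infty x^\alpha |F(x+iy)|^2\,dx\,dy < \infty$. For holomorphic $\phi : \mathbb{H} \to \mathbb{H}$, the composition operator is $C_\phi F = F \circ \phi$; it is bounded on $\mathcal{A}^2_\alpha(\mathbb{H})$ if it maps this space into itself as a bounded linear operator. The essential norm of a bounded operator $T$ is its distance to the compact operators, $\inf\{\|T - Q\| : Q \text{ compact on } \mathcal{A}^2_\alpha(\mathbb{H})\}$. *)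

(* Defs.v *)
From HB Require Import structures.
From mathcomp Require Import all_boot all_order all_algebra complex.
From mathcomp Require Import all_classical all_reals all_analysis.
From mathcomp Require Import measurable_realfun ring.
Set Implicit Arguments.
Unset Strict Implicit.
Unset Printing Implicit Defensive.
Import Order.TTheory GRing.Theory Num.Theory.
Import numFieldNormedType.Exports.
Local Open Scope classical_set_scope.
Local Open Scope ring_scope.
Local Open Scope complex_scope.

(* MathComp-Analysis puts a topology and a norm on [K^o] for an abstract
   [K : numFieldType]; this makes them canonical on the concrete field [R[i]]. *)
HB.instance Definition _ (R : rcfType) :=
  NormedModule.copy R[i] (R[i] : numFieldType)^o.

Section half_plane.
Context {R : realType}.

Definition rhp := {z : R[i] | 0 < complex.Re z}.

(* Extension by zero to the whole plane. It only serves to apply [derivable] and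
   the Lebesgue integral, both evaluated inside the open half-plane. *)
Definition rhp_ext (F : rhp -> R[i]) (z : R[i]) : R[i] :=
  if insub z is Some w then F w else 0.

Definition holomorphic (F : rhp -> R[i]) :=
  forall z : rhp, derivable (rhp_ext F) (val z) 1.

(* The square of the Bergman norm; [Normc.normc] is the real-valued modulus. *)
Definition bergman_integral (alpha : R) (F : rhp -> R[i]) : \bar R :=
  (pi^-1%:E * \int[lebesgue_measure]_y \int[lebesgue_measure]_(x in `]0%R, +oo[)
    (x `^ alpha * Normc.normc (rhp_ext F (x +i* y)) ^+ 2)%:E)%E.

Definition bergman_pred (alpha : R) : {pred rhp -> R[i]} :=
  [pred F | `[< holomorphic F /\ (bergman_integral alpha F < +oo)%E >]].

End half_plane.
Arguments rhp : clear implicits.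

Section cplx.
Context {R : realType}.
Implicit Types z w : R[i].

Lemma normcC z : `|z| = (Normc.normc z)%:C.
Proof. by []. Qed.

Lemma normc_ge0 z : 0 <= Normc.normc z.
Proof. by rewrite -lecR -normcC; exact: normr_ge0. Qed.

Lemma normc_gt0 z : (0 < Normc.normc z) = (z != 0).
Proof. by rewrite -ltcR -normcC -[RHS]normr_gt0. Qed.

End cplx.

Section open_prod.
Context {R : realType}.

Lemma open_prod_measurable (O : set (R * R)) : open O -> measurable O.
Proof.
move=> oO.
pose B (q1 q2 : rat) (n : nat) : set (R * R) :=
  ball (ratr q1 : R) n.+1%:R^-1 `*` ball (ratr q2 : R) n.+1%:R^-1.
suff -> : O = \bigcup_q1 \bigcup_q2 \bigcup_n
    (if `[< B q1 q2 n `<=` O >] then B q1 q2 n else set0).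
  apply: bigcupT_measurable_rat => q1; apply: bigcupT_measurable_rat => q2.
  apply: bigcupT_measurable => n; case: ifPn => // _.
  by apply: measurableX; apply: open_measurable; exact: ball_open.
apply/seteqP; split=> [[x y] Oxy|p [q1 _ [q2 _ [n _]]]]; last first.
  by case: ifPn => // /asboolP BO; exact: BO.
have /nbhs_ballP[e /= e0 eO] : nbhs (x, y) O by apply: open_nbhs_nbhs; split.
have [n nP] : exists n : nat, n.+1%:R^-1 < e / 2.
  have := near_infty_natSinv_lt (PosNum (divr_gt0 e0 (ltr0n _ 2))).
  by case=> n _ /(_ n (leqnn n)) /=; exists n.
have n0 : 0 < n.+1%:R^-1 :> R by rewrite invr_gt0.
have rat_near (t : R) : exists q : rat, `|ratr q - t| < n.+1%:R^-1.
  have tt : t - n.+1%:R^-1 < t + n.+1%:R^-1 by rewrite ltrD2l gtrN.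
  have [q] := rat_in_itvoo tt; rewrite in_itv /= => /andP[q1 q2].
  by exists q; rewrite ltr_norml; apply/andP; split;
    [rewrite ltrBrDr addrC | rewrite ltrBlDr addrC].
have [q1 q1P] := rat_near x; have [q2 q2P] := rat_near y.
exists q1 => //; exists q2 => //; exists n => //.
rewrite ifT; first by split; rewrite /= -ball_normE.
apply/asboolP => -[a b] /= [] /=; rewrite -!ball_normE /= => aq bq.
apply: eO; split; rewrite /= -ball_normE /=.
  rewrite (le_lt_trans (ler_distD (ratr q1) _ _))// [e]splitr ltrD//.
    by rewrite distrC (lt_trans q1P).
  by rewrite (lt_trans aq).
rewrite (le_lt_trans (ler_distD (ratr q2) _ _))// [e]splitr ltrD//.
  by rewrite distrC (lt_trans q2P).
by rewrite (lt_trans bq).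
Qed.
End open_prod.

Section ext.
Context {R : realType}.
Implicit Types (F G : rhp R -> R[i]).

Lemma rhp_extE F (z : rhp R) : rhp_ext F (val z) = F z.
Proof. by rewrite /rhp_ext valK. Qed.

Lemma rhp_ext_out F (z : R[i]) : ~~ (0 < complex.Re z) -> rhp_ext F z = 0.
Proof. by move=> z0; rewrite /rhp_ext insubN. Qed.

Lemma rhp_extD F G : rhp_ext (F + G) = rhp_ext F + rhp_ext G.
Proof.
apply/funext => z; rewrite !addrfctE /rhp_ext; case: insub => //=.
by rewrite addr0.
Qed.

Lemma rhp_extZ (c : R[i]) F : rhp_ext (c *: F) = c *: rhp_ext F.
Proof.
apply/funext => z; rewrite !scalrfctE /rhp_ext; case: insub => //=.
by rewrite scaler0.
Qed.

Lemma rhp_ext0 : rhp_ext (0 : rhp R -> R[i]) = 0.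
Proof. by apply/funext => z; rewrite /rhp_ext; case: insub. Qed.

Lemma holomorphic0 : holomorphic (0 : rhp R -> R[i]).
Proof. by move=> z; rewrite rhp_ext0; exact: derivable_cst. Qed.

Lemma holomorphicD F G : holomorphic F -> holomorphic G -> holomorphic (F + G).
Proof. by move=> hF hG z; rewrite rhp_extD; exact: derivableD. Qed.

Lemma holomorphicZ c F : holomorphic F -> holomorphic (c *: F).
Proof. by move=> hF z; rewrite rhp_extZ; exact: derivableZ. Qed.

Lemma complex_pair_continuous :
  continuous (fun p : R * R => (p.1 +i* p.2 : R[i])).
Proof.
move=> [x y]; apply/cvgrPdist_lt => e e0.
have eE : e = (complex.Re e)%:C by rewrite -[in RHS](gtr0_norm e0) -normcC gtr0_norm.
have e0' : 0 < complex.Re e by rewrite -ltcR -eE.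
have e2 : 0 < complex.Re e / 2 by rewrite divr_gt0.
apply: filterS (nbhsx_ballx (x, y) _ e2) => -[a b] [] /=; rewrite -!ball_normE /= => xa yb.
have -> : (x +i* y) - (a +i* b) = (x - a)%:C + ((y - b)%:C * 'i).
  by apply/eqP; rewrite eq_complex /= !(mulr0, mulr1, mul0r, addr0, add0r, subr0) !eqxx.
rewrite (le_lt_trans (ler_normD _ _))// normrM [`|'i|](_ : _ = 1) ?mulr1; last first.
  by rewrite normc_def /= expr0n expr1n add0r sqrtr1.
have -> : e = (complex.Re e / 2)%:C + (complex.Re e / 2)%:C.
  by rewrite -rmorphD /= -splitr.
by apply: ltrD; rewrite !normc_def /= expr0n addr0 sqrtr_sqr ltcR.
Qed.

Lemma holo_open (F : rhp R -> R[i]) (a : R) : holomorphic F -> 0 <= a ->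
  open [set p : R * R | a < Normc.normc (rhp_ext F (p.1 +i* p.2))].
Proof.
move=> hF a0; rewrite openE => -[x y] /= aF.
have x0 : 0 < complex.Re (x +i* y).
  apply: contraPT aF => /(rhp_ext_out F) ->; rewrite Normc.normc0.
  by apply/negP; rewrite -leNgt.
have := hF (Sub (x +i* y) x0); rewrite SubK => /derivable1_diffP dF.
have cF : rhp_ext F (p.1 +i* p.2) @[p --> (x, y)] --> rhp_ext F (x +i* y).
  apply: (cvg_comp _ (rhp_ext F) (@complex_pair_continuous (x, y))).
  exact: differentiable_continuous dF.
have := @cvgr_norm_gt _ _ _ _ _ _ _ cF a%:C.
rewrite normcC ltcR => /(_ _ aF).
by apply: filterS => p /=; rewrite normcC ltcR.
Qed.

Lemma holo_measurable F : holomorphic F ->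
  measurable_fun setT (fun p : R * R => Normc.normc (rhp_ext F (p.1 +i* p.2))).
Proof.
move=> hF; apply: (measurability _ (RGenOInfty.measurableE R)) => //.
move=> _ [_ [a ->] <-]; rewrite setTI.
have [a0|a0] := leP 0 a.
  apply: open_prod_measurable.
  rewrite [X in open X](_ : _ =
    [set p : R * R | a < Normc.normc (rhp_ext F (p.1 +i* p.2))]).
    exact: holo_open.
  by apply/seteqP; split => p /=; rewrite in_itv /= andbT.
rewrite [X in measurable X](_ : _ = setT)//.
apply/seteqP; split => p //= _; rewrite in_itv /= andbT.
by rewrite (lt_le_trans a0)// normc_ge0.
Qed.

End ext.

Section bergman_integral_theory.
Context {R : realType}.
Implicit Types (F G H : rhp R -> R[i]) (alpha : R).
Local Notation m := (@lebesgue_measure R).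

Let dens alpha F (p : R * R) : R :=
  p.1 `^ alpha * Normc.normc (rhp_ext F (p.1 +i* p.2)) ^+ 2.

Let dens_ge0 alpha F p : 0 <= dens alpha F p.
Proof. by rewrite mulr_ge0 ?powR_ge0 ?sqr_ge0. Qed.

Let measurable_dens alpha F : holomorphic F ->
  measurable_fun setT (EFin \o dens alpha F).
Proof.
move=> hF; apply/measurable_EFinP; apply: measurable_funM.
  exact: (measurableT_comp (measurable_powR alpha) measurable_fst).
exact: measurable_funX (holo_measurable hF).
Qed.

Let pi_inv_ge0 : (0 <= (pi^-1 : R)%:E)%E.
Proof. by rewrite lee_fin invr_ge0 pi_ge0. Qed.

Lemma bergman_integralE alpha F : holomorphic F ->
  bergman_integral alpha F = ((pi^-1)%:E * \int[m \x m]_p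
    (p.1 `^ alpha * Normc.normc (rhp_ext F (p.1 +i* p.2)) ^+ 2)%:E)%E.
Proof.
move=> hF; rewrite /bergman_integral; congr (_ * _)%E.
have d0 p : (0 <= (EFin \o dens alpha F) p)%E by rewrite lee_fin dens_ge0.
have FT := fubini_tonelli2 (m1 := m) (m2 := m) _ (measurable_dens alpha hF) d0.
suff -> : (fun y => \int[m]_(x in `]0%R, +oo[)
    (x `^ alpha * Normc.normc (rhp_ext F (x +i* y)) ^+ 2)%:E)%E =
    fubini_G m (EFin \o dens alpha F) by exact: esym FT.
apply/funext => y; rewrite /fubini_G [LHS]integral_mkcond.
congr (integral _ _ _); apply/funext => x; rewrite patchE; case: ifPn => //.
rewrite notin_setE /= in_itv /= andbT => /negP x0.
rewrite [RHS]/= /dens [in RHS]rhp_ext_out //.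
by rewrite Normc.normc0 expr0n /= mulr0.
Qed.

Let M : {measure set (measurableTypeR R * measurableTypeR R) -> \bar R} := (m \x m)%E.

Let J alpha F : \bar R := (\int[M]_p (EFin \o dens alpha F) p)%E.

Let bergman_integralJ alpha F : holomorphic F ->
  bergman_integral alpha F = (pi^-1%:E * J alpha F)%E.
Proof. exact: bergman_integralE. Qed.

Lemma bergman_integral_ge0 alpha F : (0 <= bergman_integral alpha F)%E.
Proof.
apply: mule_ge0 => //; apply: integral_ge0 => y _; apply: integral_ge0 => x _.
by rewrite lee_fin (dens_ge0 alpha F (x, y)).
Qed.

Lemma bergman_integral0 alpha : bergman_integral alpha (0 : rhp R -> R[i]) = 0%E.
Proof.
rewrite (bergman_integralJ _ holomorphic0) /J integral0_eq ?mule0// => p _.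
by rewrite /= /dens rhp_ext0 Normc.normc0 expr0n mulr0.
Qed.

Let dens_fin_ge0 alpha F p : (0 <= (EFin \o dens alpha F) p)%E.
Proof. by rewrite lee_fin dens_ge0. Qed.

Let JZ alpha F (k : R) : holomorphic F -> 0 <= k ->
  (\int[M]_p (k%:E * (EFin \o dens alpha F) p) = k%:E * J alpha F)%E.
Proof.
move=> hF k0; rewrite ge0_integralZl//; exact: measurable_dens.
Qed.

Lemma bergman_integralZ alpha c F : holomorphic F ->
  bergman_integral alpha (c *: F) =
  ((Normc.normc c ^+ 2)%:E * bergman_integral alpha F)%E.
Proof.
move=> hF; rewrite (bergman_integralJ _ hF).
rewrite (bergman_integralJ _ (@holomorphicZ _ c _ hF)) muleCA; congr (_ * _)%E.
rewrite -JZ ?sqr_ge0//; congr (integral _ _ _); apply/funext => p.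
rewrite /= -EFinM /dens rhp_extZ; congr EFin.
by rewrite scalrfctE Normc.normcM exprMn mulrCA.
Qed.

Let densD_le alpha F G (t : R) p : 0 < t -> t < 1 ->
  dens alpha (F + G) p <= t^-1 * dens alpha F p + (1 - t)^-1 * dens alpha G p.
Proof.
move=> t0 t1; have t1' : 0 < 1 - t by rewrite subr_gt0.
rewrite /dens rhp_extD addrfctE.
set u := rhp_ext F _; set v := rhp_ext G _.
rewrite [X in _ <= X + _]mulrCA [X in _ <= _ + X]mulrCA -mulrDr.
rewrite ler_wpM2l ?powR_ge0//.
have uv : Normc.normc (u + v) ^+ 2 <= (Normc.normc u + Normc.normc v) ^+ 2.
  rewrite ler_pXn2r// ?nnegrE ?addr_ge0 ?normc_ge0//; exact: le_normcD.
apply: le_trans uv _; rewrite -subr_ge0.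
set a := Normc.normc u; set b := Normc.normc v.
rewrite (_ : _ - _ = ((1 - t) * a - t * b) ^+ 2 / (t * (1 - t))).
  by rewrite divr_ge0 ?sqr_ge0// mulr_ge0// ltW.
by field; rewrite !gt_eqF.
Qed.

Lemma bergman_integralD_le alpha F G (t : R) : 0 < t -> t < 1 ->
  holomorphic F -> holomorphic G ->
  (bergman_integral alpha (F + G)%R <=
   (t^-1)%:E * bergman_integral alpha F +
   ((1 - t)^-1)%:E * bergman_integral alpha G)%E.
Proof.
move=> t0 t1 hF hG.
have ti0 : 0 <= t^-1 by rewrite invr_ge0 ltW.
have ti1 : 0 <= (1 - t)^-1 by rewrite invr_ge0 subr_ge0 ltW.
have J0 H : (0 <= J alpha H)%E by apply: integral_ge0.
rewrite (bergman_integralJ _ hF) (bergman_integralJ _ hG).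
rewrite (bergman_integralJ _ (holomorphicD hF hG)).
rewrite [X in (_ <= X + _)%E]muleCA [X in (_ <= _ + X)%E]muleCA.
rewrite -ge0_muleDr ?mule_ge0//.
apply: lee_wpmul2l => //; rewrite -!JZ//.
have mF := measurable_dens alpha hF; have mG := measurable_dens alpha hG.
have cF p : setT p -> (0 <= (t^-1)%:E * (EFin \o dens alpha F) p)%E.
  by move=> _; rewrite mule_ge0.
have cG p : setT p -> (0 <= ((1 - t)^-1)%:E * (EFin \o dens alpha G) p)%E.
  by move=> _; rewrite mule_ge0.
rewrite -(ge0_integralD M measurableT cF _ cG); [|exact: measurable_funeM..].
apply: ge0_le_integral => //.
- exact: measurable_dens (holomorphicD hF hG).
- by apply: emeasurable_funD; exact: measurable_funeM.
by move=> p _; rewrite /= -!EFinM -EFinD lee_fin densD_le.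
Qed.

Lemma bergman_integral_eq0 alpha F : holomorphic F ->
  bergman_integral alpha F = 0%E -> F = 0.
Proof.
move=> hF; rewrite (bergman_integralJ _ hF) => /eqP.
rewrite mule_eq0 eqe invr_eq0 gt_eqF ?pi_gt0//= => /eqP I0.
have mF := measurable_dens alpha hF.
have [+ _] := ae_eq_integral_abs M measurableT mF.
have -> : (\int[M]_p `|(EFin \o dens alpha F) p| = 0)%E.
  by rewrite -[RHS]I0; congr (integral _ _ _); apply/funext => p; rewrite gee0_abs.
move=> /(_ erefl) [N [mN N0 FN]].
apply/funext => z; apply/eqP; rewrite -[_ == _]negbK; apply/negP => Fz0.
pose O : set (R * R) :=
  [set p | 0 < Normc.normc (rhp_ext F (p.1 +i* p.2))].
have ON : O `<=` N.
  move=> p Op; apply: FN => /= /(_ I) [] /eqP.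
  rewrite mulf_eq0 powR_eq0 sqrf_eq0 (gt_eqF Op) orbF => /andP[/eqP p0 _].
  by move: Op; rewrite /O /= rhp_ext_out ?Normc.normc0 ?ltxx//= p0 ltxx.
have Oz : O (complex.Re (val z), complex.Im (val z)).
  have zE : complex.Re (val z) +i* complex.Im (val z) = val z by case: (val z).
  by rewrite /O /= zE rhp_extE normc_gt0.
have oO : open O by exact: holo_open.
have /nbhs_ballP[e /= e0 eO] :
    nbhs (complex.Re (val z), complex.Im (val z)) O.
  by apply: open_nbhs_nbhs; split.
set x := complex.Re (val z) in eO; set y := complex.Im (val z) in eO.
have mB (w : R) : measurable (ball w e) by apply: open_measurable; exact: ball_open.
have : (M (ball x e `*` ball y e) <= M N)%E.
  apply: le_measure; rewrite ?inE.
  - exact: (measurableX (mB x) (mB y)).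
  - exact: mN.
  by apply: subset_trans ON => -[a b] [/= xa yb]; apply: eO.
have -> : M (ball x e `*` ball y e) = (m (ball x e) * m (ball y e))%E.
  exact (product_measure1E m m (mB x) (mB y)).
rewrite N0 (lebesgue_measure_ball x (ltW e0)) (lebesgue_measure_ball y (ltW e0)).
rewrite -EFinM lee_fin.
by rewrite leNgt mulr_gt0// mulrn_wgt0.
Qed.

End bergman_integral_theory.

Section bergman_space.
Context {R : realType}.
Variable alpha : R.
Implicit Types (F G : rhp R -> R[i]).

Lemma bergman_predP F : reflect
  (holomorphic F /\ (bergman_integral alpha F < +oo)%E) (F \in bergman_pred alpha).
Proof. exact: asboolP. Qed.

Lemma bergman_submod_closed : submod_closed (@bergman_pred R alpha).
Proof.
split=> [|c F G /bergman_predP[hF iF] /bergman_predP[hG iG]].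
  by apply/bergman_predP; split; [exact: holomorphic0|rewrite bergman_integral0].
have hcF := @holomorphicZ _ c _ hF.
apply/bergman_predP; split; first exact: holomorphicD.
have h0 : 0 < 2^-1 :> R by rewrite invr_gt0.
have h1 : 2^-1 < 1 :> R by rewrite invf_lt1// ltr1n.
apply: le_lt_trans (bergman_integralD_le alpha h0 h1 hcF hG) _.
rewrite bergman_integralZ// lte_add_pinfty//.
  rewrite lte_mul_pinfty// ?lee_fin ?invr_ge0//.
  by rewrite lte_mul_pinfty// ?lee_fin ?sqr_ge0.
by rewrite lte_mul_pinfty// lee_fin invr_ge0 subr_ge0 ltW.
Qed.

HB.instance Definition _ := GRing.isSubmodClosed.Build R[i] (rhp R -> R[i])
  (bergman_pred alpha) bergman_submod_closed.

Record bergman := Bergman {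
  bergman_fun :> rhp R -> R[i];
  bergman_funP : bergman_fun \in bergman_pred alpha }.

HB.instance Definition _ := [isSub for bergman_fun].
HB.instance Definition _ := [Choice of bergman by <:].
HB.instance Definition _ := [SubChoice_isSubLmodule of bergman by <:].

Definition bergman_norm (F : bergman) : R :=
  Num.sqrt (fine (bergman_integral alpha F)).

Lemma bergman_holomorphic (F : bergman) : holomorphic F.
Proof. by have /bergman_predP[] := bergman_funP F. Qed.

Lemma bergman_integral_fin (F : bergman) :
  bergman_integral alpha F \is a fin_num.
Proof.
have /bergman_predP[_ ?] := bergman_funP F.
by rewrite ge0_fin_numE// bergman_integral_ge0.
Qed.

Lemma bergman_norm_sqr (F : bergman) :
  (bergman_norm F ^+ 2)%:E = bergman_integral alpha F.
Proof.
by rewrite sqr_sqrtr ?fineK ?bergman_integral_fin// fine_ge0// bergman_integral_ge0.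
Qed.

Lemma bergman_norm_ge0 (F : bergman) : 0 <= bergman_norm F.
Proof. exact: sqrtr_ge0. Qed.

Lemma bergman_norm_eq0 (F : bergman) : bergman_norm F = 0 -> F = 0.
Proof.
move=> F0; apply/val_inj/(bergman_integral_eq0 (@bergman_holomorphic F) (alpha := alpha)).
by rewrite /= -bergman_norm_sqr F0 expr0n.
Qed.

Lemma bergman_normZ c (F : bergman) :
  bergman_norm (c *: F) = Normc.normc c * bergman_norm F.
Proof.
apply/eqP; rewrite -(@eqrXn2 _ 2)// ?bergman_norm_ge0 ?mulr_ge0 ?normc_ge0 ?bergman_norm_ge0//.
apply/eqP/EFin_inj; rewrite bergman_norm_sqr exprMn [in RHS]EFinM bergman_norm_sqr.
exact: bergman_integralZ (@bergman_holomorphic F).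
Qed.

Let le_add_sqr (a b c : R) : 0 < a -> 0 < b -> 0 <= c ->
  (forall t, 0 < t -> t < 1 ->
     c ^+ 2 <= t^-1 * a ^+ 2 + (1 - t)^-1 * b ^+ 2) -> c <= a + b.
Proof.
move=> a0 b0 c0 abc; have ab0 : 0 < a + b := addr_gt0 a0 b0.
rewrite -(@ler_pXn2r _ 2)// ?nnegrE ?(ltW ab0)//.
have t1 : a / (a + b) < 1 by rewrite ltr_pdivrMr// mul1r ltrDl.
apply: le_trans (abc (a / (a + b)) (divr_gt0 a0 ab0) t1) _.
rewrite le_eqVlt; apply/orP; left; apply/eqP; field.
by rewrite !gt_eqF// addrAC subrr add0r.
Qed.

Lemma bergman_normD (F G : bergman) :
  bergman_norm (F + G) <= bergman_norm F + bergman_norm G.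
Proof.
have [/bergman_norm_eq0 ->|F0] := eqVneq (bergman_norm F) 0.
  by rewrite add0r lerDr bergman_norm_ge0.
have [/bergman_norm_eq0 ->|G0] := eqVneq (bergman_norm G) 0.
  by rewrite addr0 lerDl bergman_norm_ge0.
have {}F0 : 0 < bergman_norm F by rewrite lt_def F0 bergman_norm_ge0.
have {}G0 : 0 < bergman_norm G by rewrite lt_def G0 bergman_norm_ge0.
apply: (le_add_sqr F0 G0 (bergman_norm_ge0 (F + G))) => t t0 t1.
have := bergman_integralD_le alpha t0 t1
  (@bergman_holomorphic F) (@bergman_holomorphic G).
rewrite -(bergman_norm_sqr F) -(bergman_norm_sqr G) -!EFinM -EFinD.
have /= <- := bergman_norm_sqr (F + G).
by rewrite lee_fin.
Qed.

Let norm (F : bergman) : R[i] := (bergman_norm F)%:C.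

Let norm_ler_normD (F G : bergman) : norm (F + G) <= norm F + norm G.
Proof. by rewrite -rmorphD lecR bergman_normD. Qed.

Let norm_normrZ c (F : bergman) : norm (c *: F) = `|c| * norm F.
Proof. by rewrite normcC -rmorphM /norm bergman_normZ. Qed.

Let norm_normr0_eq0 (F : bergman) : norm F = 0 -> F = 0.
Proof. by move=> /complexI /bergman_norm_eq0. Qed.

HB.instance Definition _ := Lmodule_isNormed.Build R[i] bergman
  norm_ler_normD norm_normrZ norm_normr0_eq0.

Lemma bergman_normE (F : bergman) : `|F| = (bergman_norm F)%:C.
Proof. by []. Qed.

End bergman_space.
Arguments bergman {R} alpha.

Section operators.
Context {R : realType} {V : normedModType R[i]}.

(* The norm of a [normedModType R[i]] takes its (real) values in [R[i]], hence the
   injection [%:C] and the projection [complex.Re] below. *)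
Definition bounded_operator (T : {linear V -> V}) :=
  exists M : R, forall v, `|T v| <= M%:C * `|v|.

Definition compact_operator (T : {linear V -> V}) :=
  precompact (T @` [set v | `|v| <= 1]).

Definition operator_norm (T : {linear V -> V}) : R :=
  sup [set complex.Re `|T v| | v in [set v | `|v| <= 1]].

Definition essential_norm (T : {linear V -> V}) : R :=
  inf [set operator_norm (T \- Q) | Q in compact_operator].

End operators.

(* [C F = F \o phi] for all [F]: such a [C] exists exactly when composition with
   [phi] maps the Bergman space into itself, and it is then unique. *)
Definition composition_operator {R : realType} {alpha : R}
    (phi : rhp R -> rhp R) (C : {linear bergman alpha -> bergman alpha}) :=
  forall F : bergman alpha, C F = F \o phi :> (rhp R -> R[i]).

(* Main.v *)
Require Import Defs.
From HB Require Import structures.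
From mathcomp Require Import all_boot all_order all_algebra complex.
From mathcomp Require Import all_classical all_reals all_analysis.
From mathcomp Require Import measurable_realfun ring lra.
Set Implicit Arguments.
Unset Strict Implicit.
Unset Printing Implicit Defensive.
Import Order.TTheory GRing.Theory Num.Theory.
Import numFieldNormedType.Exports.
Local Open Scope classical_set_scope.
Local Open Scope ring_scope.
Local Open Scope complex_scope.

(** Put [beta = (2 + alpha) / 2] and [rho z = Re z / Re (phi z)]. The operator norm of
    the composition operator [C] and its distance to any compact operator [Q] are both
    compared with the numbers [rho z ^ beta].

    Upper bound, [bergman_comp_le]: if [l Re z <= Re (phi z)] everywhere, then
    [||C|| <= l ^ (- beta)]. For [l' < l] and [x > 0], the value of [|F| ^ 2] at
    [phi (x + iy)] is at most its Poisson integral from the line [Re z = l' x].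
    Integrating over [y], one is left with the integrals over [y] of the real parts of
    [1 / (phi (x + iy) - l' x - is)], which Poisson's formula again bounds by [pi / l].
    Thus composition with [phi] contracts the mean squares on vertical lines, from
    [Re z = l' x] to [Re z = x], by the factor [1 / l] ([line_contraction]).
    Integration against [x ^ alpha] yields the bound as [l'] tends to [l].

    Lower bound, [essential_lower_bound]: if [Q] is compact and [||C v - Q v|| <= N] on
    the unit ball, then [rho z ^ beta <= N] for every [z]. Affine maps act on the space
    with explicit norms, so the evaluation at [w] has the norm [c * Re w ^ (- beta)] for a
    constant [c], positive because the space contains a nonzero function. By Julia's
    lemma [rho] is nondecreasing to the right along horizontal lines
    ([half_plane_map_julia]). For each function [H] of the space,
    [H w * Re w ^ beta] tends to 0 along such a line, because [H] has a finite total
    mass, and it does so uniformly on precompact sets. Hence a compact operator does not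
    contribute to evaluations far to the right, where [C] multiplies the norm of the
    evaluation by [rho w ^ beta].

    With [N = ||C - Q||] the lower bound gives [l Re z <= Re (phi z)] for
    [l = N ^ (- 1 / beta)], and then the upper bound gives [||C|| <= N]. So no compact
    [Q] brings [C - Q] below [||C||], and [Q = 0] attains it. For a compact [C] the
    choice [Q = C], [N = 0] contradicts [rho > 0].

    The complex analysis rests on complex derivability alone: Goursat's theorem by
    bisection ([goursat]), Cauchy's formula on rectangles ([cauchy_rect]), the bound of a
    value by an area integral ([local_mean]), and Poisson's formula in a half-plane with
    an explicit error term ([poisson_trunc]). *)

(** * Integrals of continuous functions over segments *)
Section interval_integral.
Context {R : realType}.
Implicit Types (f g : R -> R) (a b c k : R).

Definition itgl f a b : R := (\int[lebesgue_measure]_(x in `[a, b]) f x)%R.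

(** Continuity from both sides, also at the end points: the functions integrated
    below are continuous on a neighbourhood of the segment. *)
Definition cts_on f a b := forall x, a <= x <= b -> {for x, continuous f}.

Lemma cts_on_within f a b : cts_on f a b -> {within `[a, b], continuous f}.
Proof.
move=> cf; apply: continuous_in_subspaceT => x; rewrite inE /= in_itv /=; exact: cf.
Qed.

Lemma cts_on_integrable f a b : cts_on f a b ->
  lebesgue_measure.-integrable `[a, b] (EFin \o f).
Proof.
move=> cf; apply: continuous_compact_integrable; first exact: segment_compact.
exact: cts_on_within.
Qed.

Lemma cts_onS f a b a' b' : cts_on f a b -> a <= a' -> b' <= b -> cts_on f a' b'.
Proof.
move=> cf aa bb x /andP[ax xb]; apply: cf.
by rewrite (le_trans aa ax) (le_trans xb bb).
Qed.

Lemma itgl_split f a b c : a <= b -> b <= c -> cts_on f a c ->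
  itgl f a c = itgl f a b + itgl f b c.
Proof.
move=> ab bc cf; rewrite /itgl.
have ic := cts_on_integrable cf.
have ib := cts_on_integrable (cts_onS cf ab (lexx _)).
have := @Rintegral_itvB _ f (BLeft a) (BRight c) b ic.
rewrite !bnd_simp => /(_ ab bc) E.
rewrite -(@Rintegral_itv_obnd_cbnd _ b (BRight c)) -?E ?subrKC//.
by apply: integrableS ib => //; apply: subset_itvr; rewrite bnd_simp.
Qed.

Lemma eq_itgl f g a b : (forall x, a <= x <= b -> f x = g x) -> itgl f a b = itgl g a b.
Proof.
by move=> fg; apply: eq_Rintegral => x; rewrite inE /= in_itv /=; exact: fg.
Qed.

Lemma itgl_cst k a b : a <= b -> itgl (fun=> k) a b = k * (b - a).
Proof.
move=> ab; rewrite /itgl Rintegral_cst//; congr (_ * _).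
have := @lebesgue_measure_itv R `[a, b]; rewrite /= lte_fin => ->.
case: ltP => //= ba; first by apply/eqP; rewrite eq_sym subr_eq0 eq_le ab ba.
Qed.

Lemma itglB f g a b : cts_on f a b -> cts_on g a b ->
  itgl (fun x => f x - g x) a b = itgl f a b - itgl g a b.
Proof. by move=> cf cg; rewrite /itgl RintegralB//; exact: cts_on_integrable. Qed.

Lemma itglZ f k a b : cts_on f a b -> itgl (fun x => k * f x) a b = k * itgl f a b.
Proof. by move=> cf; rewrite /itgl RintegralZl//; exact: cts_on_integrable. Qed.

Lemma le_itgl f g a b : cts_on f a b -> cts_on g a b ->
  (forall x, a <= x <= b -> f x <= g x) -> itgl f a b <= itgl g a b.
Proof.
move=> cf cg fg; apply: le_Rintegral => //.
- exact: cts_on_integrable.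
- exact: cts_on_integrable.
Qed.

Lemma cts_on_cst k a b : cts_on (fun=> k) a b.
Proof. by move=> x _; exact: cvg_cst. Qed.

Lemma cts_onB f g a b : cts_on f a b -> cts_on g a b -> cts_on (fun x => f x - g x) a b.
Proof. by move=> cf cg x xab; apply: cvgB; [exact: cf|exact: cg]. Qed.

Lemma cts_onM f g a b : cts_on f a b -> cts_on g a b -> cts_on (fun x => f x * g x) a b.
Proof. by move=> cf cg x xab; apply: cvgM; [exact: cf|exact: cg]. Qed.

Lemma itgl_near_cst f k M a b : a <= b -> cts_on f a b ->
  (forall x, a <= x <= b -> `|f x - k| <= M) ->
  `|itgl f a b - k * (b - a)| <= M * (b - a).
Proof.
move=> ab cf fM; rewrite -!itgl_cst// -itglB//; last exact: cts_on_cst.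
rewrite ler_norml; apply/andP; split.
  have -> : - itgl (fun=> M) a b = itgl (fun=> - M) a b by rewrite !itgl_cst// mulNr.
  apply: le_itgl; [exact: cts_on_cst|by apply: cts_onB => //; exact: cts_on_cst|].
  by move=> x /fM; rewrite ler_norml => /andP[].
apply: le_itgl; [by apply: cts_onB => //; exact: cts_on_cst|exact: cts_on_cst|].
by move=> x /fM; rewrite ler_norml => /andP[].
Qed.

Lemma itgl_norm_le f M a b : a <= b -> cts_on f a b ->
  (forall x, a <= x <= b -> `|f x| <= M) -> `|itgl f a b| <= M * (b - a).
Proof.
move=> ab cf fM; have := @itgl_near_cst f 0 M a b ab cf.
by rewrite mul0r subr0; apply => x /fM; rewrite subr0.
Qed.

End interval_integral.

(** * Additive functions of rectangles *)
Section rectangle_bisection.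
Context {R : realType}.

Let mid_le (a b : R) : a <= b -> a <= (a + b) / 2 /\ (a + b) / 2 <= b.
Proof. by move=> ab; split; lra. Qed.

Let mid_width (a b : R) :
  (a + b) / 2 - a = (b - a) / 2 /\ b - (a + b) / 2 = (b - a) / 2.
Proof. by split; field. Qed.

Let quarter_pick (w x y z t : R) : w <= x + y + (z + t) ->
  x < w / 4 -> y < w / 4 -> z < w / 4 -> w / 4 <= t.
Proof. lra. Qed.

(** Bisection. One of the four quarters of a rectangle carries at least a quarter
    of the modulus of [w]; the nested rectangles so obtained shrink to a point
    while the ratio of [|w|] to the square of their size stays bounded below,
    against the local estimate at that point. *)
Lemma rect_additive_eq0 (w : R -> R -> R -> R -> R) (a b c d : R) :
  a <= b -> c <= d ->
  (forall a' m b' c' d', a <= a' -> a' <= m -> m <= b' -> b' <= b ->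
    c <= c' -> c' <= d' -> d' <= d -> w a' b' c' d' = w a' m c' d' + w m b' c' d') ->
  (forall a' b' c' m d', a <= a' -> a' <= b' -> b' <= b ->
    c <= c' -> c' <= m -> m <= d' -> d' <= d -> w a' b' c' d' = w a' b' c' m + w a' b' m d') ->
  (forall x y e, a <= x <= b -> c <= y <= d -> 0 < e ->
    exists2 r, 0 < r & forall a' b' c' d', a <= a' -> a' <= x -> x <= b' -> b' <= b ->
      c <= c' -> c' <= y -> y <= d' -> d' <= d -> b' - a' < r -> d' - c' < r ->
      `|w a' b' c' d'| <= e * ((b' - a') + (d' - c')) ^+ 2) ->
  w a b c d = 0.
Proof.
move=> ab cd wH wV wloc; apply/eqP; rewrite -normr_eq0 eq_le normr_ge0 andbT.
rewrite leNgt; apply/negP => w0.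
pose ok (p : R * R * R * R) := let: (a', b', c', d') := p in
  [/\ a <= a', a' <= b', b' <= b & [/\ c <= c', c' <= d' & d' <= d]].
pose W (p : R * R * R * R) := let: (a', b', c', d') := p in `|w a' b' c' d'|.
pose child (p q : R * R * R * R) := let: (a1, b1, c1, d1) := p in
  let: (a2, b2, c2, d2) := q in
  [/\ [/\ a1 <= a2, b2 <= b1, c1 <= c2 & d2 <= d1],
      b2 - a2 = (b1 - a1) / 2 , d2 - c2 = (d1 - c1) / 2 & W p / 4 <= W q].
have step p : ok p -> {q | ok q /\ child p q}.
  case: p => [[[a1 b1] c1] d1] /= [aa1 ab1 b1b [cc1 cd1 d1d]]; apply: cid.
  pose m := (a1 + b1) / 2; pose n := (c1 + d1) / 2.
  have [am mb] := mid_le ab1; have [cn nd] := mid_le cd1.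
  have [amE mbE] := mid_width a1 b1; have [cnE ndE] := mid_width c1 d1.
  rewrite -/m in am mb amE mbE; rewrite -/n in cn nd cnE ndE.
  have am' := le_trans aa1 am; have mb' := le_trans mb b1b.
  have cn' := le_trans cc1 cn; have nd' := le_trans nd d1d.
  have E : w a1 b1 c1 d1 = (w a1 m c1 n + w a1 m n d1) + (w m b1 c1 n + w m b1 n d1).
    by rewrite (wH a1 m b1 c1 d1)// (wV a1 m c1 n d1)// (wV m b1 c1 n d1).
  have Q : `|w a1 b1 c1 d1| <=
      `|w a1 m c1 n| + `|w a1 m n d1| + (`|w m b1 c1 n| + `|w m b1 n d1|).
    by rewrite E (le_trans (ler_normD _ _))// lerD// ler_normD.
  have [h1|h1] := leP (`|w a1 b1 c1 d1| / 4) `|w a1 m c1 n|.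
    by exists (a1, m, c1, n).
  have [h2|h2] := leP (`|w a1 b1 c1 d1| / 4) `|w a1 m n d1|.
    by exists (a1, m, n, d1).
  have [h3|h3] := leP (`|w a1 b1 c1 d1| / 4) `|w m b1 c1 n|.
    by exists (m, b1, c1, n).
  have h4 := quarter_pick Q h1 h2 h3.
  by exists (m, b1, n, d1).
pose st (p : {p | ok p}) : {p | ok p} :=
  exist ok (sval (step _ (svalP p))) (svalP (step _ (svalP p))).1.
have ok0 : ok (a, b, c, d) by [].
pose P n := iter n st (exist ok _ ok0).
pose A n := (sval (P n)).1.1.1; pose B n := (sval (P n)).1.1.2.
pose C n := (sval (P n)).1.2; pose D n := (sval (P n)).2.
have PE n : sval (P n) = (A n, B n, C n, D n).
  by rewrite /A /B /C /D; case: (sval (P n)) => [[[? ?] ?] ?].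
have okn n : ok (A n, B n, C n, D n) by rewrite -PE; exact: svalP (P n).
have chn n : child (A n, B n, C n, D n) (A n.+1, B n.+1, C n.+1, D n.+1).
  by rewrite -!PE; exact: (svalP (step _ (svalP (P n)))).2.
have width n : [/\ B n - A n = (b - a) / 2 ^+ n, D n - C n = (d - c) / 2 ^+ n &
    `|w a b c d| / 4 ^+ n <= `|w (A n) (B n) (C n) (D n)|].
  elim: n => [|n [IH1 IH2 IH3]]; first by rewrite !expr0 !divr1.
  have [_ -> -> /= h] := chn n; rewrite IH1 IH2 !exprSr !invfM !mulrA; split => //.
  by apply: le_trans h; rewrite ler_wpM2r.
have mono m n : (m <= n)%N -> [/\ A m <= A n, B n <= B m, C m <= C n & D n <= D m].
  elim: n => [|n IH]; first by rewrite leqn0 => /eqP ->.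
  rewrite leq_eqVlt => /predU1P[->//|/IH [h1 h2 h3 h4]].
  have [[g1 g2 g3 g4] _ _ _] := chn n.
  by split; [exact: le_trans h1 g1|exact: le_trans g2 h2|exact: le_trans h3 g3|exact: le_trans g4 h4].
have AB m n : A m <= B n.
  have [h1 _ _ _] := mono m _ (leq_maxl m n); have [_ h2 _ _] := mono n _ (leq_maxr m n).
  by have [_ h _ _] := okn (maxn m n); exact: le_trans h1 (le_trans h h2).
have CD m n : C m <= D n.
  have [_ _ h1 _] := mono m _ (leq_maxl m n); have [_ _ _ h2] := mono n _ (leq_maxr m n).
  by have [_ _ _ [_ h _]] := okn (maxn m n); exact: le_trans h1 (le_trans h h2).
pose x := sup (range A); pose y := sup (range C).
have hA : has_sup (range A) by split; [exists (A 0), 0 | exists (B 0) => _ [n _ <-]].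
have hC : has_sup (range C) by split; [exists (C 0), 0 | exists (D 0) => _ [n _ <-]].
have Ax n : A n <= x by apply: ub_le_sup; [exact: hA.2|exists n].
have Cy n : C n <= y by apply: ub_le_sup; [exact: hC.2|exists n].
have xB n : x <= B n by apply: ge_sup => [|_ [m _ <-]]; first exact: hA.1.
have yD n : y <= D n by apply: ge_sup => [|_ [m _ <-]]; first exact: hC.1.
have xab : a <= x <= b by rewrite (Ax 0) (xB 0).
have ycd : c <= y <= d by rewrite (Cy 0) (yD 0).
pose s := (b - a) + (d - c).
have s0 : 0 <= s by rewrite addr_ge0// subr_ge0.
have s1 : 0 < s ^+ 2 + 1 by rewrite ltr_wpDl// sqr_ge0.
(* the constant for which the local estimate contradicts the lower bound on |w| *)
have [r r0 rP] := wloc x y (`|w a b c d| / (s ^+ 2 + 1)) xab ycd (divr_gt0 w0 s1).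
have [n sn] : exists n, s / 2 ^+ n < r.
  have [n nP] : exists n : nat, s / r < n%:R.
    exists (Num.bound (s / r)); have /archi_boundP// : 0 <= s / r by rewrite divr_ge0// ltW.
  exists n; rewrite ltr_pdivrMr ?exprn_gt0// mulrC -ltr_pdivrMr//.
  by apply: lt_trans nP _; rewrite -natrX ltr_nat ltn_expl.
have [h1 h2 h3] := width n.
have [aA ABn Bb [cC CDn Dd]] := okn n.
have n2 : 0 < 2 ^- n :> R by rewrite invr_gt0 exprn_gt0.
have hr1 : B n - A n < r by rewrite h1; apply: le_lt_trans sn; rewrite ler_pM2r// lerDl subr_ge0.
have hr2 : D n - C n < r by rewrite h2; apply: le_lt_trans sn; rewrite ler_pM2r// lerDr subr_ge0.
have := rP _ _ _ _ aA (Ax n) (xB n) Bb cC (Cy n) (yD n) Dd hr1 hr2.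
move=> /(le_trans h3); rewrite h1 h2 -mulrDl -/s expr_div_n -exprM mulnC exprM.
have -> : 2 ^+ 2 = 4 :> R by rewrite -natrX.
rewrite mulrA ler_pM2r ?invr_gt0 ?exprn_gt0//.
rewrite mulrAC ler_pdivlMr//; rewrite mulrDr mulr1.
by rewrite gerDl leNgt w0.
Qed.

End rectangle_bisection.

(** * Complex derivability and Goursat's theorem *)
Section complex_plane.
Context {R : realType}.
Implicit Types (f g q : R[i] -> R[i]) (z w : R[i]).

Lemma Re_le_normc z : `|complex.Re z| <= Normc.normc z.
Proof. by rewrite -lecR -normcC; exact: normc_ge_Re. Qed.

Lemma Im_le_normc z : `|complex.Im z| <= Normc.normc z.
Proof.
have := Re_le_normc (z * - 'i).
rewrite Normc.normcM (_ : Normc.normc (- 'i) = 1).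
  by rewrite mulr1; case: z => a b /=; rewrite !(mulr0, mulrN, mulrN1, mulr1, sub0r, opprK, oppr0, add0r).
by rewrite /= oppr0 expr0n /= add0r sqrrN expr1n sqrtr1.
Qed.

Lemma normc_le_ReIm z : Normc.normc z <= `|complex.Re z| + `|complex.Im z|.
Proof.
case: z => a b /=.
rewrite -(@ler_pXn2r _ 2)// ?nnegrE ?sqrtr_ge0 ?addr_ge0//.
rewrite sqr_sqrtr ?addr_ge0 ?sqr_ge0// sqrrD !real_normK ?num_real//.
by rewrite addrAC lerDl mulrn_wge0// mulr_ge0.
Qed.

Lemma normc_sqr z : Normc.normc z ^+ 2 = complex.Re z ^+ 2 + complex.Im z ^+ 2.
Proof. by case: z => a b /=; rewrite sqr_sqrtr// addr_ge0// sqr_ge0. Qed.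

Lemma normcN z : Normc.normc (- z) = Normc.normc z.
Proof. by apply: complexI; rewrite -!normcC normrN. Qed.

Lemma normcX z n : Normc.normc (z ^+ n) = Normc.normc z ^+ n.
Proof. by elim: n => [|n IH]; rewrite ?Normc.normc1// !exprS Normc.normcM IH. Qed.

Lemma ReB z w : complex.Re (z - w) = complex.Re z - complex.Re w.
Proof. by case: z w => ? ? [? ?]. Qed.

Lemma ImB z w : complex.Im (z - w) = complex.Im z - complex.Im w.
Proof. by case: z w => ? ? [? ?]. Qed.

Lemma ReImK z : complex.Re z +i* complex.Im z = z.
Proof. by case: z. Qed.

Lemma derivable_local f z : derivable f z 1 ->
  exists L, forall e : R, 0 < e -> exists2 r : R, 0 < r &
    forall h, Normc.normc h < r ->
      Normc.normc (f (z + h) - f z - L * h) <= e * Normc.normc h.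
Proof.
move=> /derivable_nbhs; set L := 'D_1 f z => /eqaddoP dL; exists L => e e0.
have /dL/nbhs_ballP[r /= r0 rP] : 0 < e%:C by rewrite ltcR.
have rE : r = (complex.Re r)%:C by rewrite RRe_real// gtr0_real.
have r0' : 0 < complex.Re r by rewrite -ltcR -rE.
exists (complex.Re r) => // h hr.
have /rP : ball 0 r h by rewrite -ball_normE /= sub0r normrN normcC rE ltcR.
rewrite /= !fctE /= -lecR rmorphM /= -!normcC [h *: 1]mulr1 [h *: L]mulrC (addrC h z).
by rewrite opprD addrA.
Qed.

Lemma derivable_mul f g z : derivable f z 1 -> derivable g z 1 ->
  derivable (fun t => f t * g t) z 1.
Proof. by move=> df dg; exact (@derivableM R[i] R[i] f g z 1 df dg). Qed.

Lemma derivable_inv f z : f z != 0 -> derivable f z 1 ->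
  derivable (fun t => (f t)^-1) z 1.
Proof. by move=> f0 df; exact (@derivableV R[i] R[i] f z 1 f0 df). Qed.

Lemma derivable_add f g z : derivable f z 1 -> derivable g z 1 ->
  derivable (fun t => f t + g t) z 1.
Proof. by move=> df dg; exact: (@derivableD _ _ _ f g z 1 df dg). Qed.

Lemma derivable_const w z : derivable (fun=> w) z 1.
Proof. exact: derivable_cst. Qed.

Lemma derivable_ident z : derivable (fun t : R[i] => t) z 1.
Proof. exact: derivable_id. Qed.

Lemma derivable_continuous f z : derivable f z 1 -> {for z, continuous f}.
Proof. by move=> /derivable1_diffP df; exact: differentiable_continuous. Qed.

Lemma continuous_Re : continuous (@complex.Re R : R[i] -> R).
Proof.
move=> z; apply/(@cvgrPdist_lt _ _ _ (nbhs z)) => e e0.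
apply/nbhs_ballP; exists e%:C => [|t] /=; first by rewrite ltcR.
rewrite -ball_normE /= normcC ltcR.
apply: le_lt_trans; have := Re_le_normc (z - t).
by case: z t => a b [c d].
Qed.

Lemma continuous_Im : continuous (@complex.Im R : R[i] -> R).
Proof.
move=> z; apply/(@cvgrPdist_lt _ _ _ (nbhs z)) => e e0.
apply/nbhs_ballP; exists e%:C => [|t] /=; first by rewrite ltcR.
rewrite -ball_normE /= normcC ltcR.
apply: le_lt_trans; have := Im_le_normc (z - t).
by case: z t => a b [c d].
Qed.

Lemma continuous_hline (y : R) : continuous (fun x => x +i* y : R[i]).
Proof.
move=> x; apply: (@continuous_comp _ _ _ (fun x : R => (x, y))
  (fun p : R * R => p.1 +i* p.2 : R[i]) x); last exact: complex_pair_continuous.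
by apply: (@cvg_pair _ _ _ (nbhs x) (nbhs x) (nbhs y) _ _ _ id (fun=> y)); [exact: cvg_id|exact: cvg_cst].
Qed.

Lemma continuous_vline (x : R) : continuous (fun y => x +i* y : R[i]).
Proof.
move=> y; apply: (@continuous_comp _ _ _ (fun y : R => (x, y))
  (fun p : R * R => p.1 +i* p.2 : R[i]) y); last exact: complex_pair_continuous.
by apply: (@cvg_pair _ _ _ (nbhs y) (nbhs x) (nbhs y) _ _ _ (fun=> x) id); [exact: cvg_cst|exact: cvg_id].
Qed.

(** Continuity of [f] at the points of a horizontal, resp. vertical, segment;
    contours avoid the poles of [f], so it is required on the segments only. *)
Definition hcont f y a b := forall x, a <= x <= b -> {for x +i* y, continuous f}.
Definition vcont f x c d := forall y, c <= y <= d -> {for x +i* y, continuous f}.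

Lemma hcont_Im f y a b : hcont f y a b -> cts_on (fun x => complex.Im (f (x +i* y))) a b.
Proof.
move=> h x xab; apply: continuous_comp (@continuous_Im _).
exact: (continuous_comp (@continuous_hline y x) (h x xab)).
Qed.

Lemma vcont_Re f x c d : vcont f x c d -> cts_on (fun y => complex.Re (f (x +i* y))) c d.
Proof.
move=> h y yab; apply: continuous_comp (@continuous_Re _).
exact: (continuous_comp (@continuous_vline x y) (h y yab)).
Qed.

Lemma hcontS f y a b a' b' : hcont f y a b -> a <= a' -> b' <= b -> hcont f y a' b'.
Proof.
by move=> h aa bb x /andP[ax xb]; apply: h; rewrite (le_trans aa)//= (le_trans xb).
Qed.

Lemma vcontS f x a b a' b' : vcont f x a b -> a <= a' -> b' <= b -> vcont f x a' b'.
Proof.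
by move=> h aa bb y /andP[ax xb]; apply: h; rewrite (le_trans aa)//= (le_trans xb).
Qed.

(** The imaginary part of the integral of [f dz] along the boundary of the
    rectangle [[a, b] x [c, d]], counterclockwise. This is the part from which
    Cauchy's formula recovers the real part of a function. *)
Definition contour_im f (a b c d : R) : R :=
  itgl (fun x => complex.Im (f (x +i* c)) - complex.Im (f (x +i* d))) a b +
  itgl (fun y => complex.Re (f (b +i* y)) - complex.Re (f (a +i* y))) c d.

Lemma contour_imE f a b c d :
  hcont f c a b -> hcont f d a b -> vcont f a c d -> vcont f b c d ->
  contour_im f a b c d =
    (itgl (fun x => complex.Im (f (x +i* c))) a b -
     itgl (fun x => complex.Im (f (x +i* d))) a b) +
    (itgl (fun y => complex.Re (f (b +i* y))) c d -
     itgl (fun y => complex.Re (f (a +i* y))) c d).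
Proof.
move=> /hcont_Im hc /hcont_Im hd /vcont_Re va /vcont_Re vb.
by rewrite /contour_im (itglB hc hd) (itglB vb va).
Qed.

Lemma contour_im_hsplit f a m b c d : a <= m -> m <= b ->
  hcont f c a b -> hcont f d a b ->
  vcont f a c d -> vcont f m c d -> vcont f b c d ->
  contour_im f a b c d = contour_im f a m c d + contour_im f m b c d.
Proof.
move=> am mb hc hd va vm vb.
have hc1 := hcontS hc (lexx _) mb; have hc2 := hcontS hc am (lexx _).
have hd1 := hcontS hd (lexx _) mb; have hd2 := hcontS hd am (lexx _).
rewrite (contour_imE hc hd va vb) (contour_imE hc1 hd1 va vm) (contour_imE hc2 hd2 vm vb).
rewrite (itgl_split am mb (hcont_Im hc)) (itgl_split am mb (hcont_Im hd)).
ring.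
Qed.

Lemma contour_im_vsplit f a b c m d : c <= m -> m <= d ->
  hcont f c a b -> hcont f m a b -> hcont f d a b ->
  vcont f a c d -> vcont f b c d ->
  contour_im f a b c d = contour_im f a b c m + contour_im f a b m d.
Proof.
move=> cm md hc hm hd va vb.
have va1 := vcontS va (lexx _) md; have va2 := vcontS va cm (lexx _).
have vb1 := vcontS vb (lexx _) md; have vb2 := vcontS vb cm (lexx _).
rewrite (contour_imE hc hd va vb) (contour_imE hc hm va1 vb1) (contour_imE hm hd va2 vb2).
rewrite (itgl_split cm md (vcont_Re va)) (itgl_split cm md (vcont_Re vb)).
ring.
Qed.

Definition derivable_rect f a b c d :=
  forall x y, a <= x <= b -> c <= y <= d -> derivable f (x +i* y) 1.

(** To first order [f] is affine at [z]. The horizontal sides of an affine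
    function of slope [L] contribute [Re L (c - d) (b - a)], the vertical ones
    the opposite, so only the remainder, small against the size, is left. *)
Lemma contour_im_local f z : derivable f z 1 -> forall e : R, 0 < e ->
  exists2 r, 0 < r & forall a b c d, a <= complex.Re z <= b -> c <= complex.Im z <= d ->
    b - a < r -> d - c < r ->
    hcont f c a b -> hcont f d a b -> vcont f a c d -> vcont f b c d ->
    `|contour_im f a b c d| <= e * ((b - a) + (d - c)) ^+ 2.
Proof.
move=> /derivable_local[L Lf] e e0.
have [r r0 rP] := Lf (e / 2) (divr_gt0 e0 (ltr0n _ 2)).
exists (r / 2); first exact: divr_gt0.
case: z {Lf} rP => x0 y0 rP a b c d /= /andP[ax xb] /andP[cy yd] bar dcr hc hd va vb.
set s := _ + _ : R.
have ba0 : 0 <= b - a by rewrite subr_ge0 (le_trans ax).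
have dc0 : 0 <= d - c by rewrite subr_ge0 (le_trans cy).
have near x y : a <= x <= b -> c <= y <= d ->
    Normc.normc (f (x +i* y) - f (x0 +i* y0) - L * ((x - x0) +i* (y - y0))) <= e / 2 * s.
  move=> /andP[axx xxb] /andP[cyy yyd].
  have hs : Normc.normc ((x - x0) +i* (y - y0)) <= s.
    apply: (le_trans (normc_le_ReIm _)) => /=.
    apply: lerD; rewrite ler_norml; apply/andP; split.
    - by rewrite opprB lerD// lerN2.
    - by rewrite lerD// lerN2.
    - by rewrite opprB lerD// lerN2.
    - by rewrite lerD// lerN2.
  have sr : s < r by rewrite [r]splitr /s ltrD.
  have := rP _ (le_lt_trans hs sr).
  have -> : (x0 +i* y0) + ((x - x0) +i* (y - y0)) = x +i* y :> R[i].
    by apply/eqP; rewrite eq_complex /= !subrKC !eqxx.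
  by move=> /le_trans; apply; rewrite ler_wpM2l// divr_ge0// ltW.
have ab : a <= b by rewrite -subr_ge0.
have cd : c <= d by rewrite -subr_ge0.
pose l := complex.Re L.
have E1 : `|itgl (fun x => complex.Im (f (x +i* c)) - complex.Im (f (x +i* d))) a b
     - l * (c - d) * (b - a)| <= e * s * (b - a).
  apply: itgl_near_cst => //; first exact: cts_onB (hcont_Im hc) (hcont_Im hd).
  move=> x xab; have := near x c xab; have := near x d xab; rewrite !lexx cd.
  move=> /(_ isT)/(le_trans (Im_le_normc _)) h1 /(_ isT)/(le_trans (Im_le_normc _)) h2.
  have := le_trans (ler_normB _ _) (lerD h2 h1).
  rewrite -mulrDl -splitr; congr (`|_| <= _).
  rewrite /l; clear; case: (f (x +i* c)) (f (x +i* d)) (f (x0 +i* y0)) L => [? ?] [? ?] [? ?] [? ?] /=; ring.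
have E2 : `|itgl (fun y => complex.Re (f (b +i* y)) - complex.Re (f (a +i* y))) c d
     - l * (b - a) * (d - c)| <= e * s * (d - c).
  apply: itgl_near_cst => //; first exact: cts_onB (vcont_Re vb) (vcont_Re va).
  move=> y ycd; have := near a y _ ycd; have := near b y _ ycd; rewrite !lexx ab.
  move=> /(_ isT)/(le_trans (Re_le_normc _)) h1 /(_ isT)/(le_trans (Re_le_normc _)) h2.
  have := le_trans (ler_normB _ _) (lerD h1 h2).
  rewrite -mulrDl -splitr; congr (`|_| <= _).
  rewrite /l; clear; case: (f (b +i* y)) (f (a +i* y)) (f (x0 +i* y0)) L => [? ?] [? ?] [? ?] [? ?] /=; ring.
rewrite expr2 mulrA {2}/s mulrDr.
apply: le_trans (lerD E1 E2); apply: le_trans (ler_normD _ _).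
rewrite le_eqVlt; apply/orP; left; apply/eqP; congr `|_|; rewrite /contour_im; ring.
Qed.

(** The contour integral is additive and, by derivability, negligible against
    the square of the size near each point. *)
Lemma goursat f a b c d : a <= b -> c <= d -> derivable_rect f a b c d ->
  contour_im f a b c d = 0.
Proof.
move=> ab cd df.
have cf x y : a <= x <= b -> c <= y <= d -> {for x +i* y, continuous f}.
  by move=> hx hy; apply: derivable_continuous; exact: df.
have ch y a' b' : a <= a' -> b' <= b -> c <= y <= d -> hcont f y a' b'.
  by move=> h1 h2 hy x /andP[h3 h4]; apply: cf => //; rewrite (le_trans h1)//= (le_trans h4).
have cv x c' d' : c <= c' -> d' <= d -> a <= x <= b -> vcont f x c' d'.
  by move=> h1 h2 hx y /andP[h3 h4]; apply: cf => //; rewrite (le_trans h1)//= (le_trans h4).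
apply: rect_additive_eq0 => //.
- move=> a' m b' c' d' h1 h2 h3 h4 h5 h6 h7.
  have am := le_trans h1 h2; have mb := le_trans h3 h4.
  have rc : c <= c' <= d by rewrite h5 (le_trans h6 h7).
  have rd : c <= d' <= d by rewrite (le_trans h5 h6) h7.
  have ra : a <= a' <= b by rewrite h1 (le_trans h2 mb).
  have rm : a <= m <= b by rewrite am mb.
  have rb : a <= b' <= b by rewrite (le_trans am h3) h4.
  exact: contour_im_hsplit h2 h3 (ch _ _ _ h1 h4 rc) (ch _ _ _ h1 h4 rd)
    (cv _ _ _ h5 h7 ra) (cv _ _ _ h5 h7 rm) (cv _ _ _ h5 h7 rb).
- move=> a' b' c' m d' h1 h2 h3 h4 h5 h6 h7.
  have cm := le_trans h4 h5; have md := le_trans h6 h7.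
  have rc : c <= c' <= d by rewrite h4 (le_trans h5 md).
  have rm : c <= m <= d by rewrite cm md.
  have rd : c <= d' <= d by rewrite (le_trans cm h6) h7.
  have ra : a <= a' <= b by rewrite h1 (le_trans h2 h3).
  have rb : a <= b' <= b by rewrite (le_trans h1 h2) h3.
  exact: contour_im_vsplit h5 h6 (ch _ _ _ h1 h3 rc) (ch _ _ _ h1 h3 rm)
    (ch _ _ _ h1 h3 rd) (cv _ _ _ h4 h7 ra) (cv _ _ _ h4 h7 rb).
move=> x y e xab ycd e0.
have [r r0 rP] := contour_im_local (df x y xab ycd) e0.
exists r => // a' b' c' d' h1 h2 h3 h4 h5 h6 h7 h8 h9 h10.
have ra : a <= a' <= b by rewrite h1 (le_trans h2 (le_trans h3 h4)).
have rb : a <= b' <= b by rewrite (le_trans h1 (le_trans h2 h3)) h4.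
have rc : c <= c' <= d by rewrite h5 (le_trans h6 (le_trans h7 h8)).
have rd : c <= d' <= d by rewrite (le_trans h5 (le_trans h6 h7)) h8.
apply: (rP a' b' c' d' _ _ h9 h10 (ch _ _ _ h1 h4 rc) (ch _ _ _ h1 h4 rd)
  (cv _ _ _ h5 h8 ra) (cv _ _ _ h5 h8 rb)) => /=; first by rewrite h2.
by rewrite h6.
Qed.

End complex_plane.

(** * Cauchy's integral formula on rectangles *)
Section cauchy.
Context {R : realType}.
Implicit Types (f g q : R[i] -> R[i]) (z w : R[i]).

Lemma itgl_FTC (f F : R -> R) a b : a < b -> cts_on f a b ->
  (forall x : R, a <= x <= b -> is_derive x (1 : R) F (f x)) -> itgl f a b = F b - F a.
Proof.
move=> ab cf dF.
have cF x : a <= x <= b -> {for x, continuous F}.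
  move=> hx; apply/differentiable_continuous/derivable1_diffP.
  exact: (@ex_derive _ _ _ _ _ _ _ (dF x hx)).
have oo x : x \in `]a, b[ -> a <= x <= b by rewrite in_itv /= => /andP[? ?]; rewrite !ltW.
rewrite /itgl /Rintegral (@continuous_FTC2 _ f F)//.
- exact: cts_on_within.
- split => [x /oo hx||]; first exact: (@ex_derive _ _ _ _ _ _ _ (dF x hx)).
    by apply: cvg_at_right_filter; apply: cF; rewrite lexx ltW.
  by apply: cvg_at_left_filter; apply: cF; rewrite lexx ltW.
by move=> x /oo hx; rewrite derive1E; exact: (@derive_val _ _ _ _ _ _ _ (dF x hx)).
Qed.

Lemma cts_poisson (x0 e a b : R) : 0 < e ->
  cts_on (fun x => e / ((x - x0) ^+ 2 + e ^+ 2)) a b.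
Proof.
move=> e0 x _; apply: cvgM; first exact: cvg_cst.
apply: cvgV; first by rewrite gt_eqF// ltr_wpDl ?sqr_ge0// exprn_gt0.
apply: cvgD; last exact: cvg_cst.
by apply: cvgM; apply: cvgB; [exact: cvg_id|exact: cvg_cst|exact: cvg_id|exact: cvg_cst].
Qed.

(** The angle under which a side of a square is seen from its centre. *)
Lemma itgl_poisson_square (x0 e : R) : 0 < e ->
  itgl (fun x => e / ((x - x0) ^+ 2 + e ^+ 2)) (x0 - e) (x0 + e) = pi / 2.
Proof.
move=> e0.
have d0 x : (x - x0) ^+ 2 + e ^+ 2 != 0.
  by rewrite gt_eqF// ltr_wpDl ?sqr_ge0// exprn_gt0.
have dF (x : R) : is_derive x (1 : R) (fun x => atan (e^-1 * (x - x0)))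
    (e / ((x - x0) ^+ 2 + e ^+ 2)).
  have dg : is_derive x (1 : R) (fun x => e^-1 * (x - x0)) e^-1.
    rewrite (_ : (fun x => _) = e^-1 *: (id - cst x0))//.
    by apply: is_derive_eq; rewrite subr0 [LHS]mulr1.
  have := @is_derive1_comp R (@atan R) _ x _ _ (is_derive1_atan (e^-1 * (x - x0))) dg.
  move=> /is_derive_eq; apply.
  by rewrite -[LHS]/(_ * _); field; rewrite d0 gt_eqF.
have ab : x0 - e < x0 + e by rewrite ltrD2l (lt_trans _ e0)// oppr_lt0.
rewrite (itgl_FTC ab (@cts_poisson _ _ _ _ e0) (fun x _ => dF x)).
have -> : e^-1 * (x0 + e - x0) = 1 by rewrite addrAC subrr add0r mulVf// gt_eqF.
have -> : e^-1 * (x0 - e - x0) = - 1.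
  by rewrite addrAC subrr sub0r mulrN mulVf// gt_eqF.
by rewrite atanN atan1; field.
Qed.

(** The pole [(u + iv) / (z - w)] on two opposite sides of a square centred at
    [w]: the contributions of [v] cancel pointwise. *)
Lemma pole_im_jump (u v s e : R) : e != 0 ->
  complex.Im ((u +i* v) / (s +i* (- e))) - complex.Im ((u +i* v) / (s +i* e)) =
  2 * u * (e / (s ^+ 2 + e ^+ 2)).
Proof.
move=> e0; rewrite /=; field; rewrite -sqrrN.
have s0 : s ^+ 2 + e ^+ 2 != 0.
  by rewrite gt_eqF// ltr_wpDl ?sqr_ge0// exprn_even_gt0.
by rewrite ?sqrrN s0.
Qed.

Lemma pole_re_jump (u v s e : R) : e != 0 ->
  complex.Re ((u +i* v) / (e +i* s)) - complex.Re ((u +i* v) / ((- e) +i* s)) =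
  2 * u * (e / (s ^+ 2 + e ^+ 2)).
Proof.
move=> e0; rewrite /=; field.
have s0 : s ^+ 2 + e ^+ 2 != 0.
  by rewrite gt_eqF// ltr_wpDl ?sqr_ge0// exprn_even_gt0.
by rewrite ?sqrrN s0.
Qed.

Lemma derivable_divB q w z : z != w -> derivable q z 1 ->
  derivable (fun z => q z / (z - w)) z 1.
Proof.
move=> zw dq; apply: derivable_mul; first exact: dq.
apply: derivable_inv; first by rewrite subr_eq0.
by apply: derivable_add; [exact: derivable_ident|exact: derivable_const].
Qed.

(** Freezing [q] at the centre changes the integrand by at most [h / e] on a
    contour of length [8 e], and the pole [q w / (z - w)] contributes exactly
    [2 pi Re (q w)]. *)
Lemma contour_im_small_square q x0 y0 : let w := x0 +i* y0 in derivable q w 1 ->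
  forall h, 0 < h -> exists2 r, 0 < r & forall e, 0 < e -> e < r ->
  (forall x y, x0 - e <= x <= x0 + e -> y0 - e <= y <= y0 + e -> derivable q (x +i* y) 1) ->
  `|contour_im (fun z => q z / (z - w)) (x0 - e) (x0 + e) (y0 - e) (y0 + e)
    - 2 * pi * complex.Re (q w)| <= 8 * h.
Proof.
move=> w dq h h0.
have /(@cvgrPdist_lt _ _ _ (nbhs w)) /(_ h%:C) := derivable_continuous dq.
rewrite ltcR => /(_ h0)/nbhs_ballP[r /= r0 rP].
have rE : r = (complex.Re r)%:C by rewrite RRe_real// gtr0_real.
have r0' : 0 < complex.Re r by rewrite -ltcR -rE.
exists (complex.Re r / 2) => [|e e0 er dqe]; first exact: divr_gt0.
set f := fun z => _.
have e0' : e != 0 by rewrite gt_eqF.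
have xx : x0 - e <= x0 + e by rewrite lerD2l (le_trans _ (ltW e0))// oppr_le0 ltW.
have yy : y0 - e <= y0 + e by rewrite lerD2l (le_trans _ (ltW e0))// oppr_le0 ltW.
have near x y : x0 - e <= x <= x0 + e -> y0 - e <= y <= y0 + e ->
    e <= `|x - x0| \/ e <= `|y - y0| ->
    Normc.normc (f (x +i* y) - q w / (x +i* y - w)) <= h / e.
  move=> hx hy hor; rewrite /f -mulrBl Normc.normcM Normc.normcV.
  have we : e <= Normc.normc (x +i* y - w).
    case: hor => /le_trans; apply; [exact: le_trans (Re_le_normc _)|exact: le_trans (Im_le_normc _)].
  apply: ler_pM; rewrite ?normc_ge0 ?invr_ge0 ?normc_ge0//; last first.
    by rewrite lef_pV2// posrE// (lt_le_trans e0).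
  rewrite ltW// -ltcR -normcC distrC; apply: rP; rewrite -ball_normE /= distrC normcC rE ltcR.
  rewrite (le_lt_trans (normc_le_ReIm _))//= [complex.Re r]splitr ltrD//.
    by apply: le_lt_trans er; rewrite ler_distl.
  by apply: le_lt_trans er; rewrite ler_distl.
pose u := complex.Re (q w); pose v := complex.Im (q w).
have qw : q w = u +i* v by rewrite ReImK.
have polE x y : q w / (x +i* y - w) = (u +i* v) / ((x - x0) +i* (y - y0)) by rewrite qw.
have df z : z != w -> derivable q z 1 -> derivable f z 1 by exact: derivable_divB.
have wx x y : x != x0 -> x +i* y != w.
  by apply: contra => /eqP[-> _].
have wy x y : y != y0 -> x +i* y != w.
  by apply: contra => /eqP[_ ->].
have x1 : x0 - e != x0 by rewrite -subr_eq0 addrAC subrr sub0r oppr_eq0.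
have x2 : x0 + e != x0 by rewrite -subr_eq0 addrAC subrr add0r.
have y1 : y0 - e != y0 by rewrite -subr_eq0 addrAC subrr sub0r oppr_eq0.
have y2 : y0 + e != y0 by rewrite -subr_eq0 addrAC subrr add0r.
have hc y : y0 - e <= y <= y0 + e -> y != y0 -> hcont f y (x0 - e) (x0 + e).
  by move=> hy yy0 x hx; apply: derivable_continuous; apply: df; [exact: wy|exact: dqe].
have vc x : x0 - e <= x <= x0 + e -> x != x0 -> vcont f x (y0 - e) (y0 + e).
  by move=> hx xx0 y hy; apply: derivable_continuous; apply: df; [exact: wx|exact: dqe].
have px x : cts_on (fun x1 => 2 * u * (e / ((x1 - x) ^+ 2 + e ^+ 2))) (x - e) (x + e).
  by apply: cts_onM; [exact: cts_on_cst|exact: cts_poisson].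
have pI x : itgl (fun x1 => 2 * u * (e / ((x1 - x) ^+ 2 + e ^+ 2))) (x - e) (x + e) = pi * u.
  rewrite itglZ ?itgl_poisson_square//; last exact: cts_poisson.
  by field.
have hb : h / e + h / e = 2 * h / e by rewrite -mulrDl -mulr2n mulr_natl.
have nx1 : e <= `|x0 - e - x0| by rewrite addrAC subrr sub0r normrN gtr0_norm.
have nx2 : e <= `|x0 + e - x0| by rewrite addrAC subrr add0r gtr0_norm.
have ny1 : e <= `|y0 - e - y0| by rewrite addrAC subrr sub0r normrN gtr0_norm.
have ny2 : e <= `|y0 + e - y0| by rewrite addrAC subrr add0r gtr0_norm.
have width (x : R) : 2 * h / e * (x + e - (x - e)) = 4 * h by field.
have E1 : `|itgl (fun x => complex.Im (f (x +i* (y0 - e))) - complex.Im (f (x +i* (y0 + e))))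
    (x0 - e) (x0 + e) - pi * u| <= 4 * h.
  have cI := cts_onB (hcont_Im (hc (y0 - e) _ y1)) (hcont_Im (hc (y0 + e) _ y2)).
  rewrite -(pI x0) -itglB//; [|by apply: cI; rewrite ?lexx ?yy..].
  rewrite -(width x0); apply: itgl_norm_le => //.
    by apply: cts_onB => //; apply: cI; rewrite ?lexx ?yy.
  move=> x hx; have := near x (y0 - e) hx; have := near x (y0 + e) hx.
  rewrite !lexx yy !polE => /(_ isT (or_intror ny2)) h2 /(_ isT (or_intror ny1)) h1.
  rewrite -(pole_im_jump u v (x - x0) e0') -hb.
  have := le_trans (ler_normB _ _) (lerD (le_trans (Im_le_normc _) h1) (le_trans (Im_le_normc _) h2)).
  congr (`|_| <= _).
  have -> : y0 - e - y0 = - e by rewrite addrAC subrr add0r.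
  have -> : y0 + e - y0 = e by rewrite addrAC subrr add0r.
  by rewrite !ImB; ring.
have E2 : `|itgl (fun y => complex.Re (f ((x0 + e) +i* y)) - complex.Re (f ((x0 - e) +i* y)))
    (y0 - e) (y0 + e) - pi * u| <= 4 * h.
  have cI := cts_onB (vcont_Re (vc (x0 + e) _ x2)) (vcont_Re (vc (x0 - e) _ x1)).
  rewrite -(pI y0) -itglB//; [|by apply: cI; rewrite ?lexx ?xx..].
  rewrite -(width y0); apply: itgl_norm_le => //.
    by apply: cts_onB => //; apply: cI; rewrite ?lexx ?xx.
  move=> y hy; have := near (x0 + e) y _ hy; have := near (x0 - e) y _ hy.
  rewrite !lexx xx !polE => /(_ isT (or_introl nx1)) h2 /(_ isT (or_introl nx2)) h1.
  rewrite -(pole_re_jump u v (y - y0) e0') -hb.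
  have := le_trans (ler_normB _ _) (lerD (le_trans (Re_le_normc _) h1) (le_trans (Re_le_normc _) h2)).
  congr (`|_| <= _).
  have -> : x0 - e - x0 = - e by rewrite addrAC subrr add0r.
  have -> : x0 + e - x0 = e by rewrite addrAC subrr add0r.
  by rewrite !ReB; ring.
have -> : 8 * h = 4 * h + 4 * h by rewrite -mulrDl -natrD.
apply: le_trans (lerD E1 E2); apply: le_trans (ler_normD _ _).
rewrite le_eqVlt; apply/orP; left; apply/eqP; congr `|_|; rewrite /contour_im -/u; ring.
Qed.

(** The rectangle is cut into a small square around the pole and four rectangles
    on which Goursat's theorem applies, so that the contour can be shrunk to the
    pole. *)
Lemma cauchy_rect q a b c d x0 y0 : a < x0 -> x0 < b -> c < y0 -> y0 < d ->
  derivable_rect q a b c d ->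
  contour_im (fun z => q z / (z - (x0 +i* y0))) a b c d = 2 * pi * complex.Re (q (x0 +i* y0)).
Proof.
move=> ax xb cy yd dq; set w := x0 +i* y0; set f := fun z => _.
have dqw : derivable q w 1 by apply: dq; rewrite !ltW.
apply/eqP; rewrite -subr_eq0 -normr_eq0 eq_le normr_ge0 andbT; apply/ler_addgt0Pr => h h0.
rewrite add0r; have h8 : 0 < h / 8 by rewrite divr_gt0.
have [r r0 rP] := contour_im_small_square dqw h8.
(* the room left around the pole *)
pose m := Num.min r (Num.min (Num.min (x0 - a) (b - x0)) (Num.min (y0 - c) (d - y0))).
have m0 : 0 < m by rewrite !lt_min r0 !subr_gt0 ax xb cy yd.
pose e := m / 2.
have e0 : 0 < e by rewrite divr_gt0.
have em : e < m by rewrite /e ltr_pdivrMr// ltr_pMr// ltr1n.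
move: (em); rewrite !lt_min => /andP[er /andP[/andP[exa exb] /andP[eyc eyd]]].
have xa1 : a < x0 - e by rewrite ltrBrDr -ltrBrDl.
have xb1 : x0 + e < b by rewrite -ltrBrDl.
have yc1 : c < y0 - e by rewrite ltrBrDr -ltrBrDl.
have yd1 : y0 + e < d by rewrite -ltrBrDl.
have xe1 : x0 - e < x0 by rewrite gtrBl.
have xe2 : x0 < x0 + e by rewrite ltrDl.
have ye1 : y0 - e < y0 by rewrite gtrBl.
have ye2 : y0 < y0 + e by rewrite ltrDl.
have xx := lt_trans xe1 xe2; have yy := lt_trans ye1 ye2.
have df x y : a <= x <= b -> c <= y <= d -> (x != x0) || (y != y0) -> derivable f (x +i* y) 1.
  move=> hx hy ne; apply: derivable_divB; last exact: dq.
  by rewrite eq_complex /= negb_and.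
have hc y : c <= y <= d -> y != y0 -> hcont f y a b.
  by move=> hy ne x hx; apply: derivable_continuous; apply: df => //; rewrite ne orbT.
have vc x : a <= x <= b -> x != x0 -> vcont f x c d.
  by move=> hx ne y hy; apply: derivable_continuous; apply: df => //; rewrite ne.
have hA y : c <= y <= d -> y != y0 -> forall a' b', a <= a' -> b' <= b -> hcont f y a' b'.
  by move=> hy ne a' b'; apply: hcontS; exact: hc.
have vA x : a <= x <= b -> x != x0 -> forall a' b', c <= a' -> b' <= d -> vcont f x a' b'.
  by move=> hx ne a' b'; apply: vcontS; exact: vc.
have ab := lt_trans ax xb; have cd := lt_trans cy yd.
have ac1 := lt_trans yc1 ye1; have ac2 := lt_trans ye2 yd1.
have yb1 := lt_trans ye1 yd; have yb2 := lt_trans cy ye2.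
have xb2 := lt_trans ax xe2; have xa2 := lt_trans xe1 xb.
have rc : c <= c <= d by rewrite lexx ltW. have rd : c <= d <= d by rewrite lexx ltW.
have ra : a <= a <= b by rewrite lexx ltW. have rb : a <= b <= b by rewrite lexx ltW.
have r1 : c <= y0 - e <= d by rewrite !ltW. have r2 : c <= y0 + e <= d by rewrite !ltW.
have r3 : a <= x0 - e <= b by rewrite !ltW. have r4 : a <= x0 + e <= b by rewrite !ltW.
have n1 := ltW xa1; have n2 := ltW xb1; have n3 := ltW yc1; have n4 := ltW yd1.
have n5 := ltW xx; have n6 := ltW yy; have n7 := ltW yb1; have n8 := ltW yb2.
have n9 := ltW xb2; have n10 := ltW xa2.
have i1 := hA _ rc (negbT (lt_eqF cy)); have i2 := hA _ rd (negbT (gt_eqF yd)).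
have i3 := hA _ r1 (negbT (lt_eqF ye1)); have i4 := hA _ r2 (negbT (gt_eqF ye2)).
have j1 := vA _ ra (negbT (lt_eqF ax)); have j2 := vA _ rb (negbT (gt_eqF xb)).
have j3 := vA _ r3 (negbT (lt_eqF xe1)); have j4 := vA _ r4 (negbT (gt_eqF xe2)).
have lx := @lexx _ R.
rewrite (contour_im_vsplit n3 n7 (i1 _ _ (lx a) (lx b)) (i3 _ _ (lx a) (lx b))
  (i2 _ _ (lx a) (lx b)) (j1 _ _ (lx c) (lx d)) (j2 _ _ (lx c) (lx d))).
rewrite (contour_im_vsplit n6 n4 (i3 _ _ (lx a) (lx b)) (i4 _ _ (lx a) (lx b))
  (i2 _ _ (lx a) (lx b)) (j1 _ _ n3 (lx d)) (j2 _ _ n3 (lx d))).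
rewrite (contour_im_hsplit n1 n10 (i3 _ _ (lx a) (lx b)) (i4 _ _ (lx a) (lx b))
  (j1 _ _ n3 n4) (j3 _ _ n3 n4) (j2 _ _ n3 n4)).
rewrite (contour_im_hsplit n5 n2 (i3 _ _ n1 (lx b)) (i4 _ _ n1 (lx b))
  (j3 _ _ n3 n4) (j4 _ _ n3 n4) (j2 _ _ n3 n4)).
have z1 : contour_im f a b c (y0 - e) = 0.
  apply: goursat; [exact: ltW|exact: ltW|move=> x y hx /andP[h1 h2]].
  by apply: df; rewrite ?h1 ?(le_trans h2)//= orbC lt_eqF// (le_lt_trans h2).
have z2 : contour_im f a b (y0 + e) d = 0.
  apply: goursat; [exact: ltW|exact: ltW|move=> x y hx /andP[h1 h2]].
  by apply: df; rewrite ?h2 ?(le_trans _ h1)//= orbC gt_eqF// (lt_le_trans _ h1).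
have z3 : contour_im f a (x0 - e) (y0 - e) (y0 + e) = 0.
  apply: goursat; [exact: ltW|exact: ltW|move=> x y /andP[h3 h4] /andP[h1 h2]].
  by apply: df; rewrite ?h3 ?(le_trans h4)//= ?(le_trans _ h1) ?(le_trans h2)// lt_eqF// (le_lt_trans h4).
have z4 : contour_im f (x0 + e) b (y0 - e) (y0 + e) = 0.
  apply: goursat; [exact: ltW|exact: ltW|move=> x y /andP[h3 h4] /andP[h1 h2]].
  by apply: df; rewrite ?h4 ?(le_trans _ h3)//= ?(le_trans _ h1) ?(le_trans h2)// gt_eqF// (lt_le_trans _ h3).
rewrite z1 z2 z3 z4 !addr0 !add0r.
have -> : h = 8 * (h / 8) by field.
apply: (rP e e0 er) => x y /andP[h1 h2] /andP[h3 h4]; apply: dq.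
  by rewrite (le_trans _ h1) ?(le_trans h2).
by rewrite (le_trans _ h3) ?(le_trans h4).
Qed.

End cauchy.

(** * Area bounds for point values *)
Section mean_value.
Context {R : realType}.
Local Notation m := (@lebesgue_measure R).
Implicit Types (f q : R[i] -> R[i]).

Lemma itgl_le_integral (f g : R -> R) a b : cts_on f a b ->
  measurable_fun setT g -> (forall x, 0 <= g x) ->
  (forall x, a <= x <= b -> `|f x| <= g x) ->
  (`|itgl f a b|%:E <= \int[m]_x (g x)%:E)%E.
Proof.
move=> cf mg g0 fg.
have If := cts_on_integrable cf.
have [mf _] := integrableP _ _ _ If.
rewrite EFin_normr_Rintegral//.
apply: le_trans (le_abse_integral _ _ mf) _ => //.
apply: (@le_trans _ _ (\int[m]_(x in `[a, b]) (g x)%:E)%E).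
  apply: ge0_le_integral => //.
  - exact: measurableT_comp.
  - by apply/measurable_EFinP; exact: measurable_funS mg.
apply: ge0_subset_integral => //; first exact/measurable_EFinP.
by move=> x _; rewrite lee_fin.
Qed.

(** Averaging. It serves to choose the sides of a contour so that an area integral
    bounds the integrals along them. *)
Lemma exists_small_slice (h : R -> \bar R) a b A : a < b ->
  measurable_fun setT h -> (forall x, 0 <= h x)%E ->
  (\int[m]_x h x < A%:E)%E ->
  exists2 x, a <= x <= b & (h x < (A / (b - a))%:E)%E.
Proof.
move=> ab mh h0 hA; apply: contrapT => H.
have hge x : a <= x <= b -> ((A / (b - a))%:E <= h x)%E.
  by move=> hx; rewrite leNgt; apply/negP => hl; apply: H; exists x.
have ba : 0 < b - a by rewrite subr_gt0.
have A0 : 0 <= A.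
  by rewrite -lee_fin (le_trans _ (ltW hA))// integral_ge0.
move: hA; rewrite ltNge => /negP; apply.
apply: (@le_trans _ _ (\int[m]_(x in `[a, b]) h x)%E); last exact: ge0_subset_integral.
have -> : A%:E = (\int[m]_(x in `[a, b]) cst (A / (b - a))%:E x)%E.
  rewrite integral_cst//.
  have := @lebesgue_measure_itv R `[a, b]; rewrite /= lte_fin ab => ->.
  by rewrite -EFinD -EFinM divfK// gt_eqF.
apply: ge0_le_integral => //.
- by move=> x _; rewrite lee_fin divr_ge0// ltW.
exact: measurable_funS mh.
Qed.

Lemma fubini_swap (g : R * R -> R) : measurable_fun setT g -> (forall p, 0 <= g p) ->
  (\int[m]_x \int[m]_y (g (x, y))%:E = \int[m]_y \int[m]_x (g (x, y))%:E)%E.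
Proof.
move=> mg g0.
have mg' : measurable_fun setT (EFin \o g) by exact/measurable_EFinP.
have g0' p : (0 <= (EFin \o g) p)%E by rewrite lee_fin.
exact: (etrans (esym (fubini_tonelli1 (m1 := m) (m2 := m) _ mg' g0'))
  (fubini_tonelli2 (m1 := m) (m2 := m) _ mg' g0')).
Qed.

Lemma measurable_slice1 (g : R * R -> R) x : measurable_fun setT g ->
  measurable_fun setT (fun y => g (x, y)).
Proof. by move=> mg; exact: (measurableT_comp mg (pair1_measurable x)). Qed.

Lemma measurable_slice2 (g : R * R -> R) y : measurable_fun setT g ->
  measurable_fun setT (fun x => g (x, y)).
Proof. by move=> mg; exact: (measurableT_comp mg (pair2_measurable y)). Qed.

Lemma measurable_iter1 (g : R * R -> R) : measurable_fun setT g -> (forall p, 0 <= g p) ->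
  measurable_fun setT (fun x => \int[m]_y (g (x, y))%:E)%E.
Proof.
move=> mg g0.
have mg' : measurable_fun setT (EFin \o g) by exact/measurable_EFinP.
have g0' p : (0 <= (EFin \o g) p)%E by rewrite lee_fin.
exact: (measurable_fun_fubini_tonelli_F (m2 := m) _ mg' g0').
Qed.

Lemma measurable_iter2 (g : R * R -> R) : measurable_fun setT g -> (forall p, 0 <= g p) ->
  measurable_fun setT (fun y => \int[m]_x (g (x, y))%:E)%E.
Proof.
move=> mg g0.
have mg' : measurable_fun setT (EFin \o g) by exact/measurable_EFinP.
have g0' p : (0 <= (EFin \o g) p)%E by rewrite lee_fin.
exact: (measurable_fun_fubini_tonelli_G (m1 := m) _ mg' g0').
Qed.

(** Multiplying a function by such a constant turns bounds on real parts into
    bounds on moduli. *)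
Lemma unimodular_rotation (z : R[i]) :
  exists2 c : R[i], Normc.normc c = 1 & c * z = (Normc.normc z)%:C.
Proof.
have [->|z0] := eqVneq z 0.
  by exists 1; rewrite ?Normc.normc1// mulr0 Normc.normc0.
exists ((Normc.normc z)%:C / z); last by rewrite divfK.
rewrite Normc.normcM Normc.normcV /= expr0n addr0 sqrtr_sqr ger0_norm ?normc_ge0//.
by rewrite divff// gt_eqF// normc_gt0.
Qed.

(** In Cauchy's formula each side of the contour may be chosen independently of the
    others, at a distance between [r] and [2 r] of the centre; on a well chosen one
    the integral of [g] is at most [A / r], and the kernel is at most [1 / r]. The
    four sides give [2 pi |q| <= 4 A / r ^ 2]. *)
Lemma local_mean q (g : R * R -> R) x0 y0 r A : 0 < r ->
  derivable_rect q (x0 - 2 * r) (x0 + 2 * r) (y0 - 2 * r) (y0 + 2 * r) ->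
  measurable_fun setT g -> (forall p, 0 <= g p) ->
  (forall x y, x0 - 2 * r <= x <= x0 + 2 * r -> y0 - 2 * r <= y <= y0 + 2 * r ->
    Normc.normc (q (x +i* y)) <= g (x, y)) ->
  (\int[m]_x \int[m]_y (g (x, y))%:E < A%:E)%E ->
  Normc.normc (q (x0 +i* y0)) * r ^+ 2 <= A.
Proof.
move=> r0 dq mg g0 qg IA.
have IA' := IA; rewrite fubini_swap// in IA'.
have wid t : t + 2 * r - (t + r) = r by ring.
have wid' t : t - r - (t - 2 * r) = r by ring.
have le1 t : t - 2 * r < t - r by rewrite ltrD2l ltrN2 ltr_pMl// ltr1n.
have le2 t : t + r < t + 2 * r by rewrite ltrD2l ltr_pMl// ltr1n.
have h0 x : (0 <= \int[m]_y (g (x, y))%:E)%E by apply: integral_ge0 => y _; rewrite lee_fin.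
have v0 y : (0 <= \int[m]_x (g (x, y))%:E)%E by apply: integral_ge0 => x _; rewrite lee_fin.
have [a ha Ia] := exists_small_slice (le1 x0) (measurable_iter1 mg g0) h0 IA.
have [b hb Ib] := exists_small_slice (le2 x0) (measurable_iter1 mg g0) h0 IA.
have [c hc Ic] := exists_small_slice (le1 y0) (measurable_iter2 mg g0) v0 IA'.
have [d hd Id] := exists_small_slice (le2 y0) (measurable_iter2 mg g0) v0 IA'.
rewrite ?wid ?wid' in Ia Ib Ic Id.
have l1 t : t - r < t by rewrite gtrBl.
have l2 t : t < t + r by rewrite ltrDl.
case/andP: ha => a1 a2; case/andP: hb => b1 b2; case/andP: hc => c1 c2; case/andP: hd => d1 d2.
have ax := le_lt_trans a2 (l1 x0); have xb := lt_le_trans (l2 x0) b1.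
have cy := le_lt_trans c2 (l1 y0); have yd := lt_le_trans (l2 y0) d1.
have [k k1 kq] := unimodular_rotation (q (x0 +i* y0)).
set w := x0 +i* y0 in kq *.
have dq' : derivable_rect (fun z => k * q z) a b c d.
  move=> x y /andP[h1 h2] /andP[h3 h4]; apply: derivable_mul; first exact: derivable_const.
  apply: dq; first by rewrite (le_trans a1 h1) (le_trans h2 b2).
  by rewrite (le_trans c1 h3) (le_trans h4 d2).
have := cauchy_rect ax xb cy yd dq'; rewrite -/w kq -[complex.Re _]/(Normc.normc (q w)).
set f := fun z => _ => E.
have inx x : a <= x <= b -> x0 - 2 * r <= x <= x0 + 2 * r.
  by move=> /andP[h1 h2]; rewrite (le_trans a1 h1) (le_trans h2 b2).
have iny y : c <= y <= d -> y0 - 2 * r <= y <= y0 + 2 * r.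
  by move=> /andP[h1 h2]; rewrite (le_trans c1 h1) (le_trans h2 d2).
have ab := ltW (lt_trans ax xb); have cd := ltW (lt_trans cy yd).
have fb x y : a <= x <= b -> c <= y <= d -> r <= `|x - x0| \/ r <= `|y - y0| ->
    Normc.normc (f (x +i* y)) <= r^-1 * g (x, y).
  move=> hx hy hor; rewrite /f Normc.normcM Normc.normcV Normc.normcM k1 mul1r mulrC.
  have we : r <= Normc.normc (x +i* y - w).
    case: hor => /le_trans; apply; [exact: le_trans (Re_le_normc _)|exact: le_trans (Im_le_normc _)].
  apply: ler_pM; rewrite ?invr_ge0 ?normc_ge0//.
    by rewrite lef_pV2// posrE// (lt_le_trans r0).
  by apply: qg; [exact: inx|exact: iny].
have fc x y : a <= x <= b -> c <= y <= d -> x +i* y != w -> {for x +i* y, continuous f}.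
  by move=> hx hy ne; apply: derivable_continuous; apply: derivable_divB => //; exact: dq'.
have rc : c <= c <= d by rewrite lexx. have rd : c <= d <= d by rewrite lexx cd.
have ra : a <= a <= b by rewrite lexx. have rb : a <= b <= b by rewrite lexx ab.
have hcc : hcont f c a b.
  by move=> x hx; apply: fc => //; apply/eqP => -[_ yE]; rewrite yE ltxx in cy.
have hcd : hcont f d a b.
  by move=> x hx; apply: fc => //; apply/eqP => -[_ yE]; rewrite yE ltxx in yd.
have vca : vcont f a c d.
  by move=> y hy; apply: fc => //; apply/eqP => -[xE _]; rewrite xE ltxx in ax.
have vcb : vcont f b c d.
  by move=> y hy; apply: fc => //; apply/eqP => -[xE _]; rewrite xE ltxx in xb.
have ri : 0 <= r^-1 by rewrite invr_ge0 ltW.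
have na : r <= `|a - x0| by rewrite distrC ler_normr lerBrDr -lerBrDl a2.
have nb : r <= `|b - x0| by rewrite ler_normr lerBrDr addrC b1.
have nc : r <= `|c - y0| by rewrite distrC ler_normr lerBrDr -lerBrDl c2.
have nd : r <= `|d - y0| by rewrite ler_normr lerBrDr addrC d1.
have bnd (I : \bar R) (J : R) : (I < (A / r)%:E)%E -> (0 <= I)%E ->
    (J%:E <= r^-1%:E * I)%E -> J <= A / r ^+ 2.
  case: I => [I|//|//] IAr _; rewrite -EFinM lee_fin => JI.
  rewrite lte_fin in IAr.
  apply: le_trans JI _; rewrite expr2 invfM mulrA mulrC ler_wpM2r//.
  exact: ltW.
have mE (h : R -> R) : measurable_fun setT h -> (forall x, 0 <= h x) ->
    (\int[m]_x (r^-1 * h x)%:E = r^-1%:E * \int[m]_x (h x)%:E)%E.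
  move=> mh h0'; under eq_integral do rewrite EFinM.
  by rewrite ge0_integralZl//; [exact/measurable_EFinP|move=> x _; rewrite lee_fin].
have B1 : `|itgl (fun x => complex.Im (f (x +i* c))) a b| <= A / r ^+ 2.
  apply: (bnd _ _ Ic (v0 c)); rewrite -mE//; last exact: measurable_slice2.
  apply: itgl_le_integral; first exact: hcont_Im.
  - by apply: measurable_funM; [exact: measurable_cst|exact: measurable_slice2].
  - by move=> x; rewrite mulr_ge0.
  - by move=> x hx; apply: le_trans (Im_le_normc _) _; apply: fb => //; right.
have B2 : `|itgl (fun x => complex.Im (f (x +i* d))) a b| <= A / r ^+ 2.
  apply: (bnd _ _ Id (v0 d)); rewrite -mE//; last exact: measurable_slice2.
  apply: itgl_le_integral; first exact: hcont_Im.
  - by apply: measurable_funM; [exact: measurable_cst|exact: measurable_slice2].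
  - by move=> x; rewrite mulr_ge0.
  - by move=> x hx; apply: le_trans (Im_le_normc _) _; apply: fb => //; right.
have B3 : `|itgl (fun y => complex.Re (f (a +i* y))) c d| <= A / r ^+ 2.
  apply: (bnd _ _ Ia (h0 a)); rewrite -mE//; last exact: measurable_slice1.
  apply: itgl_le_integral; first exact: vcont_Re.
  - by apply: measurable_funM; [exact: measurable_cst|exact: measurable_slice1].
  - by move=> x; rewrite mulr_ge0.
  - by move=> x hx; apply: le_trans (Re_le_normc _) _; apply: fb => //; left.
have B4 : `|itgl (fun y => complex.Re (f (b +i* y))) c d| <= A / r ^+ 2.
  apply: (bnd _ _ Ib (h0 b)); rewrite -mE//; last exact: measurable_slice1.
  apply: itgl_le_integral; first exact: vcont_Re.
  - by apply: measurable_funM; [exact: measurable_cst|exact: measurable_slice1].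
  - by move=> x; rewrite mulr_ge0.
  - by move=> x hx; apply: le_trans (Re_le_normc _) _; apply: fb => //; left.
have r2 : 0 < r ^+ 2 by rewrite exprn_gt0.
rewrite -ler_pdivlMr// -(@ler_pM2l _ 4)//.
have -> : 4 * (A / r ^+ 2) = (A / r ^+ 2 + A / r ^+ 2) + (A / r ^+ 2 + A / r ^+ 2) by ring.
apply: le_trans (lerD (lerD B1 B2) (lerD B4 B3)).
apply: (@le_trans _ _ (2 * pi * Normc.normc (q w))).
  rewrite ler_wpM2r ?normc_ge0// (_ : 4 = 2 * 2); last by rewrite -natrM.
  by rewrite ler_wpM2l// pi_ge2.
rewrite -E contour_imE//; apply: le_trans (ler_norm _) _.
by apply: le_trans (ler_normD _ _) _; rewrite lerD// ler_normB.
Qed.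

End mean_value.

(** * Poisson's formula and Julia's lemma *)
Section poisson.
Context {R : realType}.
Local Notation m := (@lebesgue_measure R).
Implicit Types (G f q : R[i] -> R[i]) (dl X M N B : R).

Lemma le_of_le_add_inv (a b C N0 : R) : 0 < N0 -> (forall N, N0 <= N -> a <= b + C / N) -> a <= b.
Proof.
move=> N00 H; apply/ler_addgt0Pr => e e0.
pose N := Num.max N0 (`|C| / e).
have N0' : 0 < N by rewrite lt_max N00.
have NN : N0 <= N by rewrite le_max lexx.
apply: le_trans (H _ NN) _; rewrite lerD2l ler_pdivrMr// mulrC -ler_pdivrMr//.
apply: (@le_trans _ _ (`|C| / e)); last by rewrite le_max lexx orbT.
by rewrite ler_pM2r ?invr_gt0// ler_norm.
Qed.

Definition bounded_from G dl M :=
  (forall z, dl <= complex.Re z -> derivable G z 1) /\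
  (forall z, dl <= complex.Re z -> Normc.normc (G z) <= M).

Lemma bounded_from_ge0 G dl M : bounded_from G dl M -> 0 <= M.
Proof. by move=> [_ /(_ (dl +i* 0) (lexx _))]; apply: le_trans; exact: normc_ge0. Qed.

Lemma bounded_from_vcont G dl M c d : bounded_from G dl M -> vcont G dl c d.
Proof. by move=> [dG _] y _; apply: derivable_continuous; apply: dG => /=. Qed.

(** The Poisson kernel of a half-plane, multiplied by [pi], for the point at
    distance [X] of the boundary line and at height [y0]. *)
Definition poisson X y0 s : R := X / ((s - y0) ^+ 2 + X ^+ 2).

Lemma poisson_den_gt0 X y0 s : 0 < X -> 0 < (s - y0) ^+ 2 + X ^+ 2.
Proof. by move=> X0; rewrite ltr_wpDl ?sqr_ge0// exprn_gt0. Qed.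

Lemma poisson_ge0 X y0 s : 0 < X -> 0 <= poisson X y0 s.
Proof. by move=> X0; rewrite divr_ge0 ?ltW// poisson_den_gt0. Qed.

Lemma cts_poissonM G dl M X y0 c d : 0 < X -> bounded_from G dl M ->
  cts_on (fun s => poisson X y0 s * complex.Re (G (dl +i* s))) c d.
Proof.
move=> X0 bG; apply: cts_onM; first exact: cts_poisson.
by apply: vcont_Re; apply: bounded_from_vcont bG.
Qed.

(** Cauchy's formula for [G] times [1 / (z - w) - 1 / (z - w')], where [w'] is the
    mirror image of [w] in the line [Re z = dl]. On that line the kernel is twice
    the Poisson kernel; on the three other sides of a rectangle of size [N] it is
    [O(1 / N ^ 2)], and their length is [O(N)]. *)
Lemma poisson_trunc G dl y0 X M N : 0 < X -> 2 * X <= N -> bounded_from G dl M ->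
  `|itgl (fun s => poisson X y0 s * complex.Re (G (dl +i* s))) (y0 - N) (y0 + N)
    - pi * complex.Re (G ((dl + X) +i* y0))| <= 10 * X * M / N.
Proof.
move=> X0 XN bG; have [dG MG] := bG; have M0 := bounded_from_ge0 bG.
have N0 : 0 < N by rewrite (lt_le_trans _ XN)// mulr_gt0.
have XN1 : X < N by rewrite (lt_le_trans _ XN)// ltr_pMl// ltr1n.
set w := (dl + X) +i* y0; pose w' := (dl - X) +i* y0.
pose q z := (2 * X)%:C * G z / (z - w').
pose f z := q z / (z - w).
have ww' : w - w' = (2 * X)%:C.
  by apply/eqP; rewrite eq_complex /=; apply/andP; split; apply/eqP; ring.
have X2 : (2 * X)%:C != 0 :> R[i] by rewrite eq_complex /= eqxx andbT mulf_neq0// gt_eqF.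
have qw : q w = G w by rewrite /q ww' mulrAC divff// mul1r.
have dq z : dl <= complex.Re z -> derivable q z 1.
  move=> hz; apply: derivable_divB.
    apply/eqP => zE; move: hz; rewrite zE /= lerBrDr gerDl leNgt => /negP; apply; exact: X0.
  by apply: derivable_mul; [exact: derivable_const|exact: dG].
have df z : dl <= complex.Re z -> z != w -> derivable f z 1.
  by move=> hz zw; apply: derivable_divB => //; exact: dq.
have h1 : dl < dl + X by rewrite ltrDl.
have h2 : dl + X < dl + N by rewrite ltrD2l.
have h3 : y0 - N < y0 by rewrite gtrBl.
have h4 : y0 < y0 + N by rewrite ltrDl.
have h12 := lt_trans h1 h2; have h34 := lt_trans h3 h4.
have dqr : derivable_rect q dl (dl + N) (y0 - N) (y0 + N).
  by move=> x y /andP[hx _] _; exact: dq.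
have E := cauchy_rect h1 h2 h3 h4 dqr; rewrite -/w qw in E.
have hcc : hcont f (y0 - N) dl (dl + N).
  move=> x /andP[hx _]; apply: derivable_continuous; apply: df => //.
  by apply/eqP => -[_ yE]; rewrite yE ltxx in h3.
have hcd : hcont f (y0 + N) dl (dl + N).
  move=> x /andP[hx _]; apply: derivable_continuous; apply: df => //.
  by apply/eqP => -[_ yE]; rewrite yE ltxx in h4.
have vca : vcont f dl (y0 - N) (y0 + N).
  move=> y _; apply: derivable_continuous; apply: df => //=.
  by apply/eqP => -[xE _]; rewrite -xE ltxx in h1.
have vcb : vcont f (dl + N) (y0 - N) (y0 + N).
  move=> y _; apply: derivable_continuous; apply: df => /=; first exact: ltW.
  by apply/eqP => -[xE _]; rewrite xE ltxx in h2.
have fb x y p : dl <= x -> 0 < p -> p <= Normc.normc (x +i* y - w) ->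
    p <= Normc.normc (x +i* y - w') -> Normc.normc (f (x +i* y)) <= 2 * X * M / p ^+ 2.
  move=> hx p0 pw pw'; rewrite /f /q !Normc.normcM !Normc.normcV.
  rewrite [Normc.normc (2 * X)%:C]/= expr0n addr0 sqrtr_sqr ger0_norm; last by rewrite mulr_ge0 ?ltW.
  rewrite expr2 invfM mulrA.
  have iv t : p <= t -> t^-1 <= p^-1 by move=> pt; rewrite lef_pV2// posrE// (lt_le_trans p0).
  apply: ler_pM; [|by rewrite invr_ge0 normc_ge0| |exact: iv].
    by rewrite !mulr_ge0 ?normc_ge0 ?invr_ge0 ?normc_ge0// ltW.
  apply: ler_pM; [|by rewrite invr_ge0 normc_ge0| |exact: iv].
    by rewrite !mulr_ge0 ?normc_ge0// ltW.
  by rewrite ler_wpM2l ?MG// mulr_ge0// ltW.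
have N1 : 0 <= N by exact: ltW.
have B1 : `|itgl (fun x => complex.Im (f (x +i* (y0 - N)))) dl (dl + N)| <= 2 * X * M / N.
  have -> : 2 * X * M / N = 2 * X * M / N ^+ 2 * (dl + N - dl) by field; rewrite gt_eqF.
  apply: itgl_norm_le; [exact: ltW|exact: hcont_Im|move=> x /andP[hx _]].
  apply: le_trans (Im_le_normc _) _; apply: fb => //.
    by apply: le_trans (Im_le_normc _); rewrite /= addrAC subrr add0r normrN ger0_norm.
  by apply: le_trans (Im_le_normc _); rewrite /= addrAC subrr add0r normrN ger0_norm.
have B2 : `|itgl (fun x => complex.Im (f (x +i* (y0 + N)))) dl (dl + N)| <= 2 * X * M / N.
  have -> : 2 * X * M / N = 2 * X * M / N ^+ 2 * (dl + N - dl) by field; rewrite gt_eqF.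
  apply: itgl_norm_le; [exact: ltW|exact: hcont_Im|move=> x /andP[hx _]].
  apply: le_trans (Im_le_normc _) _; apply: fb => //.
    by apply: le_trans (Im_le_normc _); rewrite /= addrAC subrr add0r ger0_norm.
  by apply: le_trans (Im_le_normc _); rewrite /= addrAC subrr add0r ger0_norm.
have B3 : `|itgl (fun y => complex.Re (f ((dl + N) +i* y))) (y0 - N) (y0 + N)| <= 16 * X * M / N.
  have -> : 16 * X * M / N = 2 * X * M / (N / 2) ^+ 2 * (y0 + N - (y0 - N)).
    by field; rewrite gt_eqF.
  apply: itgl_norm_le; [exact: ltW|exact: vcont_Re|move=> y _].
  have n2 : N / 2 + N / 2 = N by rewrite -splitr.
  have XN2 : X <= N / 2 by rewrite ler_pdivlMr// mulrC.
  apply: le_trans (Re_le_normc _) _; apply: fb; [exact: ltW|exact: divr_gt0| |].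
    apply: le_trans (Re_le_normc _); rewrite /= ler_normr; apply/orP; left.
    have -> : dl + N - (dl + X) = N - X by ring.
    by rewrite -{2}n2 -addrA lerDl subr_ge0.
  apply: le_trans (Re_le_normc _); rewrite /= ler_normr; apply/orP; left.
  have -> : dl + N - (dl - X) = N + X by ring.
  by rewrite -{2}n2 -addrA lerDl addr_ge0// ltW// divr_gt0.
have EL : itgl (fun y => complex.Re (f (dl +i* y))) (y0 - N) (y0 + N) =
    - 2 * itgl (fun s => poisson X y0 s * complex.Re (G (dl +i* s))) (y0 - N) (y0 + N).
  rewrite -itglZ; last exact: cts_poissonM bG.
  apply: eq_itgl => s _; rewrite /f /q /poisson.
  have D0 := poisson_den_gt0 y0 s X0.
  case: (G (dl +i* s)) => gr gi /=.
  have -> : dl + - (dl - X) = X by ring.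
  have -> : dl + - (dl + X) = - X by ring.
  by field; rewrite ?sqrrN -?[X ^+ 2 + _]addrC ?(gt_eqF D0).
move: E; rewrite -[contour_im _ _ _ _ _]/(contour_im f dl (dl + N) (y0 - N) (y0 + N)) contour_imE//.
rewrite EL => E.
set H1 := itgl _ _ _ in E B1; set H2 := itgl _ _ _ in E B2.
set V := itgl _ _ _ in E B3; set J := itgl _ _ _ in E *.
have -> : J - pi * complex.Re (G w) = - ((H1 - H2) + V) / 2 by move: E; clear => E; lra.
have -> : 10 * X * M / N = ((2 * X * M / N + 2 * X * M / N) + 16 * X * M / N) / 2.
  by field; rewrite gt_eqF.
rewrite normrM normrN [`|2^-1|]ger0_norm ?invr_ge0// ler_wpM2r ?invr_ge0//.
apply: le_trans (ler_normD _ _) _; apply: lerD => //.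
by apply: le_trans (ler_normB _ _) _; apply: lerD.
Qed.

Lemma poisson_le_Re G dl y0 X M (g : R -> R) : 0 < X -> bounded_from G dl M ->
  measurable_fun setT g ->
  (forall s, `|complex.Re (G (dl +i* s))| <= g s) ->
  ((pi * complex.Re (G ((dl + X) +i* y0)))%:E <= \int[m]_s (poisson X y0 s * g s)%:E)%E.
Proof.
move=> X0 bG mg Gg.
have g0 s : 0 <= g s by apply: le_trans (Gg s).
have mp : measurable_fun setT (poisson X y0).
  apply: continuous_measurable_fun => s.
  by apply: (@cts_poisson _ y0 X s s X0); rewrite lexx.
have mpg : measurable_fun setT (fun s => poisson X y0 s * g s) by exact: measurable_funM.
have pg0 s : 0 <= poisson X y0 s * g s by rewrite mulr_ge0// poisson_ge0.
have J N : (`|itgl (fun s => poisson X y0 s * complex.Re (G (dl +i* s))) (y0 - N) (y0 + N)|%:E <=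
    \int[m]_s (poisson X y0 s * g s)%:E)%E.
  apply: itgl_le_integral => //; first exact: cts_poissonM bG.
  by move=> s _; rewrite normrM ger0_norm ?poisson_ge0// ler_wpM2l// poisson_ge0.
case: (\int[m]_s _)%E J => [r| |] J; [|exact: leey|by have := J 0].
rewrite lee_fin; apply: (@le_of_le_add_inv _ _ (10 * X * M) (2 * X)); first exact: mulr_gt0.
move=> N XN; have := poisson_trunc y0 X0 XN bG; have := J N; rewrite lee_fin.
rewrite ler_norml => /andP[_ h1]; rewrite distrC => /(le_trans (ler_norm _)).
by rewrite lerBlDl => /le_trans; apply; rewrite lerD2r.
Qed.

Lemma poisson_le_normc G dl y0 X M (g : R -> R) : 0 < X -> bounded_from G dl M ->
  measurable_fun setT g ->
  (forall s, Normc.normc (G (dl +i* s)) <= g s) ->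
  ((pi * Normc.normc (G ((dl + X) +i* y0)))%:E <= \int[m]_s (poisson X y0 s * g s)%:E)%E.
Proof.
move=> X0 [dG MG] mg Gg.
have [k k1 kE] := unimodular_rotation (G ((dl + X) +i* y0)).
have bk : bounded_from (fun z => k * G z) dl M.
  split=> z hz; first by apply: derivable_mul; [exact: derivable_const|exact: dG].
  by rewrite Normc.normcM k1 mul1r MG.
have -> : Normc.normc (G ((dl + X) +i* y0)) = complex.Re (k * G ((dl + X) +i* y0)).
  by rewrite kE.
apply: (poisson_le_Re y0 X0 bk mg) => s.
by apply: le_trans (Re_le_normc _) _; rewrite Normc.normcM k1 mul1r.
Qed.

Lemma integral_bigcup_le (F : nat -> set R) (h : R -> R) (B : \bar R) :
  (forall n, measurable (F n)) -> (forall i j, (i <= j)%N -> F i `<=` F j) ->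
  measurable_fun setT h -> (forall s, 0 <= h s) ->
  (forall n, \int[m]_(s in F n) (h s)%:E <= B)%E ->
  (\int[m]_(s in \bigcup_n F n) (h s)%:E <= B)%E.
Proof.
move=> mF Fnd mh h0 hB.
have mhE : measurable_fun setT (EFin \o h) by exact/measurable_EFinP.
have h0' n s : F n s -> (0 <= (EFin \o h) s)%E by rewrite lee_fin.
have mhF n : measurable_fun (F n) (EFin \o h) by exact: measurable_funS mhE.
have ndF : nondecreasing_seq F by move=> i j ij; apply/subsetPset; exact: Fnd.
pose mu : {measure set (measurableTypeR R) -> \bar R} := m.
have := @ge0_nondecreasing_set_cvg_integral _ (measurableTypeR R) R F (EFin \o h) mu
  ndF mF mhF h0'.
by move=> /cvge_to_le; apply; apply: nearW => n; exact: hB.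
Qed.

Lemma integral_le_trunc (h : R -> R) (B : \bar R) : measurable_fun setT h ->
  (forall s, 0 <= h s) ->
  (forall n, \int[m]_(s in `[(- n.+1%:R)%R, n.+1%:R]) (h s)%:E <= B)%E ->
  (\int[m]_s (h s)%:E <= B)%E.
Proof.
move=> mh h0 hB; pose F n : set R := `[- n.+1%:R, n.+1%:R]%classic.
have -> : (\int[m]_s (h s)%:E = \int[m]_(s in \bigcup_n F n) (h s)%:E)%E.
  congr (integral _ _ _); apply/seteqP; split => // s _.
  exists (Num.bound `|s|) => //; rewrite /F /= in_itv /= -ler_norml.
  by rewrite ltW// (lt_trans (archi_boundP (normr_ge0 s)))// ltr_nat.
apply: (integral_bigcup_le (F := F)) => // [n|i j ij s]; first exact: measurable_itv.
rewrite /F /= !in_itv /= => /andP[s1 s2].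
by rewrite (le_trans _ s1) ?(le_trans s2) ?lerN2 ?ler_nat.
Qed.

(** The kernel [X * poisson X 0 s = X ^ 2 / (s ^ 2 + X ^ 2)] tends to 1 as [X] grows,
    and Poisson's formula evaluates the integral of [Re G] against it. *)
Lemma line_integral_le G dl M B : bounded_from G dl M ->
  (forall z, dl <= complex.Re z -> 0 <= complex.Re (G z)) ->
  (forall X, 0 < X -> X * complex.Re (G ((dl + X) +i* 0)) <= B) ->
  (\int[m]_s (complex.Re (G (dl +i* s)))%:E <= (pi * B)%:E)%E.
Proof.
move=> bG Gge GB; have G0 s : 0 <= complex.Re (G (dl +i* s)) by apply: Gge => /=.
have cG c d : cts_on (fun s => complex.Re (G (dl +i* s))) c d.
  by apply: vcont_Re; apply: bounded_from_vcont bG.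
have mG : measurable_fun setT (fun s => complex.Re (G (dl +i* s))).
  by apply: continuous_measurable_fun => s; apply: (cG s s); rewrite lexx.
have M0 := bounded_from_ge0 bG.
(* as the integrand is nonnegative, truncated integrals increase with N *)
have trunc n X : 0 < n -> 0 < X ->
    itgl (fun s => poisson X 0 s * complex.Re (G (dl +i* s))) (- n) n <=
    pi * complex.Re (G ((dl + X) +i* 0)).
  move=> n0 X0; apply: (@le_of_le_add_inv _ _ (10 * X * M) (Num.max n (2 * X))).
    by rewrite lt_max n0.
  move=> N; rewrite ge_max => /andP[nN XN].
  have nn : - n <= n by rewrite (@le_trans _ _ 0)// ?oppr_le0 ltW.
  have NN : - N <= - n by rewrite lerN2.
  have := poisson_trunc 0 X0 XN bG; rewrite !add0r => /(le_trans (ler_norm _)).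
  rewrite lerBlDl; apply: le_trans.
  have cP c d := cts_poissonM (y0 := 0) (c := c) (d := d) X0 bG.
  rewrite (itgl_split NN (le_trans nn nN) (cP _ _)) (itgl_split nn nN (cP _ _)).
  have ge c d : 0 <= itgl (fun s => poisson X 0 s * complex.Re (G (dl +i* s))) c d.
    by apply: Rintegral_ge0 => s _; rewrite mulr_ge0 ?poisson_ge0.
  by rewrite addrA (addrC _ (itgl _ (- n) n)) -addrA lerDl addr_ge0.
have bnd n : 0 < n -> itgl (fun s => complex.Re (G (dl +i* s))) (- n) n <= pi * B.
  move=> n0.
  have B0 : 0 <= B.
    by apply: le_trans (GB 1 ltr01); rewrite mul1r Gge//= lerDl.
  apply: (@le_of_le_add_inv _ _ (n ^+ 2 * (pi * B)) 1) => // X X1.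
  have X0 : 0 < X by rewrite (lt_le_trans _ X1).
  have c0 : 0 <= (1 + n ^+ 2 / X ^+ 2) * X.
    by rewrite mulr_ge0 ?(ltW X0)// addr_ge0// divr_ge0// sqr_ge0.
  apply: (@le_trans _ _ ((1 + n ^+ 2 / X ^+ 2) * X * (pi * complex.Re (G ((dl + X) +i* 0))))).
    apply: le_trans (ler_wpM2l c0 (trunc n X n0 X0)).
    rewrite -itglZ; last exact: cts_poissonM bG.
    apply: le_itgl => //; first by apply: cts_onM; [exact: cts_on_cst|exact: cts_poissonM bG].
    move=> s /andP[s1 s2]; rewrite mulrA -[X in X <= _]mul1r ler_wpM2r//.
    rewrite /poisson subr0 mulrA ler_pdivlMr ?ltr_wpDl ?sqr_ge0 ?exprn_gt0//.
    rewrite mul1r -mulrA -expr2 mulrDl mul1r divfK ?sqrf_eq0 ?gt_eqF// addrC lerD2l.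
    by rewrite -ler_sqrt ?sqr_ge0// !sqrtr_sqr ler_norml (ger0_norm (ltW n0)) s1.
  have -> : (1 + n ^+ 2 / X ^+ 2) * X * (pi * complex.Re (G ((dl + X) +i* 0))) =
      pi * (1 + n ^+ 2 / X ^+ 2) * (X * complex.Re (G ((dl + X) +i* 0))) by ring.
  have p0 : 0 <= pi * (1 + n ^+ 2 / X ^+ 2) :> R.
    by rewrite mulr_ge0 ?pi_ge0// addr_ge0// divr_ge0// sqr_ge0.
  apply: le_trans (ler_wpM2l p0 (GB X X0)) _.
  have -> : pi * (1 + n ^+ 2 / X ^+ 2) * B = pi * B + n ^+ 2 * (pi * B) / X ^+ 2 by ring.
  rewrite lerD2l ler_wpM2l//; first by rewrite mulr_ge0 ?sqr_ge0// mulr_ge0 ?pi_ge0.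
  by rewrite lef_pV2 ?posrE ?exprn_gt0// expr2 ler_peMl// ltW.
apply: integral_le_trunc => // n; have := bnd n.+1%:R (ltr0Sn _ _); rewrite -lee_fin.
apply: le_trans; rewrite /itgl /Rintegral fineK//.
exact: integrable_fin_num (cts_on_integrable (cG _ _)).
Qed.

(** The kernel [poisson X y s / X = 1 / ((s - y) ^ 2 + X ^ 2)] decreases with [X]. *)
Lemma re_quotient_noninc G dl M y X X' : bounded_from G dl M ->
  (forall z, dl <= complex.Re z -> 0 <= complex.Re (G z)) -> 0 < X -> X <= X' ->
  complex.Re (G ((dl + X') +i* y)) / X' <= complex.Re (G ((dl + X) +i* y)) / X.
Proof.
move=> bG Gge X0 XX'; have X'0 : 0 < X' := lt_le_trans X0 XX'.
have pi0 : 0 < pi :> R := pi_gt0 R.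
rewrite -(ler_pM2l pi0) !mulrA.
apply: (@le_of_le_add_inv _ _ (20 * M) (2 * X')); first exact: mulr_gt0.
move=> N XN'; have XN : 2 * X <= N by apply: le_trans XN'; rewrite ler_pM2l.
have N0 : 0 < N by apply: lt_le_trans XN; rewrite mulr_gt0.
have := poisson_trunc y X0 XN bG; have := poisson_trunc y X'0 XN' bG.
set J' := itgl _ _ _; set J := itgl _ _ _.
have JJ : J' / X' <= J / X.
  rewrite /J' /J ![itgl _ _ _ / _]mulrC -!itglZ; try exact: cts_poissonM bG.
  apply: le_itgl; try by apply: cts_onM; [exact: cts_on_cst|exact: cts_poissonM bG].
  move=> s _; rewrite !mulrA ler_wpM2r ?Gge//=.
  rewrite /poisson !mulVf ?gt_eqF// !mul1r lef_pV2 ?posrE ?poisson_den_gt0//.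
  by rewrite lerD2l ler_pXn2r// nnegrE ltW.
rewrite distrC => /(le_trans (ler_norm _)); rewrite lerBlDr => h1.
move=> /(le_trans (ler_norm _)); rewrite lerBlDr => h2.
have : pi * complex.Re (G ((dl + X') +i* y)) / X' <= 10 * M / N + J' / X'.
  have -> : 10 * M / N + J' / X' = (10 * X' * M / N + J') / X' by field; rewrite !gt_eqF.
  by rewrite ler_pM2r ?invr_gt0.
move=> /le_trans; apply.
have : J / X <= 10 * M / N + pi * complex.Re (G ((dl + X) +i* y)) / X.
  have -> : 10 * M / N + pi * complex.Re (G ((dl + X) +i* y)) / X =
    (10 * X * M / N + pi * complex.Re (G ((dl + X) +i* y))) / X by field; rewrite !gt_eqF.
  by rewrite ler_pM2r ?invr_gt0.
move=> /(le_trans JJ) h3.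
have -> : 20 * M / N = 10 * M / N + 10 * M / N by rewrite -!mulrDl -natrD.
by rewrite addrA [X in X <= _]addrC lerD2r (le_trans h3)// addrC.
Qed.

(** Julia's lemma along a horizontal line. The map [phi] may be unbounded, so the
    previous lemma is applied on [Re z >= d] to [phi / (1 + e phi)], the inverse
    of [e + 1 / phi], which has a positive real part and modulus at most [1 / e];
    then [e] and [d] tend to 0. *)
Lemma half_plane_map_julia (phi : R[i] -> R[i]) y (x x' : R) :
  (forall z, 0 < complex.Re z -> derivable phi z 1) ->
  (forall z, 0 < complex.Re z -> 0 < complex.Re (phi z)) ->
  0 < x -> x <= x' ->
  complex.Re (phi (x' +i* y)) / x' <= complex.Re (phi (x +i* y)) / x.
Proof.
move=> dphi rphi x0 xx'; have x'0 := lt_le_trans x0 xx'.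
have step d : 0 < d -> d < x ->
    complex.Re (phi (x' +i* y)) / (x' - d) <= complex.Re (phi (x +i* y)) / (x - d).
  move=> d0 dx; have xd : 0 < x - d by rewrite subr_gt0.
  have x'd : 0 < x' - d by rewrite (lt_le_trans xd)// lerD2r.
  pose n z := Normc.normc (phi z) ^+ 2.
  apply: (@le_of_le_add_inv _ _ (n (x' +i* y) / (x' - d) + n (x +i* y) / (x - d)) 1) => // N N1.
  have N0 : 0 < N by rewrite (lt_le_trans _ N1).
  pose e := N^-1; have e0 : 0 < e by rewrite invr_gt0.
  pose G z := phi z / (1 + e%:C * phi z).
  have den z : 0 < complex.Re z -> 1 <= Normc.normc (1 + e%:C * phi z).
    move=> hz; apply: le_trans (le_trans (ler_norm _) (Re_le_normc _)).
    have := rphi z hz; case: (phi z) => a b /= a0.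
    by rewrite mul0r subr0 lerDl mulr_ge0// ltW.
  have den0 z : 0 < complex.Re z -> 1 + e%:C * phi z != 0.
    by move=> hz; rewrite -normc_gt0 (lt_le_trans ltr01)// den.
  have bG : bounded_from G d N.
    split=> z /(lt_le_trans d0) hz.
      apply: derivable_mul; first exact: dphi.
      apply: derivable_inv; first exact: den0.
      apply: derivable_add; first exact: derivable_const.
      by apply: derivable_mul; [exact: derivable_const|exact: dphi].
    rewrite Normc.normcM Normc.normcV ler_pdivrMr ?(lt_le_trans ltr01) ?den//.
    rewrite -ler_pdivrMl// -/e.
    have -> : e * Normc.normc (phi z) = Normc.normc (e%:C * phi z).
      by rewrite Normc.normcM /= expr0n addr0 sqrtr_sqr gtr0_norm.
    rewrite -(@ler_pXn2r _ 2)// ?nnegrE ?normc_ge0// !normc_sqr.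
    have := rphi z hz; case: (phi z) => a b /= a0; rewrite !(mul0r, subr0, addr0, add0r).
    by rewrite lerD2r ler_pXn2r ?nnegrE ?addr_ge0 ?mulr_ge0 ?(ltW e0) ?(ltW a0)// lerDr.
  have Gge z : d <= complex.Re z -> 0 <= complex.Re (G z).
    move=> /(lt_le_trans d0) hz; rewrite /G; have := rphi z hz.
    case: (phi z) => a b /= a0; rewrite !(mul0r, subr0, addr0, add0r) mulrN opprK.
    rewrite addr_ge0//; last by rewrite mulrA mulr_ge0 ?invr_ge0 ?addr_ge0 ?sqr_ge0// mulrCA mulr_ge0 ?(ltW e0)// -expr2 sqr_ge0.
    by rewrite !mulr_ge0 ?invr_ge0 ?addr_ge0 ?sqr_ge0 ?mulr_ge0 ?(ltW e0) ?(ltW a0).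
  have close z : 0 < complex.Re z -> `|complex.Re (G z) - complex.Re (phi z)| <= n z / N.
    move=> hz; rewrite -ReB; apply: le_trans (Re_le_normc _) _.
    have -> : G z - phi z = - (phi z * phi z) * e%:C / (1 + e%:C * phi z).
      by rewrite /G; field; exact: den0.
    rewrite Normc.normcM Normc.normcV ler_pdivrMr ?(lt_le_trans ltr01) ?den//.
    rewrite Normc.normcM normcN Normc.normcM -expr2 -/(n z) /= expr0n addr0 sqrtr_sqr gtr0_norm//.
    by rewrite ler_peMr ?den// mulr_ge0 ?sqr_ge0// ltW.
  have xxd : x - d <= x' - d by rewrite lerD2r.
  have := re_quotient_noninc y bG Gge xd xxd; rewrite !subrKC.
  have h1 := close (x' +i* y) x'0; have h2 := close (x +i* y) x0 => h3.
  move: h1; rewrite distrC => /(le_trans (ler_norm _)); rewrite lerBlDr => h1.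
  move: h2 => /(le_trans (ler_norm _)); rewrite lerBlDr => h2.
  have xdi : 0 <= (x - d)^-1 by rewrite invr_ge0 ltW.
  have x'di : 0 <= (x' - d)^-1 by rewrite invr_ge0 ltW.
  apply: le_trans (ler_wpM2r x'di h1) _; rewrite mulrDl.
  apply: le_trans (lerD (lexx _) h3) _.
  apply: le_trans (lerD (lexx _) (ler_wpM2r xdi h2)) _.
  by rewrite le_eqVlt; apply/orP; left; apply/eqP; ring.
rewrite ler_pdivrMr// mulrAC ler_pdivlMr//.
have p' := rphi (x' +i* y) x'0; have p := rphi (x +i* y) x0.
apply: (@le_of_le_add_inv _ _ (complex.Re (phi (x' +i* y)) * x) 2) => // N N2.
have N0 : 0 < N by rewrite (lt_le_trans _ N2).
have d0 : 0 < x / N by rewrite divr_gt0.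
have dx : x / N < x by rewrite ltr_pdivrMr// ltr_pMr// (lt_le_trans _ N2)// ltr1n.
have := step _ d0 dx; rewrite ler_pdivrMr ?subr_gt0 ?(lt_le_trans dx)// mulrAC ler_pdivlMr ?subr_gt0//.
rewrite !mulrBr mulrA lerBlDr => /le_trans; apply; rewrite lerD2r gerBl.
by rewrite mulr_ge0// ltW.
Qed.

End poisson.

(** * Affine changes of variable *)
Section affine_integral.
Context {R : realType}.
Local Notation m := (@lebesgue_measure R).
Variables (k b : R) (k0 : 0 < k).

Let T (x : measurableTypeR R) : measurableTypeR R := k * x + b.

Let mT : measurable_fun setT T.
Proof. by apply: measurable_funD => //; exact: measurable_funM. Qed.

Let image_measure : {measure set (measurableTypeR R) -> \bar R} :=
  measure_function_pushforward__canonical__measure_function_Measure m mT.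
Let mu : {measure set (measurableTypeR R) -> \bar R} :=
  mscale (NngNum (ltW k0)) image_measure.

Let muE (A : set R) : measurable A -> m A = mu A.
Proof.
apply: lebesgue_measure_unique => _ [[p q]] _ <-.
have E : T @^-1` `]p, q] = `](p - b) / k, (q - b) / k]%classic.
  apply/seteqP; split=> x /=; rewrite !in_itv /= ltr_pdivrMr// ler_pdivlMr//;
    by rewrite ltrBlDr lerBrDr mulrC.
have := @lebesgue_measure_itv R `]p, q]; have := @lebesgue_measure_itv R `](p - b) / k, (q - b) / k].
rewrite -[mu _]/((k%:E * m (T @^-1` `]p, q]))%E) E /=.
move=> -> ->; rewrite !lte_fin ltr_pM2r ?invr_gt0// ltrD2r.
case: ifPn => _; last by rewrite mule0.
by rewrite -!EFinD -EFinM; congr EFin; field; rewrite gt_eqF.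
Qed.

(** Lebesgue measure is [k] times its image under [x |-> k x + b], as both agree on
    intervals. *)
Lemma integral_affine (f : R -> \bar R) : measurable_fun setT f ->
  (forall x, 0 <= f x)%E ->
  (\int[m]_x f x = k%:E * \int[m]_x f (k * x + b)%R)%E.
Proof.
move=> mf f0.
rewrite (@eq_measure_integral _ _ _ _ mu); last by move=> A mA _; exact: muE.
rewrite ge0_integral_mscale//; congr (_ * _)%E.
by rewrite ge0_integral_pushforward.
Qed.

End affine_integral.

(** * Growth of Bergman functions *)
Section bergman_estimates.
Context {R : realType} (alpha : R).
Local Notation m := (@lebesgue_measure R).
Implicit Types (F : rhp R -> R[i]).

Definition density F (p : R * R) : R :=
  p.1 `^ alpha * Normc.normc (rhp_ext F (p.1 +i* p.2)) ^+ 2.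

Lemma density_ge0 F p : 0 <= density F p.
Proof. by rewrite mulr_ge0 ?powR_ge0 ?sqr_ge0. Qed.

Lemma measurable_density F : holomorphic F -> measurable_fun setT (density F).
Proof.
move=> hF; apply: measurable_funM.
  exact: (measurableT_comp (measurable_powR alpha) measurable_fst).
exact: measurable_funX (holo_measurable hF).
Qed.

Definition line_mass F (x : R) : \bar R := (\int[m]_y (density F (x, y))%:E)%E.

Lemma line_mass_ge0 F x : (0 <= line_mass F x)%E.
Proof. by apply: integral_ge0 => y _; rewrite lee_fin density_ge0. Qed.

Lemma measurable_line_mass F : holomorphic F -> measurable_fun setT (line_mass F).
Proof. by move=> /measurable_density mF; exact: (measurable_iter1 mF (density_ge0 F)). Qed.

Lemma bergman_integral_line_mass F : holomorphic F ->
  bergman_integral alpha F = ((pi^-1)%:E * \int[m]_x line_mass F x)%E.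
Proof.
move=> hF; rewrite bergman_integralE//; congr (_ * _)%E.
have mg' : measurable_fun setT (EFin \o density F) by apply/measurable_EFinP; exact: measurable_density.
have g0' p : (0 <= (EFin \o density F) p)%E by rewrite lee_fin density_ge0.
exact: (fubini_tonelli1 (m1 := m) (m2 := m) _ mg' g0').
Qed.

Lemma holomorphicP F : holomorphic F ->
  forall z : R[i], 0 < complex.Re z -> derivable (rhp_ext F) z 1.
Proof. by move=> hF z z0; have := hF (Sub z z0); rewrite SubK. Qed.

Lemma powR_strip : exists2 c : R, 0 < c &
  forall x0 x, 0 < x0 -> x0 / 2 <= x <= x0 * 2 -> c * x0 `^ alpha <= x `^ alpha.
Proof.
have [a0|a0] := leP 0 alpha.
  exists (2^-1 `^ alpha); first by rewrite powR_gt0.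
  move=> x0 x x00 /andP[h1 h2]; rewrite -powRM ?(ltW x00)//.
  apply: ge0_ler_powR => //; rewrite ?nnegrE; last by rewrite mulrC.
    by rewrite mulr_ge0 ?invr_ge0// ltW.
  by rewrite (le_trans _ h1)// divr_ge0// ltW.
exists (2 `^ alpha); first by rewrite powR_gt0.
move=> x0 x x00 /andP[h1 h2]; rewrite -powRM ?(ltW x00)//.
have x1 : 0 < x by rewrite (lt_le_trans _ h1)// divr_gt0.
rewrite -[alpha]opprK !(powRN _ (- alpha)) lef_pV2 ?posrE ?powR_gt0 ?mulr_gt0//.
apply: ge0_ler_powR; rewrite ?nnegrE ?oppr_ge0 ?(ltW a0) ?(ltW x1)//.
  by rewrite mulr_ge0// ltW.
by rewrite mulrC.
Qed.

Lemma integral_indic_line_mass F (k a b : R) : holomorphic F -> 0 <= k ->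
  (\int[m]_x \int[m]_y (k * (\1_(`[a, b]%classic) x * density F (x, y)))%:E =
   k%:E * \int[m]_(x in `[a, b]) line_mass F x)%E.
Proof.
move=> hF k0; have md := measurable_density hF.
have mL := measurable_line_mass hF.
transitivity (\int[m]_x (k%:E * ((line_mass F) \_ `[a, b]) x))%E.
  apply: eq_integral => x _; under eq_integral do rewrite mulrA EFinM.
  rewrite ge0_integralZl//; last 3 first.
  - by apply/measurable_EFinP; exact: measurable_slice1.
  - by move=> y _; rewrite lee_fin density_ge0.
  - by rewrite lee_fin mulr_ge0.
  rewrite -/(line_mass F x) EFinM -muleA patchE indicE; congr (_ * _)%E.
  by case: ifPn => xab; rewrite ?mul1e ?mul0e.
rewrite ge0_integralZl//; last 2 first.
- by apply/(measurable_restrictT _ _).1 => //; exact: measurable_funS mL.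
- by move=> x _; rewrite patchE; case: ifPn => // _; exact: line_mass_ge0.
by rewrite -integral_mkcond.
Qed.

(** The local bound for [F ^ 2], on a box of half-side [x0 / 2]: there [x ^ alpha] is
    comparable to [x0 ^ alpha]. *)
Lemma pointwise_strip : exists2 D : R, 0 < D & forall F (x0 y0 A : R), holomorphic F -> 0 < x0 ->
  (\int[m]_(x in `[(x0 / 2)%R, (x0 * 2)%R]) line_mass F x < A%:E)%E ->
  Normc.normc (rhp_ext F (x0 +i* y0)) ^+ 2 * x0 `^ (2 + alpha) <= D * A.
Proof.
have [c c0 cP] := powR_strip; exists (16 / c); first by rewrite divr_gt0.
move=> F x0 y0 A hF x00 SA.
have r0 : 0 < x0 / 4 by rewrite divr_gt0.
have k0 : 0 < c * x0 `^ alpha by rewrite mulr_gt0 ?powR_gt0.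
have rE1 : x0 - 2 * (x0 / 4) = x0 / 2 by field.
have rE2 : x0 + 2 * (x0 / 4) <= x0 * 2.
  have -> : x0 + 2 * (x0 / 4) = x0 * (3 / 2) by field.
  by rewrite ler_wpM2l ?(ltW x00)// ler_pdivrMr// -!natrM ler_nat.
pose g (p : R * R) := (c * x0 `^ alpha)^-1 * (\1_(`[x0 / 2, x0 * 2]%classic) p.1 * density F (p.1, p.2)).
have g0 p : 0 <= g p by rewrite mulr_ge0 ?invr_ge0 ?(ltW k0)// mulr_ge0// density_ge0.
have mg : measurable_fun setT g.
  apply: measurable_funM => //; apply: measurable_funM; last exact: measurable_density.
  by apply: (measurableT_comp _ measurable_fst); exact: measurable_indic.
have := @local_mean R (fun z => rhp_ext F z * rhp_ext F z) g x0 y0 (x0 / 4)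
  ((c * x0 `^ alpha)^-1 * A) r0 _ mg g0 _ _.
rewrite Normc.normcM -expr2 => H.
have : Normc.normc (rhp_ext F (x0 +i* y0)) ^+ 2 * (x0 / 4) ^+ 2 <= (c * x0 `^ alpha)^-1 * A.
  apply: H.
  - move=> x y /andP[hx _] _; have : 0 < complex.Re (x +i* y) by rewrite /= (lt_le_trans _ hx)// rE1 divr_gt0.
    by move=> /(holomorphicP hF) dF; exact: derivable_mul.
  - move=> x y /andP[h1 h2] _; rewrite Normc.normcM -expr2 /g /=.
    have hx : x0 / 2 <= x <= x0 * 2 by rewrite -rE1 h1 (le_trans h2).
    rewrite indicE mem_set ?mul1r; last by rewrite /= in_itv.
    rewrite /density /= mulrA ler_peMl ?sqr_ge0// mulrC ler_pdivlMr// mul1r.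
    exact: cP.
  - rewrite integral_indic_line_mass// ?invr_ge0 ?(ltW k0)// EFinM lte_pmul2l//.
    by rewrite lte_fin invr_gt0.
rewrite powRD; last by apply/implyP => _; rewrite gt_eqF.
rewrite powR_mulrn ?(ltW x00)// => {}H.
have -> : 16 / c * A = (c * x0 `^ alpha)^-1 * A * (16 * x0 `^ alpha).
  by field; rewrite !gt_eqF// powR_gt0.
have h16 : 0 <= 16 * x0 `^ alpha by rewrite mulr_ge0 ?powR_ge0.
apply: le_trans (ler_wpM2r h16 H).
by rewrite le_eqVlt; apply/orP; left; apply/eqP; field.
Qed.

Lemma pointwise_bergman : exists2 D : R, 0 < D & forall F (x0 y0 A : R), holomorphic F -> 0 < x0 ->
  (bergman_integral alpha F <= A%:E)%E ->
  Normc.normc (rhp_ext F (x0 +i* y0)) ^+ 2 <= D * A * x0 `^ (- (2 + alpha)).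
Proof.
have [D D0 DP] := pointwise_strip; exists (D * pi) => [|F x0 y0 A hF x00 FA].
  by rewrite mulr_gt0// pi_gt0.
have pi0 : (0 < (pi : R)%:E)%E by rewrite lte_fin pi_gt0.
have IA : (\int[m]_x line_mass F x <= (pi * A)%:E)%E.
  have := lee_wpmul2l (ltW pi0) FA; rewrite bergman_integral_line_mass// muleA -EFinM.
  by rewrite divff ?gt_eqF ?pi_gt0// mul1e EFinM.
have p0 : 0 < x0 `^ (2 + alpha) by rewrite powR_gt0.
rewrite powRN ler_pdivlMr//; apply/ler_addgt0Pr => e e0.
have eD : 0 < e / D by rewrite divr_gt0.
have -> : D * pi * A + e = D * (pi * A + e / D) by field; rewrite gt_eqF.
apply: DP => //; apply: (@le_lt_trans _ _ (pi * A)%:E); last by rewrite lte_fin ltrDl.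
apply: le_trans IA; apply: ge0_subset_integral => //; first exact: measurable_line_mass.
by move=> x _; exact: line_mass_ge0.
Qed.

Let strips_separated (a b x : R) : 0 < a -> x <= a * 2 -> b / 2 <= x -> ~ a * 5 <= b.
Proof. by move=> *; lra. Qed.

(** The strips are disjoint, because [5 > 2 * 2], and the total mass is finite. *)
Lemma strip_mass_cvg0 F (e : R) : holomorphic F -> (bergman_integral alpha F < +oo)%E -> 0 < e ->
  exists N : nat, forall n, (N <= n)%N ->
    (\int[m]_(x in `[(5 ^+ n / 2)%R, (5 ^+ n * 2)%R]) line_mass F x < e%:E)%E.
Proof.
move=> hF Ffin e0.
pose I n : set R := `[5 ^+ n / 2, 5 ^+ n * 2]%classic.
have p5 n : 0 < 5 ^+ n :> R by rewrite exprn_gt0.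
have sepI i j x : (i < j)%N -> I i x -> I j x -> False.
  move=> ij; rewrite /I /= !in_itv /= => /andP[_ h1] /andP[h2 _].
  have : 5 ^+ i * 5 <= 5 ^+ j :> R by rewrite -exprSr ler_eXn2l// ltr1n.
  exact: strips_separated (p5 i) h1 h2.
have tI : trivIset setT I.
  move=> i j _ _ [x [Ii Ij]]; have [ij|ji|->] := ltngtP i j; last by [].
    by case: (sepI i j x ij Ii Ij).
  by case: (sepI j i x ji Ij Ii).
have mL := measurable_line_mass hF.
have mI n : measurable (I n) by exact: measurable_itv.
have mU : measurable (\bigcup_n I n) by exact: bigcupT_measurable.
pose mu : {measure set (measurableTypeR R) -> \bar R} := m.
have S := @ge0_integral_bigcup _ (measurableTypeR R) R mu I (line_mass F) mI (measurable_funS measurableT (@subsetT _ _) mL)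
   (fun x _ => line_mass_ge0 F x) tI.
have fin : (\sum_(n <oo) \int[m]_(x in I n) line_mass F x < +oo)%E.
  rewrite -S; apply: (@le_lt_trans _ _ (\int[m]_x line_mass F x)%E).
    by apply: ge0_subset_integral => // x _; exact: line_mass_ge0.
  move: Ffin; rewrite bergman_integral_line_mass//.
  have : (0 <= \int[m]_x line_mass F x)%E by apply: integral_ge0 => x _; exact: line_mass_ge0.
  case: (\int[m]_x line_mass F x)%E => [r _ _| _|//]; first exact: ltry.
  by rewrite gt0_muley ?ltxx// lte_fin invr_gt0 pi_gt0.
have I0 n : (0 <= \int[m]_(x in I n) line_mass F x)%E.
  by apply: integral_ge0 => x _; exact: line_mass_ge0.
have := nneseries_tail_cvg fin (fun n _ => I0 n).
have e0' : (0 < e%:E)%E by rewrite lte_fin.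
move=> /(_ _ (open_ereal_lt' e0'))[N _ NP]; exists N => n Nn.
apply: le_lt_trans (NP n Nn).
have := @nneseries_lim_ge R (fun k => \int[m]_(x in I k) line_mass F x)%E xpredT n n.+1
  (fun k _ _ => I0 k).
by rewrite big_nat1.
Qed.

End bergman_estimates.

(** * The upper bound for composition operators *)
Section composition_estimate.
Context {R : realType} (alpha : R) (alpha_gt : -1 < alpha).
Local Notation m := (@lebesgue_measure R).
Variables (phi : rhp R -> rhp R) (hphi : holomorphic (val \o phi)).
Implicit Types (F : rhp R -> R[i]).

Definition plane_map : R[i] -> R[i] := rhp_ext (val \o phi).
Local Notation Phi := plane_map.

Lemma plane_mapE (z : rhp R) : Phi (val z) = val (phi z).
Proof. by rewrite /plane_map rhp_extE. Qed.

Lemma plane_map_Re z : 0 < complex.Re z -> 0 < complex.Re (Phi z).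
Proof.
move=> z0; have := plane_mapE (Sub z z0); rewrite SubK => ->.
exact: (valP (phi (Sub z z0))).
Qed.

Lemma plane_map_derivable z : 0 < complex.Re z -> derivable Phi z 1.
Proof. exact: holomorphicP. Qed.

Lemma rhp_ext_comp F z : 0 < complex.Re z -> rhp_ext (F \o phi) z = rhp_ext F (Phi z).
Proof.
move=> z0; have := rhp_extE (F \o phi) (Sub z z0); have := plane_mapE (Sub z z0).
by rewrite SubK => -> ->; rewrite rhp_extE.
Qed.

Lemma measurable_poisson (X Y : R -> R) : measurable_fun setT X -> measurable_fun setT Y ->
  measurable_fun setT (fun p : R * R => poisson (X p.1) (Y p.1) p.2).
Proof.
move=> mX mY; rewrite /poisson.
under eq_fun => p do rewrite -powR_inv1 ?addr_ge0 ?sqr_ge0//.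
have mX1 : measurable_fun setT (fun p : R * R => X p.1) by exact: (measurableT_comp mX measurable_fst).
have mY1 : measurable_fun setT (fun p : R * R => Y p.1) by exact: (measurableT_comp mY measurable_fst).
apply: measurable_funM => //; apply: (measurableT_comp (measurable_powR (-1))).
apply: measurable_funD; apply: measurable_funX => //.
by apply: measurable_funB => //; exact: measurable_snd.
Qed.

Lemma square_bounded_from F A d : holomorphic F -> (bergman_integral alpha F <= A%:E)%E -> 0 < d ->
  exists M, bounded_from (fun z => rhp_ext F z * rhp_ext F z) d M.
Proof.
move=> hF FA d0; have [D D0 DP] := pointwise_bergman alpha.
exists (D * A * d `^ (- (2 + alpha))); split=> z hz; have z0 := lt_le_trans d0 hz.
  by apply: derivable_mul; exact: holomorphicP.
rewrite Normc.normcM -expr2 -{1}[z]ReImK; apply: le_trans (DP F _ _ A hF z0 FA) _.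
have A0 : 0 <= A by rewrite -lee_fin (le_trans _ FA)// bergman_integral_ge0.
rewrite ler_wpM2l ?mulr_ge0 ?(ltW D0)// !powRN lef_pV2 ?posrE ?powR_gt0//.
apply: ge0_ler_powR; rewrite ?nnegrE ?(ltW d0) ?(ltW z0)//.
by rewrite -lerBlDl sub0r ltW// (lt_trans _ alpha_gt)// ltrN2 ltr1n.
Qed.

(** At [phi (x + iy)] the function [|F| ^ 2] is at most its Poisson integral from the
    line [Re z = l' x]. Integrating over [y] and exchanging the integrals leaves, at
    the boundary point [l' x + is], the integral over [y] of the real part of
    [1 / (phi (x + iy) - l' x - is)]. This is a bounded holomorphic function of
    [x + iy] with positive real part which decays like [1 / (l X)] to the right,
    so that [line_integral_le] bounds its integral by [pi / l]. The gap between
    [l'] and [l] is what makes it bounded. *)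
Lemma line_contraction F A l l' x : holomorphic F -> holomorphic (F \o phi) ->
  (bergman_integral alpha F <= A%:E)%E ->
  0 < l' -> l' < l -> 0 < x ->
  (forall z, 0 < complex.Re z -> l * complex.Re z <= complex.Re (Phi z)) ->
  (\int[m]_y (Normc.normc (rhp_ext (F \o phi) (x +i* y)) ^+ 2)%:E <=
   (l^-1)%:E * \int[m]_s (Normc.normc (rhp_ext F ((l' * x) +i* s)) ^+ 2)%:E)%E.
Proof.
move=> hF hFp FA l'0 ll' x0 Phil.
have l0 := lt_trans l'0 ll'; pose d := l' * x; have d0 : 0 < d by rewrite mulr_gt0.
pose g s := Normc.normc (rhp_ext F (d +i* s)) ^+ 2.
have g0 s : 0 <= g s by exact: sqr_ge0.
have mg : measurable_fun setT g.
  by apply: measurable_funX; exact: (measurable_slice1 d (holo_measurable hF)).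
have [M bM] := square_bounded_from hF FA d0.
pose X y := complex.Re (Phi (x +i* y)) - d; pose Y y := complex.Im (Phi (x +i* y)).
have vcP a b : vcont Phi x a b.
  by move=> y _; apply: derivable_continuous; exact: plane_map_derivable.
have mX : measurable_fun setT X.
  apply: measurable_funB => //; apply: continuous_measurable_fun => y.
  by apply: (vcont_Re (vcP y y)); rewrite lexx.
have mY : measurable_fun setT Y.
  apply: continuous_measurable_fun => y.
  apply: (@continuous_comp _ _ _ (fun y => Phi (x +i* y)) (@complex.Im R)); last exact: continuous_Im.
  by apply: (continuous_comp (@continuous_vline R x y)); apply: (vcP y y); rewrite lexx.
have low z : x <= complex.Re z -> (l - l') * x <= complex.Re (Phi z) - d.
  move=> hz; rewrite mulrBl lerD2r (le_trans _ (Phil z _))//; last exact: lt_le_trans hz.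
  by rewrite ler_pM2l.
have ll0 : 0 < (l - l') * x by rewrite mulr_gt0// subr_gt0.
have X0 y : 0 < X y by apply: lt_le_trans (low (x +i* y) _) => /=.
pose K (p : R * R) := poisson (X p.1) (Y p.1) p.2 * g p.2.
have K0 p : 0 <= K p by rewrite mulr_ge0// poisson_ge0.
have mK : measurable_fun setT K.
  apply: measurable_funM; first exact: measurable_poisson.
  exact: (measurableT_comp mg measurable_snd).
have pi0 : (0 < (pi : R)%:E)%E by rewrite lte_fin pi_gt0.
have step1 y : (((pi : R) * Normc.normc (rhp_ext (F \o phi) (x +i* y)) ^+ 2)%:E <=
    \int[m]_s (K (y, s))%:E)%E.
  have := @poisson_le_normc R _ d (Y y) (X y) M g (X0 y) bM mg _.
  rewrite /X subrKC /Y ReImK Normc.normcM -expr2 rhp_ext_comp//; apply => s.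
  by rewrite Normc.normcM.
have step2 s : (\int[m]_y (K (y, s))%:E <= (g s)%:E * (pi * l^-1)%:E)%E.
  pose G z := (Phi z - (d +i* s))^-1.
  have den z : x <= complex.Re z -> (l - l') * x <= Normc.normc (Phi z - (d +i* s)).
    move=> hz; apply: le_trans (low z hz) (le_trans (ler_norm _) _).
    by apply: le_trans (Re_le_normc _); rewrite ReB.
  have bG : bounded_from G x ((l - l') * x)^-1.
    split=> z hz.
      apply: derivable_inv; first by rewrite -normc_gt0 (lt_le_trans ll0)// den.
      apply: derivable_add; last exact: derivable_const.
      by apply: plane_map_derivable; exact: lt_le_trans hz.
    by rewrite Normc.normcV lef_pV2 ?den// posrE// (lt_le_trans ll0)// den.
  have ReG z : complex.Re (G z) = (complex.Re (Phi z) - d) /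
      ((complex.Re (Phi z) - d) ^+ 2 + (complex.Im (Phi z) - s) ^+ 2).
    by rewrite /G; case: (Phi z).
  have Gge z : x <= complex.Re z -> 0 <= complex.Re (G z).
    move=> hz; rewrite ReG; apply: divr_ge0; last by rewrite addr_ge0 ?sqr_ge0.
    by apply: le_trans (low z hz); exact: ltW.
  have GB T : 0 < T -> T * complex.Re (G ((x + T) +i* 0)) <= l^-1.
    move=> T0; set z := (x + T) +i* 0.
    have lT : 0 < l * T by rewrite mulr_gt0.
    have lz : l * T <= Normc.normc (Phi z - (d +i* s)).
      apply: le_trans (le_trans (ler_norm _) (Re_le_normc _)); rewrite ReB /= lerBrDr.
      apply: le_trans (Phil z _); last by rewrite /= addr_gt0.
      by rewrite /= mulrDr addrC lerD2r ler_wpM2r// ltW.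
    apply: (@le_trans _ _ (T * (l * T)^-1)); last by rewrite invfM mulrCA mulfV ?mulr1// gt_eqF.
    rewrite ler_wpM2l ?(ltW T0)//; apply: le_trans (le_trans (ler_norm _) (Re_le_normc _)) _.
    by rewrite Normc.normcV lef_pV2// posrE// (lt_le_trans lT).
  have := line_integral_le bG Gge GB => H.
  under eq_integral do rewrite /K /= mulrC EFinM.
  rewrite ge0_integralZl//; last 3 first.
  - by apply/measurable_EFinP; exact: (measurable_slice2 s (measurable_poisson mX mY)).
  - by move=> y _; rewrite lee_fin poisson_ge0.
  - by rewrite lee_fin.
  apply: lee_wpmul2l; first by rewrite lee_fin.
  apply: le_trans H; rewrite le_eqVlt; apply/orP; left; apply/eqP.
  apply: eq_integral => y _; congr EFin; rewrite ReG /poisson /X /Y.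
  by rewrite [X in _ / X]addrC -[(s - _) ^+ 2]sqrrN opprB.
have mFp : measurable_fun setT (fun y => Normc.normc (rhp_ext (F \o phi) (x +i* y)) ^+ 2).
  by apply: measurable_funX; exact: (measurable_slice1 x (holo_measurable hFp)).
rewrite -(@lee_pmul2l _ pi%:E)//.
rewrite muleA -EFinM.
rewrite -ge0_integralZl//; last 3 first.
- exact/measurable_EFinP.
- by move=> y _; rewrite lee_fin sqr_ge0.
- by rewrite lee_fin pi_ge0.
apply: (@le_trans _ _ (\int[m]_y \int[m]_s (K (y, s))%:E)%E).
  apply: ge0_le_integral => //.
  - by move=> y _; rewrite mule_ge0// lee_fin ?sqr_ge0// pi_ge0.
  - by apply: measurable_funeM; exact/measurable_EFinP.
  - exact: measurable_iter1.
  - by move=> y _; rewrite -EFinM; exact: step1.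
rewrite fubini_swap// -ge0_integralZl//; last 3 first.
- exact/measurable_EFinP.
- by move=> y _; rewrite lee_fin sqr_ge0.
- by rewrite lee_fin mulr_ge0 ?pi_ge0 ?invr_ge0 ?ltW.
apply: ge0_le_integral => //.
- by move=> s _; apply: integral_ge0 => y _; rewrite lee_fin.
- exact: measurable_iter2.
- by apply: measurable_funeM; exact/measurable_EFinP.
- by move=> s _; rewrite muleC; exact: step2.
Qed.

Lemma line_massE F x : holomorphic F -> line_mass alpha F x =
  ((x `^ alpha)%:E * \int[m]_y (Normc.normc (rhp_ext F (x +i* y)) ^+ 2)%:E)%E.
Proof.
move=> hF; rewrite -ge0_integralZl//.
- apply/measurable_EFinP; apply: measurable_funX.
  exact: (measurable_slice1 x (holo_measurable hF)).
- by move=> y _; rewrite lee_fin sqr_ge0.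
- by rewrite lee_fin powR_ge0.
Qed.

(** The contraction on each vertical line, integrated against [x ^ alpha] after the
    change of variable [x |-> l' x]. *)
Lemma bergman_comp_le_aux F l l' : holomorphic F -> holomorphic (F \o phi) ->
  (bergman_integral alpha F < +oo)%E -> 0 < l' -> l' < l ->
  (forall z, 0 < complex.Re z -> l * complex.Re z <= complex.Re (Phi z)) ->
  (bergman_integral alpha (F \o phi) <=
   (l^-1 * l' `^ (- (1 + alpha)))%:E * bergman_integral alpha F)%E.
Proof.
move=> hF hFp Ffin l'0 ll' Phil; have l0 := lt_trans l'0 ll'.
have Fge := bergman_integral_ge0 alpha F.
have FA : (bergman_integral alpha F <= (fine (bergman_integral alpha F))%:E)%E.
  by rewrite fineK// ge0_fin_numE.
have mL := measurable_line_mass alpha hF.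
have mLp := measurable_line_mass alpha hFp.
have mL' : measurable_fun setT (fun x => line_mass alpha F (l' * x + 0)).
  apply: (measurableT_comp mL); apply: measurable_funD => //; exact: measurable_funM.
have c0 : 0 <= l^-1 * l' `^ (- alpha) by rewrite mulr_ge0 ?invr_ge0 ?(ltW l0) ?powR_ge0.
have main : (\int[m]_x line_mass alpha (F \o phi) x <=
    (l^-1 * l' `^ (- alpha))%:E * \int[m]_x line_mass alpha F (l' * x + 0))%E.
  rewrite -ge0_integralZl//; last by move=> x _; exact: line_mass_ge0.
  apply: ge0_le_integral => //.
  - by move=> x _; exact: line_mass_ge0.
  - exact: measurable_funeM.
  move=> x _; have [x0|x0] := leP x 0.
    rewrite (_ : line_mass alpha (F \o phi) x = 0%E); last first.
      apply: integral0_eq => y _; rewrite /density /= rhp_ext_out ?Normc.normc0 ?expr0n ?mulr0//.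
      by rewrite -leNgt.
    by rewrite mule_ge0 ?lee_fin// line_mass_ge0.
  rewrite addr0 !line_massE// powRM ?(ltW l'0) ?(ltW x0)// muleA -EFinM.
  have -> : l^-1 * l' `^ (- alpha) * (l' `^ alpha * x `^ alpha) = x `^ alpha * l^-1.
    by rewrite powRN; field; rewrite !gt_eqF// powR_gt0.
  rewrite EFinM -muleA; apply: lee_wpmul2l; first by rewrite lee_fin powR_ge0.
  exact: line_contraction FA l'0 ll' x0 Phil.
rewrite !bergman_integral_line_mass// muleCA.
apply: lee_wpmul2l; first by rewrite lee_fin invr_ge0 pi_ge0.
apply: le_trans main _.
rewrite [X in (_ <= _ * X)%E](integral_affine 0 l'0)//; last by move=> x; exact: line_mass_ge0.
rewrite muleA -EFinM le_eqVlt; apply/orP; left; apply/eqP; congr (_%:E * _)%E.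
rewrite -mulrA; congr (_ * _); rewrite opprD powRD ?(gt_eqF l'0) ?implybT//.
by rewrite powR_inv1 ?(ltW l'0)// mulrAC mulVf ?mul1r// gt_eqF.
Qed.

Let le_of_le_div (a b c : R) : 0 <= b ->
  (forall s, 0 < s -> s < 1 -> b <= c / s * a) -> b <= c * a.
Proof.
move=> b0 H; apply: (@le_of_le_add_inv _ _ _ b 2) => // N N2.
have N0 : 0 < N by rewrite (lt_le_trans _ N2).
have N1 : N^-1 < 1 by rewrite invf_lt1// (lt_le_trans _ N2)// ltr1n.
have s0 : 0 < 1 - N^-1 by rewrite subr_gt0.
have := H _ s0; rewrite gtrBl invr_gt0 N0 => /(_ isT); rewrite mulrAC ler_pdivlMr//.
by rewrite mulrBr mulr1 lerBlDr.
Qed.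

Let le_of_le_dive (a b : \bar R) (c : R) : (0 <= a)%E -> (a < +oo)%E -> (0 <= b)%E ->
  (forall s, 0 < s -> s < 1 -> (b <= (c / s)%:E * a)%E) -> (b <= c%:E * a)%E.
Proof.
case: a => // a _ _ b0 H.
have h2 : 0 < 2^-1 :> R by rewrite invr_gt0.
have h3 : 2^-1 < 1 :> R by rewrite invf_lt1// ltr1n.
case: b b0 H => [b b0 H|_ /(_ _ h2 h3)//|//].
by rewrite -EFinM lee_fin; apply: le_of_le_div => // s s0 s1; have := H s s0 s1; rewrite -EFinM lee_fin.
Qed.

(** The limit [l' -> l], with [l' = l s ^ (1 / (1 + alpha))] so that the constant
    exceeds its limit by the factor [1 / s] exactly. *)
Lemma bergman_comp_le F l : holomorphic F -> holomorphic (F \o phi) ->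
  (bergman_integral alpha F < +oo)%E -> 0 < l ->
  (forall z, 0 < complex.Re z -> l * complex.Re z <= complex.Re (Phi z)) ->
  (bergman_integral alpha (F \o phi) <=
   (l `^ (- (2 + alpha)))%:E * bergman_integral alpha F)%E.
Proof.
move=> hF hFp Ffin l0 Phil.
have a1 : 0 < 1 + alpha by rewrite -ltrBlDl sub0r.
have Fge := bergman_integral_ge0 alpha F.
have Fpge := bergman_integral_ge0 alpha (F \o phi).
have H s : 0 < s -> s < 1 -> (bergman_integral alpha (F \o phi) <=
   (l `^ (- (2 + alpha)) / s)%:E * bergman_integral alpha F)%E.
  move=> s0 s1; pose l' := l * s `^ (1 + alpha)^-1.
  have sp : 0 < s `^ (1 + alpha)^-1 by rewrite powR_gt0.
  have l'0 : 0 < l' by rewrite mulr_gt0.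
  have ll' : l' < l.
    rewrite /l' -[ltRHS]mulr1 ltr_pM2l//.
    have : s `^ (1 + alpha)^-1 < 1 `^ (1 + alpha)^-1.
      by apply: gt0_ltr_powR; rewrite ?nnegrE ?invr_gt0 ?(ltW s0).
    by rewrite powR1.
  have := bergman_comp_le_aux hF hFp Ffin l'0 ll' Phil.
  congr (_ <= _%:E * _)%E.
  rewrite /l' powRM ?(ltW l0) ?(ltW sp)// -powRrM mulrN mulVf ?gt_eqF// powR_inv1 ?(ltW s0)//.
  rewrite mulrA; congr (_ / _).
  rewrite -[l^-1](powR_inv1 (ltW l0)) -powRD ?(gt_eqF l0) ?implybT//.
  by congr (_ `^ _); ring.
exact: (le_of_le_dive Fge Ffin Fpge H).
Qed.

End composition_estimate.

(** * Affine self-maps of the half-plane *)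
Section right_half_plane_affine.
Context {R : realType}.
Implicit Types (F : rhp R -> R[i]).

Lemma affine_rhp_subproof (a b : R) (z : rhp R) : 0 < a ->
  0 < complex.Re (a%:C * val z + 0 +i* b).
Proof.
move=> a0; have := valP z; case: (val z) => x y /= x0.
by rewrite mul0r subr0 addr0 mulr_gt0.
Qed.

Definition affine_rhp (a b : R) (a0 : 0 < a) (z : rhp R) : rhp R :=
  Sub (a%:C * val z + 0 +i* b) (affine_rhp_subproof b z a0).

(** As [a > 0], the affine map preserves the complement of the half-plane too, so the
    identity holds in the whole plane. *)
Lemma rhp_ext_affine F a b (a0 : 0 < a) z :
  rhp_ext (F \o affine_rhp b a0) z = rhp_ext F (a%:C * z + 0 +i* b).
Proof.
have [z0|z0] := boolP (0 < complex.Re z).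
  pose zz : rhp R := Sub z z0; have <- : val zz = z by rewrite SubK.
  by rewrite rhp_extE /= -[LHS]rhp_extE /affine_rhp SubK.
rewrite !rhp_ext_out//; case: z z0 => x y /=.
by rewrite mul0r subr0 addr0 pmulr_rgt0.
Qed.

Lemma derivable_affine (f : R[i] -> R[i]) (a b z : R[i]) :
  derivable f (a * z + b) 1 -> derivable (fun t => f (a * t + b)) z 1.
Proof.
move=> df; apply/derivable1_diffP.
have dg : differentiable (fun t : R[i] => a * t + b) z.
  apply/derivable1_diffP; apply: derivable_add; last exact: derivable_const.
  by apply: derivable_mul; [exact: derivable_const|exact: derivable_ident].
by apply: (differentiable_comp dg); exact/derivable1_diffP.
Qed.

Lemma holomorphic_affine F a b (a0 : 0 < a) :
  holomorphic F -> holomorphic (F \o affine_rhp b a0).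
Proof.
move=> hF z; have -> : rhp_ext (F \o affine_rhp b a0) =
    (fun t => rhp_ext F (a%:C * t + 0 +i* b)).
  by apply/funext => t; rewrite rhp_ext_affine.
apply: derivable_affine; apply: holomorphicP => //; exact: affine_rhp_subproof.
Qed.

Lemma holomorphic_restrict (f : R[i] -> R[i]) :
  (forall z, 0 < complex.Re z -> derivable f z 1) -> holomorphic (f \o (val : rhp R -> R[i])).
Proof.
move=> df z; have z0 := valP z.
apply: (@near_eq_derivable _ _ _ f); last exact: df.
have /(@cvgrPdist_lt _ _ _ (nbhs (val z))) /(_ _ z0) := @continuous_Re R (val z).
apply: filterS => w; rewrite ltr_norml => /andP[_]; rewrite ltrBlDr ltrDl => w0.
by rewrite -[in RHS](SubK (rhp R) w0) rhp_extE.
Qed.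

Lemma holomorphic_val : holomorphic (val : rhp R -> R[i]).
Proof. by apply: (@holomorphic_restrict id) => z _; exact: derivable_ident. Qed.

Lemma holomorphic_affine_rhp a b (a0 : 0 < a) : holomorphic (val \o affine_rhp b a0).
Proof. by apply: holomorphic_affine; exact: holomorphic_val. Qed.

End right_half_plane_affine.

Section bergman_functions.
Context {R : realType} (alpha : R) (alpha_gt : -1 < alpha).
Local Notation m := (@lebesgue_measure R).
Local Notation beta := ((2 + alpha) / 2).

Lemma beta_gt0 : 0 < beta.
Proof. by rewrite divr_gt0// -ltrBlDl sub0r (lt_trans _ alpha_gt)// ltrN2 ltr1n. Qed.

Lemma sqr_powR_beta (x : R) : 0 <= x -> (x `^ beta) ^+ 2 = x `^ (2 + alpha).
Proof. by move=> x0; rewrite -powR_mulrn ?powR_ge0// -powRrM divfK. Qed.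

Let norm_le_of_sqr (a b c : R) (A B : \bar R) : (a ^+ 2)%:E = A -> (b ^+ 2)%:E = B ->
  (B <= (c ^+ 2)%:E * A)%E -> 0 <= a -> 0 <= c -> b <= c * a.
Proof.
move=> <- <-; rewrite -EFinM lee_fin -exprMn => h a0 c0; apply: le_trans (ler_norm b) _.
by rewrite -(@ler_pXn2r _ 2)// ?nnegrE ?mulr_ge0// real_normK ?num_real.
Qed.

Lemma bergman_norm_comp (phi : rhp R -> rhp R) (F G : bergman alpha) (l : R) :
  holomorphic (val \o phi) -> G = F \o phi :> (rhp R -> R[i]) -> 0 < l ->
  (forall z, l * complex.Re (val z) <= complex.Re (val (phi z))) ->
  bergman_norm G <= l `^ (- beta) * bergman_norm F.
Proof.
move=> hphi GF l0 lphi.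
have hF := @bergman_holomorphic _ _ F; have hG := @bergman_holomorphic _ _ G.
have Ffin : (bergman_integral alpha F < +oo)%E by have /bergman_predP[] := bergman_funP F.
have nG := bergman_norm_sqr G; rewrite GF in hG nG.
have Phil z : 0 < complex.Re z -> l * complex.Re z <= complex.Re (plane_map phi z).
  by move=> z0; have := lphi (Sub z z0); rewrite -plane_mapE SubK.
apply: (norm_le_of_sqr (bergman_norm_sqr F) nG) (bergman_norm_ge0 F) (powR_ge0 _ _).
rewrite powRN exprVn sqr_powR_beta ?(ltW l0)// -powRN.
exact: (bergman_comp_le alpha_gt hphi hF hG Ffin l0 Phil).
Qed.

(** Affine maps act on the Bergman space with the exact norm [a ^ (- beta)]; as their
    inverses are affine, this inequality contains its converse. *)
Lemma bergman_affine_exists (F : bergman alpha) (a b : R) (a0 : 0 < a) :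
  exists2 G : bergman alpha, G = F \o affine_rhp b a0 :> (rhp R -> R[i]) &
    bergman_norm G <= a `^ (- beta) * bergman_norm F.
Proof.
have hF := @bergman_holomorphic _ _ F.
have hG := @holomorphic_affine _ _ _ b a0 hF.
have Ffin : (bergman_integral alpha F < +oo)%E by have /bergman_predP[] := bergman_funP F.
have low z : a * complex.Re (val z) <= complex.Re (val (affine_rhp b a0 z)).
  by rewrite SubK; case: (val z) => x y /=; rewrite mul0r subr0 addr0.
have GP : F \o affine_rhp b a0 \in bergman_pred alpha.
  apply/bergman_predP; split; first exact: hG.
  apply: le_lt_trans (bergman_comp_le alpha_gt (@holomorphic_affine_rhp _ _ b a0) hF hG Ffin a0 _) _.
    by move=> z z0; have := low (Sub z z0); rewrite -plane_mapE SubK.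
  by apply: (lte_mul_pinfty _ _ Ffin); rewrite ?lee_fin ?powR_ge0.
exists (Bergman GP) => //.
exact: (bergman_norm_comp (@holomorphic_affine_rhp _ _ b a0) _ a0 low).
Qed.

Definition rhp_one : rhp R := @Sub _ _ (rhp R) 1 (ltr01 : 0 < complex.Re (1 : R[i])).

Lemma itgl_powR_le (e : R) : 0 < e -> e < 1 ->
  itgl (fun x => x `^ alpha) e 1 <= (1 + alpha)^-1.
Proof.
move=> e0 e1; have a1 : 0 < 1 + alpha by rewrite -ltrBlDl sub0r.
have pos x : e <= x <= 1 -> 0 < x by move=> /andP[ex _]; exact: lt_le_trans ex.
have dF x : e <= x <= 1 ->
    is_derive x (1 : R) (fun x => (1 + alpha)^-1 * x `^ (1 + alpha)) (x `^ alpha).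
  move=> /pos x0.
  rewrite (_ : (fun x => _) = (1 + alpha)^-1 *: (fun x => x `^ (1 + alpha)))//.
  have := is_derive1_powR (1 + alpha) x0 => D.
  apply: is_derive_eq; rewrite -[LHS]/(_ * _) mulrA mulVf ?gt_eqF// mul1r.
  by congr (_ `^ _); ring.
have cf : cts_on (fun x => x `^ alpha) e 1.
  move=> x /pos x0; apply/differentiable_continuous/derivable1_diffP.
  exact: (@ex_derive _ _ _ _ _ _ _ (is_derive1_powR alpha x0)).
rewrite (itgl_FTC e1 cf dF) powR1 mulr1 gerBl mulr_ge0 ?powR_ge0// invr_ge0 ltW//.
Qed.

Lemma itgl_invsqr_le (n : R) : 1 < n -> itgl (fun x : R => x ^- 2) 1 n <= 1.
Proof.
move=> n1; have pos x : 1 <= x <= n -> 0 < x by move=> /andP[ex _]; exact: lt_le_trans ex.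
have dF x : 1 <= x <= n -> is_derive x (1 : R) (fun x : R => - x^-1) (x ^- 2).
  move=> /pos x0; have D := @is_deriveV R id x 1 1 (lt0r_neq0 x0) (is_derive_id x 1).
  rewrite (_ : (fun x => _) = - (fun x : R => x^-1))//.
  by apply: is_derive_eq; rewrite /= scaleNr opprK [LHS]mulr1.
have cf : cts_on (fun x : R => x ^- 2) 1 n.
  move=> x /pos x0; apply: cvgV; first by rewrite sqrf_eq0 gt_eqF.
  exact: exprn_continuous.
rewrite (itgl_FTC n1 cf dF) invr1 opprK addrC gerBl invr_ge0.
by rewrite (le_trans _ (ltW n1)).
Qed.

Lemma itgl_cauchy_le (n : R) : 0 < n -> itgl (fun y : R => (1 + y ^+ 2)^-1) (- n) n <= pi.
Proof.
move=> n0; have nn : - n < n by rewrite gtrN.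
have cf : cts_on (fun y : R => (1 + y ^+ 2)^-1) (- n) n.
  move=> x _; apply: cvgV; first by rewrite gt_eqF// ltr_pwDl// sqr_ge0.
  by apply: cvgD; [exact: cvg_cst|exact: exprn_continuous].
rewrite (itgl_FTC nn cf (fun x _ => is_derive1_atan x)) atanN opprK.
by rewrite [leRHS]splitr lerD// ltW// atan_ltpi2.
Qed.

End bergman_functions.

(** * A nonzero Bergman function *)
Section nonzero_function.
Context {R : realType} (alpha : R) (alpha_gt : -1 < alpha).
Local Notation m := (@lebesgue_measure R).

Lemma EFin_itgl (f : R -> R) a b : cts_on f a b ->
  (itgl f a b)%:E = (\int[m]_(x in `[a, b]) (f x)%:E)%E.
Proof. by move=> cf; rewrite /itgl /Rintegral fineK//; exact: integrable_fin_num (cts_on_integrable cf). Qed.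

Lemma integral_powR_le : (\int[m]_(x in `]0%R, 1%R]) (x `^ alpha)%:E <= ((1 + alpha)^-1)%:E)%E.
Proof.
have n2 n : 0 < n.+2%:R^-1 :> R by rewrite invr_gt0.
have n2' n : n.+2%:R^-1 < 1 :> R by rewrite invf_lt1// ltr1n.
pose F n : set R := `[n.+2%:R^-1, 1]%classic.
have -> : `]0%R, 1%R]%classic = \bigcup_n F n.
  apply/seteqP; split => [x|x [n _]]; rewrite /F /= !in_itv /=.
    move=> /andP[x0 x1]; exists (Num.bound x^-1) => //; rewrite /= in_itv /= x1 andbT.
    rewrite -[leRHS]invrK lef_pV2 ?posrE ?invr_gt0//.
    have xi : 0 <= x^-1 by rewrite invr_ge0 ltW.
    by rewrite ltW// (lt_le_trans (archi_boundP xi))// ler_nat (leq_trans (leqnSn _)).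
  by move=> /andP[nx ->]; rewrite (lt_le_trans (n2 n)).
apply: (integral_bigcup_le (F := F)).
- by move=> n; exact: measurable_itv.
- move=> i j ij x; rewrite /F /= !in_itv /= => /andP[h ->]; rewrite andbT.
  by apply: le_trans h; rewrite lef_pV2 ?posrE// ler_nat !ltnS.
- exact: measurable_powR.
- by move=> x; exact: powR_ge0.
move=> n; have := itgl_powR_le alpha_gt (n2 n) (n2' n).
rewrite -lee_fin EFin_itgl//.
move=> x /andP[nx _]; apply/differentiable_continuous/derivable1_diffP.
exact: (@ex_derive _ _ _ _ _ _ _ (is_derive1_powR alpha (lt_le_trans (n2 n) nx))).
Qed.

Lemma integral_invsqr_le : (\int[m]_(x in `[1%R, +oo[) (x ^- 2)%:E <= 1%:E)%E.
Proof.
pose F n : set R := `[1, n.+2%:R]%classic.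
have -> : `[1%R, +oo[%classic = \bigcup_n F n.
  apply/seteqP; split => [x|x [n _]]; rewrite /F /= !in_itv /= ?andbT.
    move=> x1; have x0 : 0 <= x by rewrite (le_trans _ x1).
    exists (Num.bound x) => //; rewrite /= in_itv /= x1 /=.
    by rewrite ltW// (lt_le_trans (archi_boundP x0))// ler_nat (leq_trans (leqnSn _)).
  by move=> /andP[].
apply: (integral_bigcup_le (F := F)).
- by move=> n; exact: measurable_itv.
- move=> i j ij x; rewrite /F /= !in_itv /= => /andP[-> h].
  by apply: le_trans h _; rewrite ler_nat !ltnS.
- under eq_fun => x do rewrite -powR_inv1 ?sqr_ge0//.
  by apply: (measurableT_comp (measurable_powR (-1))); exact: measurable_funX.
- by move=> x; rewrite invr_ge0 sqr_ge0.
move=> n; have n2 : 1 < n.+2%:R :> R by rewrite ltr1n.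
have := itgl_invsqr_le n2; rewrite -lee_fin EFin_itgl//.
move=> x /andP[x1 _]; apply: cvgV; last exact: exprn_continuous.
by rewrite sqrf_eq0 gt_eqF// (lt_le_trans ltr01).
Qed.

Lemma continuous_cauchy : continuous (fun y : R => (1 + y ^+ 2)^-1).
Proof.
move=> y; apply: cvgV; first by rewrite gt_eqF// ltr_pwDl// sqr_ge0.
by apply: cvgD; [exact: cvg_cst|exact: exprn_continuous].
Qed.

Lemma integral_cauchy_le : (\int[m]_y ((1 + y ^+ 2)^-1)%:E <= pi%:E)%E.
Proof.
apply: integral_le_trunc.
- exact: continuous_measurable_fun continuous_cauchy.
- by move=> y; rewrite invr_ge0 addr_ge0 ?sqr_ge0.
move=> n; have := itgl_cauchy_le (ltr0Sn R n); rewrite -lee_fin EFin_itgl//.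
by move=> x _; exact: continuous_cauchy.
Qed.

Lemma derivable_pow (f : R[i] -> R[i]) z n : derivable f z 1 -> derivable (fun t => f t ^+ n) z 1.
Proof.
move=> df; elim: n => [|n IH]; first exact: derivable_const.
rewrite (_ : (fun t => _) = (fun t => f t * f t ^+ n)); last by apply/funext => t; rewrite exprS.
by apply: derivable_mul; [exact: df|exact: IH].
Qed.

(** The function [(1 + z) ^ (- (k + 1))] for a large [k]. Since [|1 + z| ^ 2] is at
    least [(1 + x) ^ 2] and at least [1 + y ^ 2], its square is bounded by a product
    of functions of [x] and of [y]; [x ^ alpha] is integrable at 0 because
    [alpha > -1]. *)
Lemma bergman_nonzero : exists F : bergman alpha, F (rhp_one (R := R)) != 0.
Proof.
(* then x ^ alpha / (1 + x) ^ (2 k) is at most x ^ (-2) for x >= 1 *)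
pose k := (Num.bound `|alpha|).+1.
have ak : alpha <= (k.*2)%:R - 2.
  have h := archi_boundP (normr_ge0 alpha).
  apply: (le_trans (ler_norm _)); apply: (le_trans (ltW h)).
  rewrite /k doubleS -[X in _ - X]/(2%:R) -natrB// !subSS subn0 ler_nat.
  by rewrite -addnn leq_addr.
pose f (t : R[i]) := (1 + t)^-1 ^+ k.+1.
pose F := f \o (val : rhp R -> R[i]).
have z1 (z : R[i]) : 0 < complex.Re z -> 1 + z != 0.
  by case: z => a b /= a0; rewrite eq_complex /= negb_and gt_eqF// addr_gt0.
have hF : holomorphic F.
  apply: holomorphic_restrict => z z0; apply: derivable_pow.
  apply: derivable_inv; first exact: z1.
  by apply: derivable_add; [exact: derivable_const|exact: derivable_ident].
have FE x y : 0 < x -> Normc.normc (rhp_ext F (x +i* y)) ^+ 2 = ((1 + x) ^+ 2 + y ^+ 2) ^- k.+1.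
  move=> x0; have x0' : 0 < complex.Re (x +i* y) by [].
  rewrite -[x +i* y](SubK (rhp R) x0') rhp_extE /F /= /f normcX Normc.normcV.
  by rewrite -exprM mulnC exprM exprVn normc_sqr /= add0r -exprVn.
pose g1 := (fun x : R => (x `^ alpha)%:E) \_ `]0%R, 1%R].
pose g2 := (fun x : R => (x ^- 2)%:E) \_ `[1%R, +oo[.
have g10 x : (0 <= g1 x)%E by rewrite /g1 patchE; case: ifPn => // _; rewrite lee_fin powR_ge0.
have g20 x : (0 <= g2 x)%E.
  by rewrite /g2 patchE; case: ifPn => // _; rewrite lee_fin invr_ge0 sqr_ge0.
have mg1 : measurable_fun setT g1.
  apply/(measurable_restrictT _ _).1 => //; apply/measurable_EFinP.
  by apply: measurable_funS (measurable_powR alpha).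
have mg2 : measurable_fun setT g2.
  apply/(measurable_restrictT _ _).1 => //; apply/measurable_EFinP.
  apply: (@measurable_funS _ _ _ _ setT) => //.
  under eq_fun => x do rewrite -powR_inv1 ?sqr_ge0//.
  by apply: (measurableT_comp (measurable_powR (-1))); exact: measurable_funX.
have hbound x : 0 < x -> ((x `^ alpha / ((1 + x) ^+ 2) ^+ k)%:E <= g1 x + g2 x)%E.
  move=> x0; have x1 : 1 <= 1 + x by rewrite lerDl ltW.
  have [xle|xgt] := leP x 1.
    apply: (@le_trans _ _ (g1 x)); last by rewrite leeDl.
    rewrite /g1 patchE mem_set; last by rewrite /= in_itv /= x0.
    rewrite lee_fin -[leRHS]mulr1 ler_wpM2l ?powR_ge0// invf_le1 ?exprn_gt0 ?(lt_le_trans ltr01)//.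
    by rewrite !exprn_ege1.
  apply: (@le_trans _ _ (g2 x)); last by rewrite leeDr.
  rewrite /g2 patchE mem_set; last by rewrite /= in_itv /= andbT ltW.
  rewrite lee_fin ler_pdivrMr ?exprn_gt0 ?(lt_le_trans ltr01)//.
  apply: (@le_trans _ _ (x `^ ((k.*2)%:R - 2))); first by apply: ler_powR => //; exact: ltW.
  rewrite powRB; last by rewrite (gt_eqF x0) implybT.
  rewrite !powR_mulrn ?(ltW x0)// mulrC ler_wpM2l ?invr_ge0 ?sqr_ge0//.
  by rewrite -exprM mul2n ler_pXn2r ?nnegrE ?(ltW x0) ?(le_trans ler01)// ?double_gt0// lerDr.
have LM x : (line_mass alpha F x <= (pi : R)%:E * (g1 x + g2 x))%E.
  have [x0|x0] := leP x 0.
    rewrite (_ : line_mass alpha F x = 0%E); last first.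
      apply: integral0_eq => y _; rewrite /density /= rhp_ext_out ?Normc.normc0 ?expr0n ?mulr0//.
      by rewrite -leNgt.
    by rewrite mule_ge0 ?adde_ge0// lee_fin pi_ge0.
  have mC : measurable_fun setT (fun y : R => (1 + y ^+ 2)^-1).
    exact: continuous_measurable_fun continuous_cauchy.
  have c0 : 0 <= x `^ alpha / ((1 + x) ^+ 2) ^+ k.
    by rewrite divr_ge0 ?powR_ge0// exprn_ge0// sqr_ge0.
  have C0 y : 0 <= (1 + y ^+ 2)^-1 :> R by rewrite invr_ge0 addr_ge0 ?sqr_ge0.
  apply: (@le_trans _ _ (\int[m]_y ((x `^ alpha / ((1 + x) ^+ 2) ^+ k)%:E * ((1 + y ^+ 2)^-1)%:E))%E).
    apply: ge0_le_integral => //.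
    - by move=> y _; rewrite lee_fin density_ge0.
    - by apply/measurable_EFinP; exact: (measurable_slice1 x (measurable_density alpha hF)).
    - by apply: measurable_funeM; exact/measurable_EFinP.
    move=> y _; rewrite -EFinM lee_fin /density /= FE// -mulrA ler_wpM2l ?powR_ge0//.
    have p1 : 0 < (1 + x) ^+ 2 by rewrite exprn_gt0// addr_gt0.
    have p2 : 0 < 1 + y ^+ 2 by rewrite ltr_pwDl// sqr_ge0.
    have p3 : 0 < (1 + x) ^+ 2 + y ^+ 2 by rewrite ltr_pwDl// sqr_ge0.
    have p4 : 0 < ((1 + x) ^+ 2) ^+ k * (1 + y ^+ 2) by apply: mulr_gt0 => //; exact: exprn_gt0.
    have p5 : 0 < ((1 + x) ^+ 2 + y ^+ 2) ^+ k.+1 by exact: exprn_gt0.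
    have q1 : 0 <= ((1 + x) ^+ 2) ^+ k by apply: exprn_ge0; exact: ltW.
    have q2 : ((1 + x) ^+ 2) ^+ k <= ((1 + x) ^+ 2 + y ^+ 2) ^+ k.
      by apply: lerXn2r; rewrite ?nnegrE ?(ltW p1) ?(ltW p3)// lerDl sqr_ge0.
    have q3 : 1 + y ^+ 2 <= (1 + x) ^+ 2 + y ^+ 2.
      by rewrite lerD2r exprn_ege1// lerDl ltW.
    by rewrite -invfM lef_pV2// (exprSr ((1 + x) ^+ 2 + y ^+ 2) k); exact: ler_pM q1 (ltW p2) q2 q3.
  rewrite ge0_integralZl//; last 2 first.
  - exact/measurable_EFinP.
  - by move=> y _; rewrite lee_fin.
  rewrite muleC; apply: lee_pmul => //; [|exact: integral_cauchy_le|exact: hbound].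
  by apply: integral_ge0 => y _; rewrite lee_fin.
have FP : F \in bergman_pred alpha.
  apply/bergman_predP; split; first exact: hF.
  have h1 := integral_powR_le; have h2 := integral_invsqr_le.
  have : (\int[m]_x line_mass alpha F x <= (pi * ((1 + alpha)^-1 + 1))%:E)%E.
    apply: (@le_trans _ _ (\int[m]_x ((pi : R)%:E * (g1 x + g2 x)))%E).
      apply: ge0_le_integral => //.
      - by move=> x _; exact: line_mass_ge0.
      - exact: measurable_line_mass.
      - by apply: measurable_funeM; exact: emeasurable_funD.
    rewrite ge0_integralZl//; last 3 first.
    - exact: emeasurable_funD.
    - by move=> x _; rewrite adde_ge0.
    - by rewrite lee_fin pi_ge0.
    rewrite ge0_integralD// EFinM; apply: lee_wpmul2l; first by rewrite lee_fin pi_ge0.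
    by rewrite EFinD; apply: leeD; rewrite -integral_mkcond.
  rewrite bergman_integral_line_mass// => /le_lt_trans /(_ (ltry _)).
  by move=> /(@lte_mul_pinfty _ (pi^-1)%:E); apply => //; rewrite lee_fin invr_ge0 pi_ge0.
exists (Bergman FP); rewrite /= /F /= /f; apply: expf_neq0; rewrite invr_eq0.
by apply: (z1 1); exact: ltr01.
Qed.

End nonzero_function.

(** * The norm of point evaluations *)
Section evaluation.
Context {R : realType} (alpha : R) (alpha_gt : -1 < alpha).
Local Notation beta := ((2 + alpha) / 2).
Local Notation V := (bergman alpha).
Local Notation one := (rhp_one (R := R)).

(** The norm of the evaluation at 1. By affine invariance the one at [w] has the norm
    [eval_const * Re w ^ (- beta)]: [eval_le] is one inequality, and
    [eval_test_function] the other. *)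
Definition eval_const : R := sup [set Normc.normc (F one) | F in [set F : V | bergman_norm F <= 1]].
Local Notation c := eval_const.

Lemma eval_set_has_sup :
  has_sup [set Normc.normc (F one) | F in [set F : V | bergman_norm F <= 1]].
Proof.
split.
  exists (Normc.normc ((0 : V) one)); exists (0 : V) => //=.
  have -> : bergman_norm (0 : V) = 0 by apply: complexI; rewrite -bergman_normE normr0.
  exact: ler01.
have [D D0 DP] := pointwise_bergman alpha.
exists (Num.max 1 D) => _ [F /= F1 <-].
have F1' : (bergman_integral alpha F <= 1%:E)%E.
  by rewrite -bergman_norm_sqr lee_fin exprn_ile1// bergman_norm_ge0.
have := DP F 1 0 1 (@bergman_holomorphic _ _ F) ltr01 F1'.
rewrite powR1 !mulr1 (_ : 1 +i* 0 = val one); last by rewrite SubK.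
rewrite rhp_extE => h; set t := Normc.normc _ in h *.
have [t1|t1] := leP t 1; first by rewrite le_max t1.
rewrite le_max; apply/orP; right; apply: le_trans h.
by rewrite expr2 ler_peMr ?(ltW t1)// (le_trans ler01 (ltW t1)).
Qed.

Lemma eval_one_le (F : V) : Normc.normc (F one) <= c * bergman_norm F.
Proof.
have [F0|F0] := eqVneq (bergman_norm F) 0.
  rewrite F0 mulr0 (bergman_norm_eq0 F0) (_ : (0 : V) one = 0)//.
  by rewrite Normc.normc0.
have p : 0 < bergman_norm F by rewrite lt_def F0 bergman_norm_ge0.
rewrite -ler_pdivrMr//; apply: ub_le_sup; first exact: eval_set_has_sup.2.
have nk : Normc.normc (bergman_norm F)^-1%:C = (bergman_norm F)^-1.
  by rewrite /= expr0n addr0 sqrtr_sqr ger0_norm// invr_ge0 ltW.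
exists ((bergman_norm F)^-1%:C *: F); first by rewrite /= bergman_normZ nk mulVf.
by rewrite -[(_ *: F) one]/((bergman_norm F)^-1%:C * F one) Normc.normcM nk mulrC.
Qed.

Lemma eval_const_gt0 : 0 < c.
Proof.
have [F F1] := bergman_nonzero alpha_gt.
have := eval_one_le F; have : 0 < Normc.normc (F one) by rewrite normc_gt0.
move=> p /(lt_le_trans p) h; have := bergman_norm_ge0 F.
by rewrite le_eqVlt => /predU1P[E|/pmulr_lgt0 <-//]; move: h; rewrite -E mulr0 ltxx.
Qed.

Lemma eval_le (F : V) (w : rhp R) :
  Normc.normc (F w) <= c * complex.Re (val w) `^ (- beta) * bergman_norm F.
Proof.
have w0 := valP w.
have [G GE Gn] := bergman_affine_exists alpha_gt F (complex.Im (val w)) w0.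
have -> : F w = G one.
  rewrite GE /=; congr (bergman_fun F _); apply/val_inj; rewrite SubK SubK.
  by rewrite mulr1; apply/eqP; rewrite eq_complex /= addr0 add0r !eqxx.
apply: le_trans (eval_one_le G) _; rewrite -mulrA ler_wpM2l//.
exact: ltW eval_const_gt0.
Qed.

Lemma eval_test_function (w : rhp R) (e : R) : 0 < e ->
  exists2 G : V, bergman_norm G <= 1 &
    (c - e) * complex.Re (val w) `^ (- beta) <= Normc.normc (G w).
Proof.
move=> e0; have w0 := valP w; set a := complex.Re (val w); set b := complex.Im (val w).
have [_ [F /= F1 <-] Fc] := sup_adherent e0 eval_set_has_sup.
have ai : 0 < a^-1 by rewrite invr_gt0.
have [H HE Hn] := bergman_affine_exists alpha_gt F (- b / a) ai.
have k0 : 0 <= a `^ (- beta) by exact: powR_ge0.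
have nk : Normc.normc (a `^ (- beta))%:C = a `^ (- beta).
  by rewrite /= expr0n addr0 sqrtr_sqr ger0_norm.
exists ((a `^ (- beta))%:C *: H).
  rewrite bergman_normZ nk; apply: le_trans (ler_wpM2l k0 Hn) _.
  rewrite mulrA -powRM ?(ltW w0) ?(ltW ai)// mulfV ?gt_eqF// powR1 mul1r.
  exact: F1.
rewrite -[(_ *: H) w]/((a `^ (- beta))%:C * H w) Normc.normcM nk mulrC ler_wpM2l//.
have -> : H w = F one; last exact: ltW.
rewrite HE /=; congr (bergman_fun F _); apply/val_inj; rewrite SubK SubK /a /b.
move: w0; case: (val w) => x y /= x0; apply/eqP; rewrite eq_complex /=.
by apply/andP; split; apply/eqP; field; rewrite gt_eqF.
Qed.

End evaluation.

(** * Operator norms and compact operators *)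
Lemma eq_operator_norm (R : realType) (V : normedModType R[i]) (T S : {linear V -> V}) :
  (forall v, T v = S v) -> operator_norm T = operator_norm S.
Proof.
by move=> TS; congr (sup _); apply/seteqP; split=> _ [v v1 <-]; exists v => //; rewrite TS.
Qed.

Section operators.
Context {R : realType} (alpha : R) (alpha_gt : -1 < alpha).
Local Notation beta := ((2 + alpha) / 2).
Local Notation V := (bergman alpha).
Implicit Types (T Q : {linear V -> V}) (v u : V).

Lemma bergman_normN v : bergman_norm (- v) = bergman_norm v.
Proof. by rewrite -scaleN1r bergman_normZ normcN Normc.normc1 mul1r. Qed.

Lemma bergman_norm0 : bergman_norm (0 : V) = 0.
Proof. by rewrite -(scale0r (0 : V)) bergman_normZ Normc.normc0 mul0r. Qed.

Lemma unit_ballE v : (`|v| <= 1) = (bergman_norm v <= 1).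
Proof. by rewrite bergman_normE lecR. Qed.

Lemma operator_norm_le T (N : R) : 
  (forall v, bergman_norm v <= 1 -> bergman_norm (T v) <= N) -> operator_norm T <= N.
Proof.
move=> TN; apply: ge_sup => [|_ [v /= + <-]]; last by rewrite unit_ballE => /TN.
by exists (complex.Re `|T 0|), 0 => //=; rewrite normr0.
Qed.

Lemma le_operator_norm T (N : R) : (forall v, bergman_norm v <= 1 -> bergman_norm (T v) <= N) ->
  forall v, bergman_norm v <= 1 -> bergman_norm (T v) <= operator_norm T.
Proof.
move=> TN v v1; apply: ub_le_sup; last by exists v => //=; rewrite unit_ballE.
by exists N => _ [u /= + <-]; rewrite unit_ballE => /TN.
Qed.

Lemma compact_operator_net Q (e : R) : compact_operator Q -> 0 < e ->
  exists s : seq V, forall v, bergman_norm v <= 1 ->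
    exists2 u, u \in s & bergman_norm (Q v - u) <= e.
Proof.
rewrite /compact_operator precompactE compact_cover => cK e0.
have e0' : 0 < e%:C by rewrite ltcR.
have [||D _ DK] := cK V setT (fun u => ball u e%:C).
- by move=> u _; exact: ball_open.
- by move=> u _; exists u => //; exact: ballxx.
exists (finmap.enum_fset D) => v v1.
have : closure (Q @` [set v | `|v| <= 1]) (Q v).
  by apply: subset_closure; exists v => //=; rewrite unit_ballE.
move=> /DK [u /= uD]; rewrite -ball_normE /= => uv; exists u => //.
by rewrite -lecR -bergman_normE distrC ltW.
Qed.

Lemma compact_operator_bounded Q : compact_operator Q ->
  exists N : R, forall v, bergman_norm v <= 1 -> bergman_norm (Q v) <= N.
Proof.
move=> cQ; have [s sP] := compact_operator_net cQ ltr01.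
exists (1 + \sum_(u <- s) bergman_norm u) => v /sP[u us Qu].
rewrite -[Q v](subrK u); apply: le_trans (bergman_normD _ _) _; apply: lerD => //.
rewrite (big_rem u)//= lerDl; apply: sumr_ge0 => w _; exact: bergman_norm_ge0.
Qed.

Lemma compact_operator0 : compact_operator (\0 : {linear V -> V}).
Proof.
rewrite /compact_operator; apply: (@precompact_subset _ _ [set (0 : V)]).
  by move=> _ [v _ <-].
apply: compact_precompact; last exact: compact_set1.
exact: norm_hausdorff.
Qed.

End operators.

(** * The lower bound for essential norms *)
Section lower_bound.
Context {R : realType} (alpha : R) (alpha_gt : -1 < alpha).
Local Notation beta := ((2 + alpha) / 2).
Local Notation V := (bergman alpha).
Variables (phi : rhp R -> rhp R) (hphi : holomorphic (val \o phi)).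

Definition rhp_pt (x y : R) (x0 : 0 < x) : rhp R :=
  @Sub _ _ (rhp R) (x +i* y) (x0 : 0 < complex.Re (x +i* y)).

(** Far to the right on a horizontal line, every function of a finite set becomes
    negligible against the norm of the evaluation. *)
Lemma net_evaluation_small (s : seq V) (y e : R) : 0 < e ->
  exists N : nat, forall n, (N <= n)%N -> forall u, u \in s ->
    Normc.normc (rhp_ext u ((5 ^+ n) +i* y)) * (5 ^+ n) `^ beta <= e.
Proof.
move=> e0; have [D D0 DP] := pointwise_strip alpha.
elim: s => [|u s [N NP]]; first by exists 0.
have hu := @bergman_holomorphic _ _ u.
have ufin : (bergman_integral alpha u < +oo)%E by have /bergman_predP[] := bergman_funP u.
have e1 : 0 < e ^+ 2 / D by rewrite divr_gt0// exprn_gt0.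
have [M MP] := strip_mass_cvg0 hu ufin e1.
exists (maxn N M) => n; rewrite geq_max => /andP[Nn Mn] t; rewrite inE => /predU1P[->|]; last exact: NP.
have x0 : 0 < 5 ^+ n :> R by rewrite exprn_gt0.
have := DP u _ y _ hu x0 (MP n Mn).
rewrite -sqr_powR_beta ?(ltW x0)// -exprMn [D * _]mulrC divfK ?gt_eqF//.
by rewrite ler_pXn2r// ?nnegrE ?mulr_ge0 ?normc_ge0 ?powR_ge0// ltW.
Qed.

(** By Julia's lemma the quotient only grows when [z] moves to the right on its
    horizontal line, so [z] is replaced by a remote [w]. Let [G] almost attain the
    norm of the evaluation at [phi w], and so the value [C G w]. The image of the
    unit ball under [Q] lies near a finite set, whence [Q G w] is negligible
    there, and [N] times the norm of the evaluation at [w] bounds [C G w]. *)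
Lemma essential_lower_bound (C Q : {linear V -> V}) (N : R) (z : rhp R) :
  composition_operator phi C -> compact_operator Q ->
  (forall v, bergman_norm v <= 1 -> bergman_norm (C v - Q v) <= N) ->
  (complex.Re (val z) / complex.Re (val (phi z))) `^ beta <= N.
Proof.
move=> CP cQ CQN; pose c := eval_const alpha.
have c0 : 0 < c := eval_const_gt0 alpha_gt.
have z0 := valP z; have phiz0 := valP (phi z).
set y := complex.Im (val z); set x := complex.Re (val z); set r := complex.Re (val (phi z)).
have r0 : 0 < x / r by rewrite divr_gt0.
have b0 := beta_gt0 alpha_gt.
rewrite -(ler_pM2r c0).
apply: (@le_of_le_add_inv _ _ _ (1 + c + (x / r) `^ beta) 1) => // K K1.
have K0 : 0 < K by rewrite (lt_le_trans _ K1).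
pose e := K^-1; have e0 : 0 < e by rewrite invr_gt0.
have [s sP] := compact_operator_net cQ e0.
have [M MP] := net_evaluation_small s y e0.
pose n := (maxn M (Num.bound x)).
have Mn : (M <= n)%N by rewrite leq_maxl.
pose X : R := 5 ^+ n; have X0 : 0 < X by rewrite exprn_gt0.
have xX : x <= X.
  apply: (@le_trans _ _ n%:R); last by rewrite /X -natrX ler_nat ltnW// ltn_expl.
  rewrite (le_trans (ltW (archi_boundP (ltW z0))))// ler_nat leq_maxr//.
pose w := rhp_pt y X0; set a := complex.Re (val (phi w)).
have a0 : 0 < a := valP (phi w).
have xr : x / r <= X / a.
  have := @half_plane_map_julia _ (plane_map phi) y x X
    (plane_map_derivable hphi) (@plane_map_Re _ phi) z0 xX.
  have -> : x +i* y = val z by rewrite /x /y ReImK.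
  have -> : X +i* y = val w by rewrite SubK.
  rewrite !plane_mapE -/a -/r => h.
  by rewrite -[x / r]invf_div -[X / a]invf_div lef_pV2 ?posrE ?divr_gt0.
have [G G1 Gw] := eval_test_function alpha_gt (phi w) e0.
have [u us Qu] := sP G G1.
have Xb : 0 < X `^ beta by rewrite powR_gt0.
have CG : C G w = G (phi w) by rewrite CP.
have E1 := eval_le alpha_gt (C G - Q G) w.
have E2 := eval_le alpha_gt (Q G - u) w.
have E3 := MP n Mn u us; rewrite -/X in E3.
have wE : complex.Re (val w) = X by rewrite SubK.
have uE : rhp_ext u (X +i* y) = u w by rewrite -rhp_extE SubK.
rewrite uE in E3; rewrite wE in E1 E2.
have split3 : C G w = (C G - Q G : V) w + ((Q G - u : V) w + u w).
  by rewrite -[(C G - Q G : V) w]/(C G w - Q G w) -[(Q G - u : V) w]/(Q G w - u w) subrK subrK.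
have T1 : Normc.normc ((C G - Q G : V) w) * X `^ beta <= c * N.
  rewrite -ler_pdivlMr//; apply: le_trans E1 _; rewrite -/c powRN mulrAC ler_wpM2r ?invr_ge0 ?(ltW Xb)//.
  by rewrite ler_wpM2l ?(ltW c0)// CQN.
have T2 : Normc.normc ((Q G - u : V) w) * X `^ beta <= c * e.
  rewrite -ler_pdivlMr//; apply: le_trans E2 _; rewrite -/c powRN mulrAC ler_wpM2r ?invr_ge0 ?(ltW Xb)//.
  by rewrite ler_wpM2l ?(ltW c0)// Qu.
have T : Normc.normc (C G w) * X `^ beta <= c * N + (c * e + e).
  rewrite split3; apply: le_trans (ler_wpM2r (ltW Xb) (le_normcD _ _)) _.
  rewrite mulrDl; apply: lerD => //.
  apply: le_trans (ler_wpM2r (ltW Xb) (le_normcD _ _)) _.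
  by rewrite mulrDl; apply: lerD.
have L : (c - e) * (X / a) `^ beta <= Normc.normc (C G w) * X `^ beta.
  rewrite CG; apply: le_trans (ler_wpM2r (ltW Xb) Gw).
  rewrite -/c -/a powRN -mulrA powRM ?(ltW X0) ?invr_ge0 ?(ltW a0)//.
  have -> : a^-1 `^ beta = (a `^ beta)^-1.
    by rewrite -powR_inv1 ?(ltW a0)// -powRrM mulN1r powRN.
  by rewrite [X in _ * X <= _]mulrC.
have N0 : 0 <= N.
  have := CQN 0; rewrite bergman_norm0.
  by move=> /(_ ler01); apply: le_trans; exact: bergman_norm_ge0.
have p0 : 0 <= (x / r) `^ beta by exact: powR_ge0.
have pX : (x / r) `^ beta <= (X / a) `^ beta.
  by apply: ge0_ler_powR; rewrite ?nnegrE ?(ltW b0) ?(ltW r0)// divr_ge0 ?ltW.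
rewrite -/e; have [ce|ce] := leP e c; last first.
  apply: (@le_trans _ _ ((x / r) `^ beta * e)); first by rewrite ler_wpM2l// ltW.
  apply: (@le_trans _ _ ((1 + c + (x / r) `^ beta) * e)).
    by rewrite ler_wpM2r ?(ltW e0)// lerDr addr_ge0// ltW.
  by rewrite lerDr mulr_ge0// ltW.
have ce0 : 0 <= c - e by rewrite subr_ge0.
have := le_trans (ler_wpM2l ce0 pX) (le_trans L T).
by move: ((x / r) `^ beta) => p; clear; lra.
Qed.

End lower_bound.

Theorem theorem3p6 (R : realType) (alpha : R) (alpha_gt : -1 < alpha) :
  (forall (phi : rhp R -> rhp R)
      (C : {linear bergman alpha -> bergman alpha}),
    holomorphic (val \o phi) -> composition_operator phi C ->
    bounded_operator C ->
    essential_norm C = operator_norm C) /\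
  (forall (phi : rhp R -> rhp R)
      (C : {linear bergman alpha -> bergman alpha}),
    holomorphic (val \o phi) -> composition_operator phi C ->
    ~ compact_operator C).
Proof.
have b0 := beta_gt0 alpha_gt.
split=> phi C hphi CP; last first.
  move=> cC; pose rho := complex.Re (val (rhp_one (R := R))) / complex.Re (val (phi rhp_one)).
  have rho0 : 0 < rho by exact: divr_gt0 (valP rhp_one) (valP (phi rhp_one)).
  suff : rho `^ ((2 + alpha) / 2) <= 0 by apply/negP; rewrite -ltNge powR_gt0.
  apply: (essential_lower_bound alpha_gt hphi rhp_one CP cC) => v _.
  by rewrite subrr bergman_norm0.
move=> [M CM].
have CB v : bergman_norm v <= 1 -> bergman_norm (C v) <= `|M|.
  move=> v1; have := CM v; rewrite !bergman_normE -rmorphM lecR => /le_trans; apply.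
  apply: le_trans (ler_wpM2r (bergman_norm_ge0 v) (ler_norm M)) _.
  by rewrite -[leRHS]mulr1 ler_wpM2l.
have lower (Q : {linear bergman alpha -> bergman alpha}) : compact_operator Q ->
    operator_norm C <= operator_norm (C \- Q).
  move=> cQ; have [K QK] := compact_operator_bounded cQ.
  have CQB v : bergman_norm v <= 1 -> bergman_norm ((C \- Q) v) <= `|M| + K.
    move=> v1; apply: le_trans (bergman_normD (C v) (- Q v)) _.
    by rewrite bergman_normN; apply: lerD; [exact: CB|exact: QK].
  pose N := operator_norm (C \- Q).
  have CQN := le_operator_norm CQB.
  have rhoN z := essential_lower_bound alpha_gt hphi z CP cQ CQN.
  have N0 : 0 < N.
    apply: lt_le_trans (rhoN rhp_one); apply: powR_gt0.
    exact: divr_gt0 (valP rhp_one) (valP (phi rhp_one)).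
  (* the constant for which the upper bound is N *)
  pose l := N `^ (- ((2 + alpha) / 2)^-1).
  have l0 : 0 < l by rewrite powR_gt0.
  apply: operator_norm_le => v v1.
  rewrite -/N; have -> : N = l `^ (- ((2 + alpha) / 2)).
    by rewrite /l -powRrM mulrNN mulVf ?gt_eqF// powRr1// ltW.
  apply: le_trans (bergman_norm_comp alpha_gt hphi (CP v) l0 _) _; last first.
    by rewrite -[leRHS]mulr1 ler_wpM2l// powR_ge0.
  move=> z; have z0 := valP z; have p0 := valP (phi z).
  rewrite -ler_pdivlMr// /l powRN -[leRHS]invf_div lef_pV2 ?posrE ?powR_gt0 ?divr_gt0//.
  have rho0 : 0 < complex.Re (val z) / complex.Re (val (phi z)) by rewrite divr_gt0.
  move: (rhoN z) rho0; set rho := _ / _ => h rho0.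
  have -> : rho = (rho `^ ((2 + alpha) / 2)) `^ ((2 + alpha) / 2)^-1.
    by rewrite -powRrM mulfV ?gt_eqF// powRr1// ltW.
  by apply: ge0_ler_powR; rewrite ?nnegrE ?powR_ge0 ?invr_ge0 ?(ltW b0) ?(ltW N0).
have C0 : [set operator_norm (C \- Q) | Q in compact_operator] (operator_norm C).
  exists (\0 : {linear bergman alpha -> bergman alpha}); first exact: compact_operator0.
  by apply: eq_operator_norm => v; exact: subr0.
apply/eqP; rewrite eq_le; apply/andP; split.
  apply: ge_inf => //; exists (operator_norm C) => _ [Q cQ <-]; exact: lower.
apply: lb_le_inf; first by exists (operator_norm C).
by move=> _ [Q cQ <-]; exact: lower.
Qed.
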